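(* Suppose that, for some $k\ge1$, $$(\lambda_k^0-1)(\lambda_k^\infty-1)<0\quad\text{and}\quad\boldsymbol\alpha\in\mathcal A_{\gamma_k}.$$ Then the problem $-u''=g(\cdot,u)u$ on $(-1,1)$, $u\in X$, has solutions $u_k^+\in T_k^+$ and $u_k^-\in T_k^-$.
   Context: Integers $m^\pm\ge1$ and points $\eta_i^\pm\in[-1,1]$, $i=1,\dots,m^\pm$, with $\eta_i^+\ne1$, $\eta_i^-\ne-1$, are fixed. The coefficients are $\alpha^\pm=(\alpha_1^\pm,\dots,\alpha_{m^\pm}^\pm)\in\mathbb R^{m^\pm}$, $\boldsymbol\alpha=(\alpha^-,\alpha^+)$. For $\alpha\in\mathbb R^m$, $|\alpha|:=\sum_{i=1}^m|\alpha_i|$. For $\gamma>0$, $\mathcal A_\gamma:=\{\boldsymbol\alpha:|\alpha^-|<\gamma\text{ and }|\alpha^+|<\gamma\}$. $X:=\{u\in C^2[-1,1]: u(\pm1)=\sum_{i=1}^{m^\pm}\alpha_i^\pm u(\eta_i^\pm)\}$ (both boundary conditions hold), with the $C^2$ norm; $Y:=C^0[-1,1]$ with the sup norm; $\Delta:X\to Y$, $\Delta u:=u''$. It is known that if $|\alpha^\pm|<1$ then $\Delta$ is bijective with continuous inverse, and $\Delta^{-1}:Y\to C^1[-1,1]$ is compact; put $K_ru:=-\Delta^{-1}(ru)$, $u\in Y$. For $k\ge1$ and $\nu\in\{+,-\}$, $T_k^\nu\subset X$ is the set of $u\in X$ such that: (a) $u'(\pm1)\ne0$ and $\nu u'(-1)>0$;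 (b) $u'$ has only simple zeros in $(-1,1)$, and has exactly $k$ such zeros; (c) $u$ has a zero strictly between each pair of consecutive zeros of $u'$. Put $T_k:=T_k^+\cup T_k^-$. Eigenvalues: for $r\in C^1[-1,1]$, $r>0$, a number $\lambda\in\mathbb R$ is an eigenvalue if $-u''=\lambda ru$ has a non-trivial solution $u\in X$; it is simple if $\dim\bigcup_{l\ge1}N((I_Y-\lambda K_r)^l)=1$, where $N$ denotes null-space and $I_Y$ the identity on $Y$. For each such $r$ there exists a constant $\gamma(r)\in(0,1]$ such that, whenever $\boldsymbol\alpha\in\mathcal A_{\gamma(r)}$, the set of eigenvalues consists of a strictly increasing sequence of simple eigenvalues $\lambda_k(r)>0$, $k\ge1$, with $\lambda_k(r)\to\infty$, and $\lambda_k(r)$ has an eigenfunction in $T_k^+$. Here $\gamma(r)$ denotes such a (fixed) constant. Assumptions on $g$: $g\in C^1([-1,1]\times\mathbb R,\mathbb R)$, and there exist $r_0,r_\infty\in C^1[-1,1]$ with $\lim_{\xi\to0}g(x,\xi)=r_0(x)>0$ and $\lim_{|\xi|\to\infty}g(x,\xi)=r_\infty(x)>0$, uniformly for $x\in[-1,1]$, and $\sup|g_x|+\sup|\xi g_\xi|<\infty$ (suprema over $(x,\xi)\in[-1,1]\times\mathbb R$). $g_{\min}$ denotes the infimum of $g$ over $[-1,1]\times\mathbb R$. It is assumed throughout that $|\alpha^\pm|<\min\{\gamma(r_0),\gamma(r_\infty)\}$, and $\lambda_k^0:=\lambda_k(r_0)$, $\lambda_k^\infty:=\lambda_k(r_\infty)$.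 $\mathcal S$ is the set of non-trivial ($u\neq0$) solutions $(\lambda,u)\in(0,\infty)\times X$ of $-u''=\lambda g(\cdot,u)u$ on $(-1,1)$. For each $\Lambda>0$, $\gamma_{g,\Lambda}\in(0,1)$ denotes a fixed constant with the property that if $\boldsymbol\alpha\in\mathcal A_{\gamma_{g,\Lambda}}$ and $(\lambda,u)\in\mathcal S$ with $\lambda\le\Lambda$ then $u\in T_j$ for some $j\ge1$. Put $\Lambda(k):=g_{\min}^{-1}\big((k+2)\pi/2\big)^2$ and $\gamma_k:=\gamma_{g,\Lambda(k)}$. *)

(* Defs.v *)
From Stdlib Require Import Reals List ClassicalEpsilon.
From Coquelicot Require Import Coquelicot.
Open Scope R_scope.

(* A function on [-1,1] is represented by a total function R -> R.  No
   definition below depends on its values outside [-1,1]; accordingly equality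
   of functions, and being non-zero, refer to [-1,1] only. *)
Definition J (x : R) : Prop := -1 <= x <= 1.

Definition eq_on_J (u v : R -> R) : Prop := forall x, J x -> u x = v x.

Definition nonzero (u : R -> R) : Prop := exists x, J x /\ u x <> 0.

Definition positive_on_J (r : R -> R) : Prop := forall x, J x -> 0 < r x.

(* Derivatives are relative to [-1,1], hence one-sided at -1 and at 1; [deriv]
   is meaningful at x only when [derivable_at u x] holds. *)
Definition derivable_at (u : R -> R) (x : R) : Prop :=
  exists l, D_in u (fun _ => l) J x.

Definition deriv (u : R -> R) (x : R) : R :=
  iota (fun l : R => D_in u (fun _ => l) J x).

Definition C0_J (u : R -> R) : Prop := continuous_on J u.

Definition C1_J (u : R -> R) : Prop :=
  (forall x, J x -> derivable_at u x) /\ C0_J (deriv u).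

Definition C2_J (u : R -> R) : Prop :=
  (forall x, J x -> derivable_at u x) /\ C1_J (deriv u).

Definition Delta (u : R -> R) : R -> R := deriv (deriv u).

(* The superscripts + and -. *)
Inductive side : Set := Plus | Minus.

Definition sgn (s : side) : R := match s with Plus => 1 | Minus => -1 end.

(* The numbers m^s, the points eta_i^s and the coefficients alpha_i^s are given
   by m s, eta s i and alpha s i; only the indices 1 <= i <= m s matter. *)
Definition valid_points (m : side -> nat) (eta : side -> nat -> R) : Prop :=
  forall s, (1 <= m s)%nat /\
    forall i, (1 <= i <= m s)%nat -> J (eta s i) /\ eta s i <> sgn s.

Definition norm1 (n : nat) (a : nat -> R) : R :=
  sum_n_m (fun i => Rabs (a i)) 1 n.

Definition calA (m : side -> nat) (gamma : R) (alpha : side -> nat -> R) : Prop :=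
  forall s, norm1 (m s) (alpha s) < gamma.

Definition spaceX (m : side -> nat) (eta alpha : side -> nat -> R) (u : R -> R) : Prop :=
  C2_J u /\
  forall s, u (sgn s) = sum_n_m (fun i => alpha s i * u (eta s i)) 1 (m s).

Definition nodalT (m : side -> nat) (eta alpha : side -> nat -> R)
    (k : nat) (nu : side) (u : R -> R) : Prop :=
  spaceX m eta alpha u /\
  deriv u (-1) <> 0 /\ deriv u 1 <> 0 /\ 0 < sgn nu * deriv u (-1) /\
  (forall x, -1 < x < 1 -> deriv u x = 0 -> Delta u x <> 0) /\
  (exists zs : list R, NoDup zs /\ length zs = k /\
     forall x, In x zs <-> -1 < x < 1 /\ deriv u x = 0) /\
  (forall x y, -1 < x -> x < y -> y < 1 -> deriv u x = 0 -> deriv u y = 0 ->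
     (forall z, x < z < y -> deriv u z <> 0) ->
     exists z, x < z < y /\ u z = 0).

(* Meaningful when Delta : X -> Y is bijective, in particular when
   |alpha^+| < 1 and |alpha^-| < 1. *)
Definition Delta_inv (m : side -> nat) (eta alpha : side -> nat -> R)
    (h : R -> R) : R -> R :=
  epsilon (inhabits (fun _ : R => 0))
    (fun v => spaceX m eta alpha v /\ eq_on_J (Delta v) h).

Definition opK (m : side -> nat) (eta alpha : side -> nat -> R)
    (r u : R -> R) : R -> R :=
  fun x => - Delta_inv m eta alpha (fun y => r y * u y) x.

Definition eigenfunction (m : side -> nat) (eta alpha : side -> nat -> R)
    (r : R -> R) (lambda : R) (u : R -> R) : Prop :=
  spaceX m eta alpha u /\ nonzero u /\
  forall x, J x -> - Delta u x = lambda * r x * u x.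

Definition eigenvalue (m : side -> nat) (eta alpha : side -> nat -> R)
    (r : R -> R) (lambda : R) : Prop :=
  exists u, eigenfunction m eta alpha r lambda u.

(* Union over l >= 1 of the null-spaces of (I_Y - lambda K_r)^l. *)
Definition generalized_null_space (m : side -> nat)
    (eta alpha : side -> nat -> R) (r : R -> R) (lambda : R)
    (u : R -> R) : Prop :=
  C0_J u /\ exists l : nat, (1 <= l)%nat /\
    eq_on_J
      (Nat.iter l
         (fun (v : R -> R) x => v x - lambda * opK m eta alpha r v x) u)
      (fun _ => 0).

Definition simple_eigenvalue (m : side -> nat)
    (eta alpha : side -> nat -> R) (r : R -> R) (lambda : R) : Prop :=
  eigenvalue m eta alpha r lambda /\
  exists phi, generalized_null_space m eta alpha r lambda phi /\ nonzero phi /\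
    forall u, generalized_null_space m eta alpha r lambda u ->
      exists c, eq_on_J u (fun x => c * phi x).

(* lam k is the k-th eigenvalue, k >= 1; the term lam 0 is irrelevant. *)
Definition eigenvalue_sequence (m : side -> nat)
    (eta alpha : side -> nat -> R) (r : R -> R) (lam : nat -> R) : Prop :=
  (forall k, (1 <= k)%nat -> lam k < lam (S k)) /\
  (forall l, eigenvalue m eta alpha r l <->
     exists k, (1 <= k)%nat /\ l = lam k).

(* c can serve as the constant gamma(r). *)
Definition spectral_constant (m : side -> nat) (eta : side -> nat -> R)
    (r : R -> R) (c : R) : Prop :=
  0 < c <= 1 /\
  forall alpha, calA m c alpha ->
    exists lam, eigenvalue_sequence m eta alpha r lam /\
      (forall k, (1 <= k)%nat ->
         simple_eigenvalue m eta alpha r (lam k) /\ 0 < lam k /\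
         exists u, nodalT m eta alpha k Plus u /\
           eigenfunction m eta alpha r (lam k) u) /\
      is_lim_seq lam p_infty.

Definition g_x (g : R -> R -> R) (x xi : R) : R := deriv (fun y => g y xi) x.

Definition g_xi (g : R -> R -> R) (x xi : R) : R := Derive (g x) xi.

(* g is in C^1([-1,1] x R). *)
Definition C1_strip (g : R -> R -> R) : Prop :=
  (forall x xi, J x ->
     derivable_at (fun y => g y xi) x /\ ex_derive (g x) xi) /\
  continuous_on (fun p : R * R => J (fst p)) (fun p => g_x g (fst p) (snd p)) /\
  continuous_on (fun p : R * R => J (fst p)) (fun p => g_xi g (fst p) (snd p)).

Definition uniform_limit_at_0 (g : R -> R -> R) (r : R -> R) : Prop :=
  forall eps, 0 < eps -> exists delta, 0 < delta /\
    forall x xi, J x -> 0 < Rabs xi < delta -> Rabs (g x xi - r x) < eps.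

Definition uniform_limit_at_infty (g : R -> R -> R) (r : R -> R) : Prop :=
  forall eps, 0 < eps -> exists M,
    forall x xi, J x -> M < Rabs xi -> Rabs (g x xi - r x) < eps.

Definition admissible_g (g : R -> R -> R) (r0 rinf : R -> R) : Prop :=
  C1_strip g /\
  C1_J r0 /\ positive_on_J r0 /\ uniform_limit_at_0 g r0 /\
  C1_J rinf /\ positive_on_J rinf /\ uniform_limit_at_infty g rinf /\
  (exists B, forall x xi, J x -> Rabs (g_x g x xi) <= B) /\
  (exists B, forall x xi, J x -> Rabs (xi * g_xi g x xi) <= B).

Definition g_min (g : R -> R -> R) : R :=
  real (Glb_Rbar (fun y => exists x xi, J x /\ y = g x xi)).

Definition solves (m : side -> nat) (eta alpha : side -> nat -> R)
    (g : R -> R -> R) (lambda : R) (u : R -> R) : Prop :=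
  spaceX m eta alpha u /\
  forall x, -1 < x < 1 -> - Delta u x = lambda * g x (u x) * u x.

Definition calS (m : side -> nat) (eta alpha : side -> nat -> R)
    (g : R -> R -> R) (lambda : R) (u : R -> R) : Prop :=
  0 < lambda /\ nonzero u /\ solves m eta alpha g lambda u.

(* c can serve as the constant gamma_{g,L}. *)
Definition nodal_constant (m : side -> nat) (eta : side -> nat -> R)
    (g : R -> R -> R) (L c : R) : Prop :=
  0 < c < 1 /\
  forall alpha, calA m c alpha ->
    forall lambda u, calS m eta alpha g lambda u -> lambda <= L ->
      exists j, (1 <= j)%nat /\
        (nodalT m eta alpha j Plus u \/ nodalT m eta alpha j Minus u).

Definition LambdaK (g : R -> R -> R) (k : nat) : R :=
  / g_min g * ((INR k + 2) * PI / 2) ^ 2.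

(* Main.v *)
From Stdlib Require Import Reals ZArith List Classical ClassicalEpsilon FunctionalExtensionality Bool Btauto Lra Lia Psatz.
From Coquelicot Require Import Coquelicot.
Require Import Defs.
Open Scope R_scope.

(** Fix the sign [nu].  A solution is described by its polar coordinates
    [u = r * sin th], [u' = r * cos th]: the angle increases along [[-1, 1]], and [u]
    belongs to the class with [k] critical points exactly when, up to the sign,
    the angle starts in [(- PI / 2, PI / 2)] and ends within [PI / 2] of [k * PI]
    ([nodalT_of_angle]).  The initial value problem is globally solvable, so the
    unknowns are the radius [rho] and the angle [a] at -1 together with [lam], and
    the two boundary conditions are two equations for these three numbers.

    The idea is to fix [rho] and to solve for [(lam, a)].  Dividing [u] by [rho] one
    obtains a family of problems which extends continuously to [rho = 0] and to
    [rho = +oo], where it is the linear problem with weight [r0], respectively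
    [rinf] ([blowup_field], [blowup_polar_field]).  Say [lam0 k < 1 < laminf k], the
    other case being the same with the two ends exchanged.  The number of
    solutions modulo 2 in the region
      [0 < lam < 1], [|a| < PI / 2], angle at 1 within [PI / 2] of [k * PI]
    cannot change with [rho] as long as none of them reaches the boundary of the
    region.  The faces that concern angles are never reached, because solutions of
    the nonlinear problem with [lam <= LambdaK g k] and eigenfunctions of the
    linear ones belong to some nodal class, hence their derivatives do not vanish
    at the end points; the face [lam = 0] is not reached because an affine function
    that satisfies the boundary conditions is 0.  So if no solution existed at
    [lam = 1], the numbers at [rho = 0] and at [rho = +oo] would have the same
    parity.  At [rho = +oo] it is 0, since the only eigenvalue with this nodal type
    is [laminf k > 1].  At [rho = 0] it is 1: the only eigenvalue with this nodal
    type is below 1, so the bound 1 for [lam] can be raised to [LambdaK g k], where the solution rotates too fast to have the right nodal type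
    ([angle_lower_bound]), and then all coefficients can be deformed to 0, i.e. to
    the Dirichlet problem, for which [a = 0] and the angle at 1 as a function of
    [lam] crosses [k * PI] an odd number of times.

    Parities are made rigorous without degree theory, by counting sign changes on
    a fine cubical grid: [zero_continuation], which rests on [bottom_parity].
    Continuous dependence of the solutions on all data is [flow_continuous], and
    the deformation just described is carried out in [nodal_solution_between]. *)

(** * A parity argument on a cubical grid *)

Fixpoint xsum (n : nat) (f : nat -> bool) : bool :=
  match n with O => false | S n' => xorb (xsum n' f) (f n') end.

Lemma xsum_ext n f f' :
  (forall i, (i < n)%nat -> f i = f' i) -> xsum n f = xsum n f'.
Proof.
  induction n as [|n IH]; intros H; simpl; [easy|].
  rewrite IH by (intros; apply H; lia). rewrite H by lia. easy.
Qed.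

Lemma xsum_xorb n f f' :
  xsum n (fun i => xorb (f i) (f' i)) = xorb (xsum n f) (xsum n f').
Proof.
  induction n as [|n IH]; simpl; [easy|]. rewrite IH. btauto.
Qed.

Lemma xsum_false n f : (forall i, (i < n)%nat -> f i = false) -> xsum n f = false.
Proof.
  induction n as [|n IH]; intros H; simpl; [easy|].
  rewrite IH by (intros; apply H; lia). rewrite H by lia. easy.
Qed.

Lemma xsum_telescope n f :
  xsum n (fun i => xorb (f i) (f (S i))) = xorb (f 0%nat) (f n).
Proof.
  induction n as [|n IH]; simpl; [btauto|]. rewrite IH. btauto.
Qed.

(** A vertex carries the truth values of [F1 >= 0] and [F2 >= 0].  The edges
    selected here are those on which the sign of [F2] changes inside the half
    plane [F1 >= 0].  Their number along a closed polygon, modulo 2, is a discrete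
    substitute for the winding number of [(F1, F2)] around the origin. *)
Definition sign_edge (p q : bool * bool) : bool :=
  fst p && fst q && xorb (snd p) (snd q).

Definition square_parity (p q r s : bool * bool) : bool :=
  xorb (xorb (sign_edge p q) (sign_edge q r))
       (xorb (sign_edge s r) (sign_edge p s)).

(** Every edge of the cube belongs to exactly two of its faces. *)
Lemma cube_parity (v : nat -> nat -> nat -> bool * bool) (i j l : nat) :
  let X i := square_parity (v i j l) (v i (S j) l) (v i (S j) (S l)) (v i j (S l)) in
  let Y j := square_parity (v i j l) (v (S i) j l) (v (S i) j (S l)) (v i j (S l)) in
  let Z l := square_parity (v i j l) (v (S i) j l) (v (S i) (S j) l) (v i (S j) l) in
  xorb (xorb (X i) (X (S i))) (xorb (xorb (Y j) (Y (S j))) (xorb (Z l) (Z (S l))))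
  = false.
Proof.
  cbv zeta. unfold square_parity.
  generalize (sign_edge (v i j l) (v i (S j) l))
   (sign_edge (v i (S j) l) (v i (S j) (S l)))
   (sign_edge (v i j (S l)) (v i (S j) (S l)))
   (sign_edge (v i j l) (v i j (S l)))
   (sign_edge (v (S i) j l) (v (S i) (S j) l))
   (sign_edge (v (S i) (S j) l) (v (S i) (S j) (S l)))
   (sign_edge (v (S i) j (S l)) (v (S i) (S j) (S l)))
   (sign_edge (v (S i) j l) (v (S i) j (S l)))
   (sign_edge (v i j l) (v (S i) j l))
   (sign_edge (v i (S j) l) (v (S i) (S j) l))
   (sign_edge (v i (S j) (S l)) (v (S i) (S j) (S l)))
   (sign_edge (v i j (S l)) (v (S i) j (S l))).
  intros.
  btauto.
Qed.

Section Parity.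
Variables (v : nat -> nat -> nat -> bool * bool) (chi : nat -> nat -> nat -> bool) (n : nat).
Let X i j l := square_parity (v i j l) (v i (S j) l) (v i (S j) (S l)) (v i j (S l)).
Let Y i j l := square_parity (v i j l) (v (S i) j l) (v (S i) j (S l)) (v i j (S l)).
Let Z i j l := square_parity (v i j l) (v (S i) j l) (v (S i) (S j) l) (v i (S j) l).
Hypothesis HX : forall i j l, (i < n)%nat -> (j < n)%nat -> (l < n)%nat ->
  X (S i) j l = true -> chi i j l = chi (S i) j l.
Hypothesis HY : forall i j l, (i < n)%nat -> (j < n)%nat -> (l < n)%nat ->
  Y i (S j) l = true -> chi i j l = chi i (S j) l.
Hypothesis HZ : forall i j l, (i < n)%nat -> (j < n)%nat -> (l < n)%nat ->
  Z i j (S l) = true -> chi i j l = chi i j (S l).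
Hypothesis HY0 : forall i l, (i < n)%nat -> (l < n)%nat ->
  Y i 0 l = true -> chi i 0%nat l = false.
Hypothesis HZ0 : forall i j, (i < n)%nat -> (j < n)%nat ->
  Z i j 0 = true -> chi i j 0%nat = false.
Hypothesis Hout : forall i j l, (n <= i \/ n <= j \/ n <= l)%nat -> chi i j l = false.

(** [chi] marks a set of cubes.  Summing [cube_parity] over the marked cubes of
    one slice leaves the squares below and above them and the faces inside the
    slice between a marked and an unmarked cube, whose parity is 0 by hypothesis. *)
Lemma slice_parity_step i : (i < n)%nat ->
  xsum n (fun j => xsum n (fun l => X i j l && chi i j l)) =
  xsum n (fun j => xsum n (fun l => X (S i) j l && chi (S i) j l)).
Proof.
  intros Hi.
  assert (E : xorb (xsum n (fun j => xsum n (fun l => X i j l && chi i j l)))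
       (xsum n (fun j => xsum n (fun l => X (S i) j l && chi (S i) j l))) = false).
  2:{ destruct (xsum n (fun j => xsum n (fun l => X i j l && chi i j l))),
       (xsum n (fun j => xsum n (fun l => X (S i) j l && chi (S i) j l))); easy. }
  rewrite <- xsum_xorb.
  transitivity (xsum n (fun j => xorb (xsum n (fun l => Y i j l && chi i j l))
     (xsum n (fun l => Y i (S j) l && chi i (S j) l)))).
  - apply xsum_ext; intros j Hj. rewrite <- !xsum_xorb.
    transitivity (xorb
      (xsum n (fun l => xorb (Y i j l && chi i j l) (Y i (S j) l && chi i (S j) l)))
      (xsum n (fun l => xorb (Z i j l && chi i j l) (Z i j (S l) && chi i j (S l))))).
    + rewrite <- xsum_xorb. apply xsum_ext; intros l Hl.
      pose proof (cube_parity v i j l) as Q.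
      change (xorb (xorb (X i j l) (X (S i) j l)) (xorb (xorb (Y i j l) (Y i (S j) l))
        (xorb (Z i j l) (Z i j (S l)))) = false) in Q.
      pose proof (HX i j l Hi Hj Hl) as A. pose proof (HY i j l Hi Hj Hl) as B.
      pose proof (HZ i j l Hi Hj Hl) as C.
      destruct (X i j l), (X (S i) j l), (Y i j l), (Y i (S j) l), (Z i j l), (Z i j (S l));
        try discriminate Q;
        try rewrite <- (A eq_refl); try rewrite <- (B eq_refl); try rewrite <- (C eq_refl);
        simpl; btauto.
    + rewrite (xsum_telescope n (fun l => Z i j l && chi i j l)).
      rewrite (Hout i j n) by lia. rewrite andb_false_r.
      replace (Z i j 0 && chi i j 0%nat) with false.
      * btauto.
      * pose proof (HZ0 i j Hi Hj) as D. destruct (Z i j 0); [rewrite D|]; easy.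
  - rewrite (xsum_telescope n (fun j => xsum n (fun l => Y i j l && chi i j l))).
    rewrite !xsum_false; [easy|intros l Hl|intros l Hl].
    + rewrite Hout by lia. btauto.
    + pose proof (HY0 i l Hi Hl) as D. destruct (Y i 0 l); [rewrite D|]; easy.
Qed.

(** The parity of the marked bottom squares is carried from slice to slice up to
    the last one, which has no marked cube. *)
Lemma bottom_parity :
  xsum n (fun j => xsum n (fun l => X 0 j l && chi 0%nat j l)) = false.
Proof.
  assert (E : forall i, (i <= n)%nat ->
    xsum n (fun j => xsum n (fun l => X 0 j l && chi 0%nat j l)) =
    xsum n (fun j => xsum n (fun l => X i j l && chi i j l))).
  { induction i as [|i IH]; intros Hi; [easy|].
    rewrite IH by lia. apply slice_parity_step; lia. }
  rewrite (E n) by lia. apply xsum_false; intros j _; apply xsum_false; intros l _.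
  rewrite Hout by lia. btauto.
Qed.
End Parity.

(** * Continuation of zeros of planar maps *)

Definition in_box (A t l a : R) : Prop := 0 <= t <= 1 /\ 0 <= l <= 1 /\ - A <= a <= A.

Definition box_ball (A d t l a t' l' a' : R) : Prop :=
  in_box A t' l' a' /\ Rabs (t' - t) < d /\ Rabs (l' - l) < d /\ Rabs (a' - a) < d.

Definition box_continuous (A : R) (F : R -> R -> R -> R) : Prop :=
  forall t l a, in_box A t l a -> forall eps, 0 < eps ->
  exists d, 0 < d /\ forall t' l' a', box_ball A d t l a t' l' a' ->
    Rabs (F t' l' a' - F t l a) < eps.

Lemma box_ball_le A d d' t l a t' l' a' :
  d <= d' -> box_ball A d t l a t' l' a' -> box_ball A d' t l a t' l' a'.
Proof. unfold box_ball; intros; intuition lra. Qed.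

(** Turns a dichotomy that holds near each point of the box into one that holds
    on all balls of a common radius, hence on all cubes of a fine grid. *)
Lemma box_lebesgue_number (A : R) (Q : (R -> R -> R -> Prop) -> Prop)
  (Qsub : forall B B' : R -> R -> R -> Prop,
     (forall t l a, B t l a -> B' t l a) -> Q B' -> Q B)
  (Qloc : forall t l a, in_box A t l a -> exists d, 0 < d /\ Q (box_ball A d t l a)) :
  exists d, 0 < d /\ forall t l a, in_box A t l a -> Q (box_ball A d t l a).
Proof.
  assert (G : forall t l a, exists d : posreal,
     in_box A t l a -> Q (box_ball A (2 * d) t l a)).
  { intros t l a. destruct (classic (in_box A t l a)) as [H|H].
    - destruct (Qloc t l a H) as (d & Hd & HQ).
      assert (Hd2 : 0 < d / 2) by lra.
      exists (mkposreal _ Hd2). intros _. simpl.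
      replace (2 * (d / 2)) with d by field. exact HQ.
    - exists (mkposreal 1 Rlt_0_1). intros; easy. }
  set (delta := fun t l a => proj1_sig (constructive_indefinite_description _ (G t l a))).
  assert (Hdelta : forall t l a, in_box A t l a -> Q (box_ball A (2 * delta t l a) t l a))
    by (intros t l a; exact (proj2_sig (constructive_indefinite_description _ (G t l a)))).
  clearbody delta.
  destruct (compactness_value 3 (0, (0, (- A, tt))) (1, (1, (A, tt)))
    (fun x => let '(t, (l, (a, _))) := x in delta t l a)) as [d Hd].
  exists d. split; [apply cond_pos|]. intros t l a H.
  apply NNPP. intros HN. apply (Hd (t, (l, (a, tt)))).
  { unfold in_box in H. simpl. intuition. }
  intros [[t0 [l0 [a0 u0]]] (Hb & Hc & Hle)]. apply HN.
  pose proof (Hdelta t0 l0 a0) as Hg. simpl in Hb, Hc, Hle.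
  revert Hc Hle Hg. generalize (delta t0 l0 a0); intros e Hc Hle Hg.
  assert (H0 : in_box A t0 l0 a0) by (unfold in_box; intuition).
  refine (Qsub _ _ _ (Hg H0)).
  intros t' l' a' (Hin & Ht & Hl & Ha). split; [exact Hin|].
  assert (T : forall x y z : R, Rabs (x - y) < d ->
     Rabs (y - z) < e ->
     Rabs (x - z) < 2 * e).
  { intros x y z H1 H2. replace (x - z) with ((x - y) + (y - z)) by ring.
    eapply Rle_lt_trans; [apply Rabs_triang|]. lra. }
  destruct Hc as (Hc1 & Hc2 & Hc3 & _). repeat split.
  - exact (T _ _ _ Ht Hc1).
  - exact (T _ _ _ Hl Hc2).
  - exact (T _ _ _ Ha Hc3).
Qed.

Lemma box_continuous_gt A F c t l a :
  box_continuous A F -> in_box A t l a -> c < F t l a ->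
  exists d, 0 < d /\ forall t' l' a', box_ball A d t l a t' l' a' -> c < F t' l' a'.
Proof.
  intros HF Hin Hc. destruct (HF t l a Hin (F t l a - c)) as (d & Hd & H); [lra|].
  exists d. split; [easy|]. intros t' l' a' Hb. specialize (H _ _ _ Hb).
  apply Rabs_def2 in H. lra.
Qed.

Lemma box_continuous_lt A F c t l a :
  box_continuous A F -> in_box A t l a -> F t l a < c ->
  exists d, 0 < d /\ forall t' l' a', box_ball A d t l a t' l' a' -> F t' l' a' < c.
Proof.
  intros HF Hin Hc. destruct (HF t l a Hin (c - F t l a)) as (d & Hd & H); [lra|].
  exists d. split; [easy|]. intros t' l' a' Hb. specialize (H _ _ _ Hb).
  apply Rabs_def2 in H. lra.
Qed.

Lemma box_continuous_abs A F :
  box_continuous A F -> box_continuous A (fun t l a => Rabs (F t l a)).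
Proof.
  intros HF t l a Hin eps He. destruct (HF t l a Hin eps He) as (d & Hd & H).
  exists d. split; [easy|]. intros t' l' a' Hb.
  eapply Rle_lt_trans; [apply Rabs_triang_inv2|]. exact (H _ _ _ Hb).
Qed.

Lemma square_parity_true p q r s :
  square_parity p q r s = true ->
  ~ (fst p = true /\ fst q = true /\ fst r = true /\ fst s = true) /\
  ~ (fst p = false /\ fst q = false /\ fst r = false /\ fst s = false) /\
  ~ (snd p = true /\ snd q = true /\ snd r = true /\ snd s = true) /\
  ~ (snd p = false /\ snd q = false /\ snd r = false /\ snd s = false).
Proof.
  destruct p as [[] []], q as [[] []], r as [[] []], s as [[] []]; cbn;
    intros; repeat split; intros (? & ? & ? & ?); easy.
Qed.

Lemma xsum_single n f l0 :
  (l0 < n)%nat -> (forall l, (l < n)%nat -> l <> l0 -> f l = false) -> xsum n f = f l0.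
Proof.
  induction n as [|n IH]; intros Hl H; [lia|]. simpl.
  destruct (PeanoNat.Nat.eq_dec l0 n) as [->|E].
  - rewrite xsum_false by (intros; apply H; lia). destruct (f n); easy.
  - rewrite IH by (try lia; intros; apply H; lia). rewrite (H n) by lia. destruct (f l0); easy.
Qed.

Definition nonnegb (x : R) : bool := if Rle_dec 0 x then true else false.
Definition ltb (x y : R) : bool := if Rlt_dec x y then true else false.

Lemma nonnegb_true x : 0 <= x -> nonnegb x = true.
Proof. unfold nonnegb; destruct (Rle_dec 0 x); easy. Qed.
Lemma nonnegb_false x : x < 0 -> nonnegb x = false.
Proof. unfold nonnegb; destruct (Rle_dec 0 x); [lra|easy]. Qed.
Lemma ltb_true x y : x < y -> ltb x y = true.
Proof. unfold ltb; destruct (Rlt_dec x y); easy. Qed.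
Lemma ltb_false x y : y <= x -> ltb x y = false.
Proof. unfold ltb; destruct (Rlt_dec x y); [lra|easy]. Qed.
Lemma ltb_true_inv x y : ltb x y = true -> x < y.
Proof. unfold ltb; destruct (Rlt_dec x y); easy. Qed.
Lemma ltb_false_inv x y : ltb x y = false -> y <= x.
Proof. unfold ltb; destruct (Rlt_dec x y); [easy|lra]. Qed.

(** The zeros of [(F1, F2)] with [|N| < h] cannot leave through the sides, so
    their number modulo 2 is the same for all [t].  At [t = 0] it is 1: there
    [F1] changes sign across the segment [a = 0], along which [F2], having the
    sign of [N], changes sign.  The grid version: a square of odd parity is close
    to a zero, so if there were no zero at [t = 1], marking the cubes with
    [|N| < h] would satisfy the hypotheses of [bottom_parity], whereas the bottom
    squares, whose parities can be computed, have odd total parity. *)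
Lemma zero_continuation (A h : R) (F1 F2 N : R -> R -> R -> R)
  (HA : 0 < A) (Hh : 0 < h)
  (C1 : box_continuous A F1) (C2 : box_continuous A F2) (CN : box_continuous A N)
  (Hside : forall t l a, in_box A t l a -> F1 t l a = 0 -> F2 t l a = 0 ->
     Rabs (N t l a) <= h -> 0 < l < 1 /\ - A < a < A /\ Rabs (N t l a) < h)
  (Hpos : forall l a, in_box A 0 l a -> 0 <= a -> 0 <= F1 0 l a)
  (Hneg : forall l a, in_box A 0 l a -> a < 0 -> F1 0 l a < 0)
  (Hsign : forall l, 0 <= l <= 1 -> Rabs (N 0 l 0) < 2 * h ->
     (0 <= F2 0 l 0 <-> 0 <= N 0 l 0))
  (HN0 : N 0 0 0 < 0) (HN1 : 0 <= N 0 1 0) :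
  exists l a, in_box A 1 l a /\ F1 1 l a = 0 /\ F2 1 l a = 0 /\ Rabs (N 1 l a) < h.
Proof.
  apply NNPP. intros Hno.
  set (all := fun (B P : R -> R -> R -> Prop) => forall t l a, B t l a -> P t l a).
  (* what is needed of a ball that contains a square: if the square has odd
     parity then the first four cases are excluded *)
  set (face := fun B =>
     all B (fun t l a => 0 < F1 t l a) \/ all B (fun t l a => F1 t l a < 0) \/
     all B (fun t l a => 0 < F2 t l a) \/ all B (fun t l a => F2 t l a < 0) \/
     all B (fun t l a => Rabs (N t l a) < h /\ 0 < l < 1 /\ - A < a < A /\ t < 1) \/
     all B (fun t l a => h <= Rabs (N t l a))).
  (* used for the bottom squares that meet the segment a = 0 *)
  set (row := fun B =>
     (all B (fun t l a => h < Rabs (N t l a)) \/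
      all B (fun t l a => Rabs (N t l a) < 2 * h)) /\
     (all B (fun t l a => 0 < N t l a) \/ all B (fun t l a => N t l a < 0) \/
      all B (fun t l a => Rabs (N t l a) < h))).
  assert (Hsub : forall B B' P, (forall t l a, B t l a -> B' t l a) -> all B' P -> all B P)
    by (unfold all; intros; auto).
  destruct (box_lebesgue_number A (fun B => face B /\ row B)) as (d & Hd & HQ).
  { intros B B' HB [HE HR]. unfold face, row in *. split; [|split].
    - destruct HE as [HF|[HF|[HF|[HF|[HF|HF]]]]]; pose proof (Hsub B B' _ HB HF) as K;
        repeat first [exact K | left; exact K | right].
    - destruct HR as [[HF|HF] _]; pose proof (Hsub B B' _ HB HF) as K;
        repeat first [exact K | left; exact K | right].
    - destruct HR as [_ [HF|[HF|HF]]]; pose proof (Hsub B B' _ HB HF) as K;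
        repeat first [exact K | left; exact K | right]. }
  { intros t l a Hin.
    pose proof (box_continuous_abs A N CN) as CA.
    assert (E1 : exists d, 0 < d /\ face (box_ball A d t l a)).
    { unfold face.
      destruct (Rtotal_order (F1 t l a) 0) as [HF|[HF1|HF]].
      - destruct (box_continuous_lt A F1 0 t l a C1 Hin HF) as (d & Hd & H).
        exists d. split; [easy|]. right; left. exact H.
      - destruct (Rtotal_order (F2 t l a) 0) as [HF|[HF2|HF]].
        + destruct (box_continuous_lt A F2 0 t l a C2 Hin HF) as (d & Hd & H).
          exists d. split; [easy|]. do 3 right; left. exact H.
        + destruct (Rle_or_lt (Rabs (N t l a)) h) as [HN|HN].
          * destruct (Hside t l a Hin HF1 HF2 HN) as (Hl & Ha & HNh).
            destruct (box_continuous_lt A _ h t l a CA Hin HNh) as (d & Hd & H).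
            assert (Ht : t < 1).
            { destruct (Req_dec t 1) as [E|E]; [|unfold in_box in Hin; lra].
              subst t. exfalso; apply Hno. exists l, a. easy. }
            assert (HA1 : 0 < A - a) by lra. assert (HA2 : 0 < a + A) by lra.
            assert (HA3 : 0 < 1 - l) by lra. assert (HA4 : 0 < 1 - t) by lra.
            destruct Hl as [HA5 _].
            exists (Rmin d (Rmin (Rmin (A - a) (a + A)) (Rmin (Rmin l (1 - l)) (1 - t)))).
            split; [repeat apply Rmin_glb_lt; easy|].
            do 4 right; left. intros t' l' a' Hb. split.
            { apply (H t' l' a'). revert Hb; apply box_ball_le, Rmin_l. }
            destruct Hb as (_ & H1 & H2 & H3).
            apply Rabs_def2 in H1, H2, H3.
            set (e1 := Rmin (A - a) (a + A)) in *. set (e3 := Rmin l (1 - l)) in *.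
            set (e2 := Rmin e3 (1 - t)) in *. set (e4 := Rmin e1 e2) in *.
            assert (Rmin d e4 <= e4) by apply Rmin_r.
            assert (e4 <= e1) by apply Rmin_l. assert (e4 <= e2) by apply Rmin_r.
            assert (e2 <= e3) by apply Rmin_l. assert (e2 <= 1 - t) by apply Rmin_r.
            assert (e3 <= l) by apply Rmin_l. assert (e3 <= 1 - l) by apply Rmin_r.
            assert (e1 <= A - a) by apply Rmin_l. assert (e1 <= a + A) by apply Rmin_r.
            repeat split; lra.
          * destruct (box_continuous_gt A _ h t l a CA Hin HN) as (d & Hd & H).
            exists d. split; [easy|]. do 5 right. intros t' l' a' Hb.
            apply Rlt_le, (H t' l' a' Hb).
        + destruct (box_continuous_gt A F2 0 t l a C2 Hin HF) as (d & Hd & H).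
          exists d. split; [easy|]. do 2 right; left. exact H.
      - destruct (box_continuous_gt A F1 0 t l a C1 Hin HF) as (d & Hd & H).
        exists d. split; [easy|]. left. exact H. }
    assert (E2 : exists d, 0 < d /\ (all (box_ball A d t l a) (fun t l a => h < Rabs (N t l a)) \/
      all (box_ball A d t l a) (fun t l a => Rabs (N t l a) < 2 * h))).
    { destruct (Rle_or_lt (Rabs (N t l a)) h) as [HN|HN].
      - destruct (box_continuous_lt A _ (2 * h) t l a CA Hin) as (d & Hd & H); [lra|].
        exists d. split; [easy|]. right. exact H.
      - destruct (box_continuous_gt A _ h t l a CA Hin HN) as (d & Hd & H).
        exists d. split; [easy|]. left. exact H. }
    assert (E3 : exists d, 0 < d /\ (all (box_ball A d t l a) (fun t l a => 0 < N t l a) \/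
      all (box_ball A d t l a) (fun t l a => N t l a < 0) \/
      all (box_ball A d t l a) (fun t l a => Rabs (N t l a) < h))).
    { destruct (Rtotal_order (N t l a) 0) as [HF|[HF1|HF]].
      - destruct (box_continuous_lt A N 0 t l a CN Hin HF) as (d & Hd & H).
        exists d. split; [easy|]. right; left. exact H.
      - destruct (box_continuous_lt A _ h t l a CA Hin) as (d & Hd & H).
        { rewrite HF1, Rabs_R0. easy. }
        exists d. split; [easy|]. right; right. exact H.
      - destruct (box_continuous_gt A N 0 t l a CN Hin HF) as (d & Hd & H).
        exists d. split; [easy|]. left. exact H. }
    destruct E1 as (d1 & Hd1 & E1), E2 as (d2 & Hd2 & E2), E3 as (d3 & Hd3 & E3).
    exists (Rmin d1 (Rmin d2 d3)). split; [repeat apply Rmin_glb_lt; easy|].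
    assert (B1 : forall t' l' a', box_ball A (Rmin d1 (Rmin d2 d3)) t l a t' l' a' ->
       box_ball A d1 t l a t' l' a') by (intros t' l' a'; apply box_ball_le, Rmin_l).
    assert (B2 : forall t' l' a', box_ball A (Rmin d1 (Rmin d2 d3)) t l a t' l' a' ->
       box_ball A d2 t l a t' l' a').
    { intros t' l' a'; apply box_ball_le. eapply Rle_trans; [apply Rmin_r|apply Rmin_l]. }
    assert (B3 : forall t' l' a', box_ball A (Rmin d1 (Rmin d2 d3)) t l a t' l' a' ->
       box_ball A d3 t l a t' l' a').
    { intros t' l' a'; apply box_ball_le. eapply Rle_trans; [apply Rmin_r|apply Rmin_r]. }
    unfold face, row in *. split; [|split].
    - destruct E1 as [HF|[HF|[HF|[HF|[HF|HF]]]]]; pose proof (Hsub _ _ _ B1 HF) as K;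
        repeat first [exact K | left; exact K | right].
    - destruct E2 as [HF|HF]; pose proof (Hsub _ _ _ B2 HF) as K;
        repeat first [exact K | left; exact K | right].
    - destruct E3 as [HF|[HF|HF]]; pose proof (Hsub _ _ _ B3 HF) as K;
        repeat first [exact K | left; exact K | right]. }
  (* An even number n = 2 q of steps puts a = 0 on the grid, at index q. *)
  assert (Hq : exists q, (1 <= q)%nat /\ / (2 * INR q) < d /\ A / INR q < d).
  { destruct (INR_archimed (Rmin d (d / A)) 1) as [q Hq].
    { apply Rlt_gt, Rmin_glb_lt; [easy|]. apply Rdiv_lt_0_compat; easy. }
    assert (Hq0 : (1 <= q)%nat).
    { destruct q; [simpl in Hq; lra|lia]. }
    assert (Hq1 : 0 < INR q) by (apply lt_0_INR; lia).
    exists q. split; [easy|].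
    pose proof (Rmin_l d (d / A)). pose proof (Rmin_r d (d / A)).
    assert (K1 : 1 < INR q * d) by nra.
    assert (K2 : 1 < INR q * (d / A)) by nra.
    split.
    - apply (Rmult_lt_reg_l (2 * INR q)); [lra|]. rewrite Rinv_r by lra. lra.
    - apply (Rmult_lt_reg_r (INR q)); [lra|]. unfold Rdiv at 1.
      rewrite Rmult_assoc, Rinv_l, Rmult_1_r by lra.
      apply (Rmult_lt_reg_r (/ A)); [now apply Rinv_0_lt_compat|].
      rewrite Rinv_r by lra. unfold Rdiv in K2. lra. }
  destruct Hq as (q & Hq0 & Hq1 & Hq2).
  assert (Hqp : 1 <= INR q) by (change 1 with (INR 1); apply le_INR; easy).
  set (n := (2 * q)%nat).
  assert (Hn : INR n = 2 * INR q) by (unfold n; rewrite mult_INR; simpl; ring).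
  set (T := fun i => INR i / INR n).
  set (al := fun i => A * (INR i - INR q) / INR q).
  assert (HT : forall i, (i <= n)%nat -> 0 <= T i <= 1).
  { intros i Hi. apply le_INR in Hi. pose proof (pos_INR i). unfold T. split.
    - apply Rdiv_le_0_compat; lra.
    - apply (Rmult_le_reg_r (INR n)); [lra|]. field_simplify; lra. }
  assert (Hal : forall i, (i <= n)%nat -> - A <= al i <= A).
  { intros i Hi. apply le_INR in Hi. pose proof (pos_INR i). unfold al. split.
    - apply (Rmult_le_reg_r (INR q)); [lra|]. field_simplify; [nra|lra].
    - apply (Rmult_le_reg_r (INR q)); [lra|]. field_simplify; [nra|lra]. }
  assert (Hbox : forall i j l, (i <= n)%nat -> (j <= n)%nat -> (l <= n)%nat ->
     in_box A (T i) (T j) (al l)) by (intros; unfold in_box; auto).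
  assert (HdT : forall i, Rabs (T (S i) - T i) < d).
  { intros i. replace (T (S i) - T i) with (/ (2 * INR q)).
    - rewrite Rabs_pos_eq; [easy|]. apply Rlt_le, Rinv_0_lt_compat; lra.
    - unfold T. rewrite S_INR, Hn. field. lra. }
  assert (Hdal : forall i, Rabs (al (S i) - al i) < d).
  { intros i. replace (al (S i) - al i) with (A / INR q).
    - rewrite Rabs_pos_eq; [easy|]. apply Rdiv_le_0_compat; lra.
    - unfold al. rewrite S_INR. field. lra. }
  assert (Hd0 : forall x : R, Rabs (x - x) < d)
    by (intros; rewrite Rminus_diag, Rabs_R0; easy).
  set (ball := fun i j l => box_ball A d (T i) (T j) (al l)).
  assert (Hball : forall i j l i' j' l', (i' <= n)%nat -> (j' <= n)%nat -> (l' <= n)%nat ->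
    (i' = i \/ i' = S i) -> (j' = j \/ j' = S j) -> (l' = l \/ l' = S l) ->
    ball i j l (T i') (T j') (al l')).
  { intros i j l i' j' l' Hi Hj Hl [-> | ->] [-> | ->] [-> | ->];
      unfold ball, box_ball; auto. }
  set (v := fun i j l => (nonnegb (F1 (T i) (T j) (al l)), nonnegb (F2 (T i) (T j) (al l)))).
  set (inside := fun i j l => ltb (Rabs (N (T i) (T j) (al l))) h).
  set (chi := fun i j l => Nat.ltb i n && Nat.ltb j n && Nat.ltb l n && inside i j l).
  assert (Tn : T n = 1) by (unfold T; field; lra).
  assert (T0 : T 0%nat = 0) by (unfold T; simpl; field; lra).
  assert (aln : al n = A) by (unfold al; rewrite Hn; field; lra).
  assert (al0 : al 0%nat = - A) by (unfold al; simpl; field; lra).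
  assert (Hface : forall i j l p1 p2 p3 p4, (i < n)%nat -> (j < n)%nat -> (l < n)%nat ->
    square_parity p1 p2 p3 p4 = true ->
    (forall p, p = p1 \/ p = p2 \/ p = p3 \/ p = p4 ->
       exists i' j' l', p = v i' j' l' /\ ball i j l (T i') (T j') (al l')) ->
    all (ball i j l) (fun t l a => Rabs (N t l a) < h /\ 0 < l < 1 /\ - A < a < A /\ t < 1) \/
    all (ball i j l) (fun t l a => h <= Rabs (N t l a))).
  { intros i j l p1 p2 p3 p4 Hi Hj Hl Hp Hv.
    assert (Hin : in_box A (T i) (T j) (al l)) by (apply Hbox; lia).
    destruct (HQ _ _ _ Hin) as [HF _]. fold (ball i j l) in HF.
    destruct (square_parity_true _ _ _ _ Hp) as (K1 & K2 & K3 & K4).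
    destruct HF as [HF|[HF|[HF|[HF|HF]]]]; [| | | |exact HF]; exfalso.
    - apply K1; repeat split; match goal with |- fst ?p = _ =>
        destruct (Hv p ltac:(tauto)) as (i' & j' & l' & -> & Hb) end;
        apply nonnegb_true, Rlt_le, (HF _ _ _ Hb).
    - apply K2; repeat split; match goal with |- fst ?p = _ =>
        destruct (Hv p ltac:(tauto)) as (i' & j' & l' & -> & Hb) end;
        apply nonnegb_false, (HF _ _ _ Hb).
    - apply K3; repeat split; match goal with |- snd ?p = _ =>
        destruct (Hv p ltac:(tauto)) as (i' & j' & l' & -> & Hb) end;
        apply nonnegb_true, Rlt_le, (HF _ _ _ Hb).
    - apply K4; repeat split; match goal with |- snd ?p = _ =>
        destruct (Hv p ltac:(tauto)) as (i' & j' & l' & -> & Hb) end;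
        apply nonnegb_false, (HF _ _ _ Hb). }
  assert (Hchi : forall i j l, (i < n)%nat -> (j < n)%nat -> (l < n)%nat ->
     chi i j l = inside i j l).
  { intros i j l Hi Hj Hl. unfold chi. apply Nat.ltb_lt in Hi, Hj, Hl.
    rewrite Hi, Hj, Hl. easy. }
  assert (Hchi_in : forall i j l i' j' l', (i < n)%nat -> (j < n)%nat -> (l < n)%nat ->
    (i' <= n)%nat -> (j' <= n)%nat -> (l' <= n)%nat ->
    ball i j l (T i') (T j') (al l') ->
    all (ball i j l) (fun t l a => Rabs (N t l a) < h /\ 0 < l < 1 /\ - A < a < A /\ t < 1) ->
    chi i' j' l' = true).
  { intros i j l i' j' l' Hi Hj Hl Hi' Hj' Hl' Hb Hall.
    destruct (Hall _ _ _ Hb) as (K1 & K2 & K3 & K4).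
    rewrite Hchi.
    - apply ltb_true, K1.
    - assert (i' <> n) by (intros ->; lra). lia.
    - assert (j' <> n) by (intros ->; lra). lia.
    - assert (l' <> n) by (intros ->; lra). lia. }
  assert (Hchi_out : forall i j l i' j' l',
    ball i j l (T i') (T j') (al l') ->
    all (ball i j l) (fun t l a => h <= Rabs (N t l a)) ->
    chi i' j' l' = false).
  { intros i j l i' j' l' Hb Hall. unfold chi, inside.
    rewrite (ltb_false _ _ (Hall _ _ _ Hb)). apply andb_false_r. }
  pose proof (bottom_parity v chi n) as HB. cbv zeta in HB.
  assert (HB' : xsum n (fun j => xsum n (fun l => square_parity (v 0%nat j l) (v 0%nat (S j) l)
      (v 0%nat (S j) (S l)) (v 0%nat j (S l)) && chi 0%nat j l)) = false).
  { apply HB; clear HB.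
    - intros i j l Hi Hj Hl Hp.
      destruct (Hface i j l _ _ _ _ Hi Hj Hl Hp) as [K|K].
      { intros p [->|[->|[->| ->]]]; do 3 eexists; (split; [reflexivity|apply Hball]); lia. }
      + rewrite !(Hchi_in i j l) by (try easy; try apply Hball; lia). easy.
      + rewrite !(Hchi_out i j l) by (try easy; try apply Hball; lia). easy.
    - intros i j l Hi Hj Hl Hp.
      destruct (Hface i j l _ _ _ _ Hi Hj Hl Hp) as [K|K].
      { intros p [->|[->|[->| ->]]]; do 3 eexists; (split; [reflexivity|apply Hball]); lia. }
      + rewrite !(Hchi_in i j l) by (try easy; try apply Hball; lia). easy.
      + rewrite !(Hchi_out i j l) by (try easy; try apply Hball; lia). easy.
    - intros i j l Hi Hj Hl Hp.
      destruct (Hface i j l _ _ _ _ Hi Hj Hl Hp) as [K|K].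
      { intros p [->|[->|[->| ->]]]; do 3 eexists; (split; [reflexivity|apply Hball]); lia. }
      + rewrite !(Hchi_in i j l) by (try easy; try apply Hball; lia). easy.
      + rewrite !(Hchi_out i j l) by (try easy; try apply Hball; lia). easy.
    - intros i l Hi Hl Hp. assert (Hj : (0 < n)%nat) by lia.
      destruct (Hface i 0%nat l _ _ _ _ Hi Hj Hl Hp) as [K|K].
      { intros p [->|[->|[->| ->]]]; do 3 eexists; (split; [reflexivity|apply Hball]); lia. }
      + exfalso. assert (Hb : ball i 0%nat l (T i) (T 0%nat) (al l)) by (apply Hball; lia).
        destruct (K _ _ _ Hb) as (_ & ? & _). lra.
      + rewrite !(Hchi_out i 0%nat l) by (try easy; try apply Hball; lia). easy.
    - intros i j Hi Hj Hp. assert (Hl : (0 < n)%nat) by lia.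
      destruct (Hface i j 0%nat _ _ _ _ Hi Hj Hl Hp) as [K|K].
      { intros p [->|[->|[->| ->]]]; do 3 eexists; (split; [reflexivity|apply Hball]); lia. }
      + exfalso. assert (Hb : ball i j 0%nat (T i) (T j) (al 0%nat)) by (apply Hball; lia).
        destruct (K _ _ _ Hb) as (_ & _ & ? & _). lra.
      + rewrite !(Hchi_out i j 0%nat) by (try easy; try apply Hball; lia). easy.
    - intros i j l Hout. unfold chi.
      destruct Hout as [E|[E|E]]; apply Nat.ltb_ge in E; rewrite E; simpl; btauto. }
  clear HB.
  assert (Halq : al q = 0) by (unfold al; field; lra).
  assert (Halpos : forall l, (q <= l)%nat -> 0 <= al l).
  { intros l Hl. apply le_INR in Hl. unfold al. apply Rdiv_le_0_compat; nra. }
  assert (Halneg : forall l, (l < q)%nat -> al l < 0).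
  { intros l Hl. apply lt_INR in Hl. unfold al.
    apply (Rmult_lt_reg_r (INR q)); [lra|]. field_simplify; nra. }
  set (beta := fun j => nonnegb (N 0 (T j) 0)).
  (* Only the row just below a = 0 contributes: in the other rows F1 has the
     same label at the four vertices. *)
  assert (Hrow : forall j, (j < n)%nat ->
    xsum n (fun l => square_parity (v 0%nat j l) (v 0%nat (S j) l)
      (v 0%nat (S j) (S l)) (v 0%nat j (S l)) && chi 0%nat j l) = xorb (beta j) (beta (S j))).
  { intros j Hj.
    assert (Lpos : forall j l, (j <= n)%nat -> (l <= n)%nat -> (q <= l)%nat ->
       fst (v 0%nat j l) = true).
    { intros j' l Hj' Hl Hql. simpl. rewrite T0. apply nonnegb_true, Hpos; auto.
      rewrite <- T0. apply Hbox; lia. }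
    assert (Lneg : forall j l, (j <= n)%nat -> (l < q)%nat ->
       fst (v 0%nat j l) = false).
    { intros j' l Hj' Hl. simpl. rewrite T0. apply nonnegb_false, Hneg; auto.
      rewrite <- T0. apply Hbox; lia. }
    rewrite (xsum_single n _ (q - 1)); [|lia|].
    - replace (S (q - 1)) with q by lia.
      assert (Hin : in_box A (T 0%nat) (T j) (al (q - 1)%nat)) by (apply Hbox; lia).
      destruct (HQ _ _ _ Hin) as [_ [HR1 HR2]]. fold (ball 0%nat j (q - 1)%nat) in HR1, HR2.
      assert (Hb0 : ball 0%nat j (q - 1)%nat (T 0%nat) (T j) (al (q - 1)%nat))
        by (apply Hball; lia).
      assert (Hb1 : ball 0%nat j (q - 1)%nat (T 0%nat) (T j) (al q)) by (apply Hball; lia).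
      assert (Hb2 : ball 0%nat j (q - 1)%nat (T 0%nat) (T (S j)) (al q)) by (apply Hball; lia).
      rewrite Hchi by lia.
      assert (Ep : square_parity (v 0%nat j (q - 1)%nat) (v 0%nat (S j) (q - 1)%nat)
         (v 0%nat (S j) q) (v 0%nat j q) = xorb (snd (v 0%nat j q)) (snd (v 0%nat (S j) q))).
      { unfold square_parity, sign_edge.
        rewrite !Lneg, !Lpos by lia. simpl. btauto. }
      rewrite Ep. clear Ep.
      destruct (inside 0%nat j (q - 1)%nat) eqn:Ei.
      + apply ltb_true_inv in Ei. rewrite andb_true_r.
        destruct HR1 as [HR1|HR1]; [specialize (HR1 _ _ _ Hb0); lra|].
        pose proof (HR1 _ _ _ Hb1) as M1. pose proof (HR1 _ _ _ Hb2) as M2.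
        simpl. unfold beta. rewrite T0, Halq in *.
        pose proof (Hsign (T j) ltac:(apply HT; lia) M1) as S1.
        pose proof (Hsign (T (S j)) ltac:(apply HT; lia) M2) as S2.
        unfold nonnegb. repeat destruct Rle_dec; try easy; exfalso; tauto.
      + apply ltb_false_inv in Ei. rewrite andb_false_r. unfold beta.
        rewrite T0, Halq in *.
        destruct HR2 as [HR2|[HR2|HR2]].
        * rewrite !nonnegb_true by (apply Rlt_le; eauto). easy.
        * rewrite !nonnegb_false by eauto. easy.
        * specialize (HR2 _ _ _ Hb0). lra.
    - intros l Hl Hne. apply andb_false_iff. left.
      unfold square_parity, sign_edge.
      destruct (PeanoNat.Nat.lt_ge_cases l q) as [Hlq|Hlq].
      + rewrite !Lneg by lia. btauto.
      + rewrite !Lpos by lia. simpl. btauto. }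
  rewrite (xsum_ext n _ (fun j => xorb (beta j) (beta (S j)))) in HB' by exact Hrow.
  rewrite xsum_telescope in HB'. unfold beta in HB'.
  rewrite T0, Tn in HB'. rewrite (nonnegb_false _ HN0), (nonnegb_true _ HN1) in HB'. easy.
Qed.

(** * Planar differential equations *)

Lemma derive_plus (f g : R -> R) x a b :
  is_derive f x a -> is_derive g x b -> is_derive (fun s => f s + g s) x (a + b).
Proof. exact (is_derive_plus f g x a b). Qed.

Lemma derive_minus (f g : R -> R) x a b :
  is_derive f x a -> is_derive g x b -> is_derive (fun s => f s - g s) x (a - b).
Proof. exact (is_derive_minus f g x a b). Qed.

Lemma derive_nonneg_le (f df : R -> R) (a b : R) :
  a <= b -> (forall s, a <= s <= b -> is_derive f s (df s)) ->
  (forall s, a <= s <= b -> 0 <= df s) -> f a <= f b.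
Proof.
  intros Hab Hd Hp.
  destruct (MVT_gen f a b df) as (c & Hc & E).
  - rewrite Rmin_left, Rmax_right by easy. intros; apply Hd; lra.
  - rewrite Rmin_left, Rmax_right by easy. intros s Hs.
    apply continuity_pt_filterlim, @ex_derive_continuous. eexists; apply Hd; lra.
  - rewrite Rmin_left, Rmax_right in Hc by easy. specialize (Hp c Hc). nra.
Qed.

(** Takes the place of estimating integrals: the growth of a difference is read
    off its derivative. *)
Lemma derive_dominated_le (f df h dh : R -> R) (a b : R) :
  a <= b -> (forall s, a <= s <= b -> is_derive f s (df s)) ->
  (forall s, a <= s <= b -> is_derive h s (dh s)) ->
  (forall s, a <= s <= b -> Rabs (df s) <= dh s) ->
  Rabs (f a) <= h a -> Rabs (f b) <= h b.
Proof.
  intros Hab Hf Hh Hle H0. apply Rabs_le_between in H0. apply Rabs_le_between.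
  assert (P : h a + f a <= h b + f b).
  { apply (derive_nonneg_le (fun s => h s + f s) (fun s => dh s + df s)); [easy| |].
    - intros s Hs. apply derive_plus; auto.
    - intros s Hs. specialize (Hle s Hs). apply Rabs_le_between in Hle. lra. }
  assert (M : h a - f a <= h b - f b).
  { apply (derive_nonneg_le (fun s => h s - f s) (fun s => dh s - df s)); [easy| |].
    - intros s Hs. apply derive_minus; auto.
    - intros s Hs. specialize (Hle s Hs). apply Rabs_le_between in Hle. lra. }
  lra.
Qed.

Definition antiderivative (f : R -> R) (c x : R) : R := c + RInt f (-1) x.

Lemma antiderivative_start f c : antiderivative f c (-1) = c.
Proof. unfold antiderivative. rewrite RInt_point. apply Rplus_0_r. Qed.

Lemma antiderivative_derive f c x :
  (forall s, continuous f s) -> is_derive (antiderivative f c) x (f x).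
Proof.
  intros Hf. unfold antiderivative.
  replace (f x) with (0 + f x) by ring.
  apply derive_plus; [exact (is_derive_const c x)|].
  apply (is_derive_RInt f _ (-1)); [|apply Hf].
  apply filter_forall. intros b. apply (@RInt_correct R_CompleteNormedModule).
  apply (@ex_RInt_continuous R_CompleteNormedModule). intros; apply Hf.
Qed.

Lemma lipschitz_continuous (f : R -> R) (M : R) :
  (forall x y, Rabs (f x - f y) <= M * Rabs (x - y)) -> forall x, continuous f x.
Proof.
  intros H x. apply filterlim_locally. intros eps.
  assert (HM : 0 <= M).
  { specialize (H 1 0). rewrite Rminus_0_r, Rabs_R1 in H.
    pose proof (Rabs_pos (f 1 - f 0)). lra. }
  assert (Hd : 0 < eps / (M + 1)) by (apply Rdiv_lt_0_compat; [apply cond_pos|lra]).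
  exists (mkposreal _ Hd). intros y Hy. change (Rabs (y - x) < eps / (M + 1)) in Hy.
  change (Rabs (f y - f x) < eps). eapply Rle_lt_trans; [apply H|].
  apply (Rmult_lt_compat_r (M + 1)) in Hy; [|lra].
  unfold Rdiv in Hy. rewrite Rmult_assoc, Rinv_l, Rmult_1_r in Hy by lra.
  pose proof (Rabs_pos (y - x)). nra.
Qed.

Lemma geometric_convergence (u : nat -> R) (c : R) :
  (forall n, Rabs (u (S n) - u n) <= c * (/ 2) ^ n) ->
  forall n, Rabs (u n - real (Lim_seq u)) <= 2 * c * (/ 2) ^ n.
Proof.
  intros H.
  assert (Hk : forall n k, Rabs (u (n + k)%nat - u n) <= 2 * c * (/ 2) ^ n - 2 * c * (/ 2) ^ (n + k)).
  { intros n. induction k as [|k IH].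
    - rewrite Nat.add_0_r, Rminus_diag, Rabs_R0. lra.
    - rewrite Nat.add_succ_r. specialize (H (n + k)%nat).
      replace (u (S (n + k)) - u n) with ((u (S (n + k)) - u (n + k)%nat) + (u (n + k)%nat - u n)) by ring.
      eapply Rle_trans; [apply Rabs_triang|]. simpl. lra. }
  assert (Hc : 0 <= c).
  { specialize (H 0%nat). simpl in H. pose proof (Rabs_pos (u 1%nat - u 0%nat)). lra. }
  assert (Hp : forall n, 0 < (/ 2) ^ n) by (intros; apply pow_lt; lra).
  assert (Hk' : forall n k, Rabs (u (n + k)%nat - u n) <= 2 * c * (/ 2) ^ n).
  { intros n k. specialize (Hk n k). specialize (Hp (n + k)%nat). nra. }
  assert (L0 : is_lim_seq (fun n => 2 * c * (/ 2) ^ n) 0).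
  { replace (Finite 0) with (Rbar_mult (2 * c) 0) by (simpl; f_equal; ring).
    apply is_lim_seq_scal_l. apply is_lim_seq_geom. rewrite Rabs_pos_eq; lra. }
  assert (Hex : ex_finite_lim_seq u).
  { apply ex_lim_seq_cauchy_corr. intros eps.
    apply is_lim_seq_spec in L0.
    destruct (L0 (pos_div_2 eps)) as [N HN]. exists N.
    specialize (HN N (le_n N)). rewrite Rminus_0_r in HN. simpl in HN.
    apply Rabs_def2 in HN.
    intros n m Hn Hm.
    replace n with (N + (n - N))%nat by lia. replace m with (N + (m - N))%nat by lia.
    replace (u (N + (n - N))%nat - u (N + (m - N))%nat) with
      ((u (N + (n - N))%nat - u N) - (u (N + (m - N))%nat - u N)) by ring.
    eapply Rle_lt_trans; [apply Rabs_triang|]. rewrite Rabs_Ropp.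
    pose proof (Hk' N (n - N)%nat). pose proof (Hk' N (m - N)%nat). lra. }
  intros n. apply Lim_seq_correct' in Hex.
  assert (Hl : is_lim_seq (fun k => Rabs (u n - u (k + n)%nat)) (Rabs (u n - real (Lim_seq u)))).
  { apply (is_lim_seq_abs _ (Finite (u n - real (Lim_seq u)))).
    apply is_lim_seq_minus'; [apply is_lim_seq_const|].
    apply is_lim_seq_incr_n. exact Hex. }
  refine (is_lim_seq_le _ _ _ (Finite _) _ Hl (is_lim_seq_const _)).
  intros k. rewrite Rabs_minus_sym, Nat.add_comm. apply Hk'.
Qed.

Lemma derive_bounded_lipschitz (f df : R -> R) (M : R) :
  (forall x, is_derive f x (df x)) -> (forall x, Rabs (df x) <= M) ->
  forall x y, Rabs (f x - f y) <= M * Rabs (x - y).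
Proof.
  intros Hd HM x y.
  destruct (MVT_gen f y x df) as (c & _ & E).
  - intros; apply Hd.
  - intros. apply continuity_pt_filterlim, @ex_derive_continuous. eexists; apply Hd.
  - rewrite E, Rabs_mult. apply Rmult_le_compat_r; [apply Rabs_pos|apply HM].
Qed.

Lemma Rmax_lipschitz a x y : Rabs (Rmax x a - Rmax y a) <= Rabs (x - y).
Proof.
  unfold Rmax. destruct (Rle_dec x a), (Rle_dec y a); unfold Rabs;
    repeat destruct Rcase_abs; lra.
Qed.

Lemma continuous_eps (f : R -> R) (x : R) :
  (forall eps, 0 < eps -> exists d, 0 < d /\ forall y, Rabs (y - x) < d ->
     Rabs (f y - f x) < eps) -> continuous f x.
Proof.
  intros H. apply filterlim_locally. intros eps.
  destruct (H eps (cond_pos eps)) as (d & Hd & K).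
  exists (mkposreal _ Hd). intros y Hy. exact (K y Hy).
Qed.

Lemma continuous_eps_inv (f : R -> R) (x : R) : continuous f x ->
  forall eps, 0 < eps -> exists d, 0 < d /\ forall y, Rabs (y - x) < d ->
     Rabs (f y - f x) < eps.
Proof.
  intros H eps He. 
  destruct (proj1 (filterlim_locally _ _) H (mkposreal _ He)) as [d Hd].
  exists d. split; [apply cond_pos|]. intros y Hy. exact (Hd y Hy).
Qed.

Section Picard.
Variables (V1 V2 : R -> R -> R -> R) (K M y0 z0 : R).
Hypothesis HK : 0 <= K.
Hypothesis bound1 : forall x a b, Rabs (V1 x a b) <= M.
Hypothesis bound2 : forall x a b, Rabs (V2 x a b) <= M.
Hypothesis lip1 : forall x a b a' b',
  Rabs (V1 x a b - V1 x a' b') <= K * (Rabs (a - a') + Rabs (b - b')).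
Hypothesis lip2 : forall x a b a' b',
  Rabs (V2 x a b - V2 x a' b') <= K * (Rabs (a - a') + Rabs (b - b')).
Hypothesis cont1 : forall x a b, continuous (fun s => V1 s a b) x.
Hypothesis cont2 : forall x a b, continuous (fun s => V2 s a b) x.

Let M_pos : 0 <= M.
Proof. eapply Rle_trans; [apply Rabs_pos|apply (bound1 0 0 0)]. Qed.

Lemma field_continuous_along (V : R -> R -> R -> R) (y z : R -> R)
  (lip : forall x a b a' b',
    Rabs (V x a b - V x a' b') <= K * (Rabs (a - a') + Rabs (b - b')))
  (cont : forall x a b, continuous (fun s => V s a b) x) :
  (forall s, continuous y s) -> (forall s, continuous z s) ->
  forall s, continuous (fun s => V s (y s) (z s)) s.
Proof.
  intros Hy Hz x. apply continuous_eps. intros eps He.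
  destruct (continuous_eps_inv _ _ (cont x (y x) (z x)) (eps / 2)) as (d1 & Hd1 & H1); [lra|].
  assert (He2 : 0 < eps / (4 * (K + 1))) by (apply Rdiv_lt_0_compat; lra).
  destruct (continuous_eps_inv _ _ (Hy x) _ He2) as (d2 & Hd2 & H2).
  destruct (continuous_eps_inv _ _ (Hz x) _ He2) as (d3 & Hd3 & H3).
  exists (Rmin d1 (Rmin d2 d3)). split; [repeat apply Rmin_glb_lt; easy|].
  intros s Hs.
  pose proof (Rmin_l d1 (Rmin d2 d3)). pose proof (Rmin_r d1 (Rmin d2 d3)).
  pose proof (Rmin_l d2 d3). pose proof (Rmin_r d2 d3).
  specialize (H1 s ltac:(lra)). specialize (H2 s ltac:(lra)). specialize (H3 s ltac:(lra)).
  replace (V s (y s) (z s) - V x (y x) (z x)) with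
    ((V s (y s) (z s) - V s (y x) (z x)) + (V s (y x) (z x) - V x (y x) (z x))) by ring.
  eapply Rle_lt_trans; [apply Rabs_triang|].
  specialize (lip s (y s) (z s) (y x) (z x)).
  assert (E : eps = 4 * (K + 1) * (eps / (4 * (K + 1)))) by (field; lra).
  set (e := eps / (4 * (K + 1))) in *. nra.
Qed.

(** Freezing the state before time -1 makes the iterates differentiable on the
    whole line, so that no one-sided derivative occurs at -1. *)
Definition from_start (s : R) : R := Rmax s (-1).

Definition picard_step (V : R -> R -> R -> R) (c : R) (y z : R -> R) : R -> R :=
  antiderivative (fun s => V s (y (from_start s)) (z (from_start s))) c.

Fixpoint picard_iter (n : nat) : (R -> R) * (R -> R) :=
  match n with
  | O => (fun _ => y0, fun _ => z0)
  | S n' => let yz := picard_iter n' in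
      (picard_step V1 y0 (fst yz) (snd yz), picard_step V2 z0 (fst yz) (snd yz))
  end.

Lemma from_start_lipschitz y :
  (forall a b, Rabs (y a - y b) <= M * Rabs (a - b)) ->
  forall s, continuous (fun s => y (from_start s)) s.
Proof.
  intros H. apply (lipschitz_continuous _ M). intros a b.
  eapply Rle_trans; [apply H|]. apply Rmult_le_compat_l; [apply M_pos|].
  apply Rmax_lipschitz.
Qed.

Lemma picard_step_derive V c y z
  (lip : forall x a b a' b',
    Rabs (V x a b - V x a' b') <= K * (Rabs (a - a') + Rabs (b - b')))
  (cont : forall x a b, continuous (fun s => V s a b) x) :
  (forall a b, Rabs (y a - y b) <= M * Rabs (a - b)) ->
  (forall a b, Rabs (z a - z b) <= M * Rabs (a - b)) ->
  forall x, is_derive (picard_step V c y z) x (V x (y (from_start x)) (z (from_start x))).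
Proof.
  intros Hy Hz x.
  apply (antiderivative_derive (fun s => V s (y (from_start s)) (z (from_start s)))).
  apply (field_continuous_along V (fun s => y (from_start s)) (fun s => z (from_start s))
     lip cont); apply from_start_lipschitz; assumption.
Qed.

Lemma picard_iter_lipschitz n :
  (forall a b, Rabs (fst (picard_iter n) a - fst (picard_iter n) b) <= M * Rabs (a - b)) /\
  (forall a b, Rabs (snd (picard_iter n) a - snd (picard_iter n) b) <= M * Rabs (a - b)).
Proof.
  induction n as [|n [IH1 IH2]]; simpl.
  - split; intros a b; rewrite Rminus_diag, Rabs_R0;
      (apply Rmult_le_pos; [apply M_pos|apply Rabs_pos]).
  - split.
    + apply (derive_bounded_lipschitz _ _ M
        (picard_step_derive V1 y0 _ _ lip1 cont1 IH1 IH2)); intros; apply bound1.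
    + apply (derive_bounded_lipschitz _ _ M
        (picard_step_derive V2 z0 _ _ lip2 cont2 IH1 IH2)); intros; apply bound2.
Qed.

Let rate : R := 4 * K + 1.
Let growth (n : nat) (x : R) : R := M * (/ 2) ^ n * exp (rate * (x + 1)).

Let growth_derive c x :
  is_derive (fun s => c * exp (rate * (s + 1))) x (rate * (c * exp (rate * (x + 1)))).
Proof. auto_derive; [easy|]. ring. Qed.

(** In the norm weighted by [exp (rate * (x + 1))], a Picard step contracts by
    the factor [2 * K / rate], which is at most 1/2. *)
Lemma picard_iter_diff n x : -1 <= x ->
  Rabs (fst (picard_iter (S n)) x - fst (picard_iter n) x) <= growth n x /\
  Rabs (snd (picard_iter (S n)) x - snd (picard_iter n) x) <= growth n x.
Proof.
  revert x. induction n as [|n IH]; intros x Hx.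
  - assert (B : forall V c,
      (forall x a b a' b',
        Rabs (V x a b - V x a' b') <= K * (Rabs (a - a') + Rabs (b - b'))) ->
      (forall x a b, continuous (fun s => V s a b) x) ->
      (forall x a b, Rabs (V x a b) <= M) ->
      Rabs (picard_step V c (fun _ => y0) (fun _ => z0) x - c) <= growth 0 x).
    { intros V c lip cont bound. unfold growth. rewrite pow_O, Rmult_1_r.
      apply (derive_dominated_le (fun s => picard_step V c (fun _ => y0) (fun _ => z0) s - c)
        (fun s => V s y0 z0 - 0) (fun s => M * exp (rate * (s + 1))) (fun s => rate * (M * exp (rate * (s + 1)))) (-1) x Hx).
      - intros s _. apply derive_minus; [|exact (is_derive_const c s)].
        apply (picard_step_derive V c (fun _ => y0) (fun _ => z0) lip cont);
          intros; rewrite Rminus_diag, Rabs_R0; apply Rmult_le_pos; auto; apply Rabs_pos.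
      - intros s _. apply growth_derive.
      - intros s Hs. rewrite Rminus_0_r. eapply Rle_trans; [apply bound|].
        assert (1 <= exp (rate * (s + 1))).
        { pose proof (exp_ineq1_le (rate * (s + 1))). unfold rate in *. nra. }
        assert (1 <= rate) by (unfold rate; lra).
        pose proof M_pos. assert (M <= M * exp (rate * (s + 1))) by nra. nra.
      - unfold picard_step. rewrite antiderivative_start, Rminus_diag, Rabs_R0.
        apply Rmult_le_pos; [apply M_pos|apply Rlt_le, exp_pos]. }
    simpl. split; apply B; assumption.
  - assert (B : forall V c,
      (forall x a b a' b',
        Rabs (V x a b - V x a' b') <= K * (Rabs (a - a') + Rabs (b - b'))) ->
      (forall x a b, continuous (fun s => V s a b) x) ->
      Rabs (picard_step V c (fst (picard_iter (S n))) (snd (picard_iter (S n))) x -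
         picard_step V c (fst (picard_iter n)) (snd (picard_iter n)) x) <= growth (S n) x).
    { intros V c lip cont. unfold growth.
      set (p := picard_iter (S n)) in *. set (r := picard_iter n) in *.
      pose proof (picard_iter_lipschitz (S n)) as [L1 L2]. fold p in L1, L2.
      pose proof (picard_iter_lipschitz n) as [L3 L4]. fold r in L3, L4.
      apply (derive_dominated_le
        (fun s => picard_step V c (fst p) (snd p) s - picard_step V c (fst r) (snd r) s)
        (fun s => V s (fst p (from_start s)) (snd p (from_start s)) -
                  V s (fst r (from_start s)) (snd r (from_start s))) (fun s => M * (/ 2) ^ (S n) * exp (rate * (s + 1)))
        (fun s => rate * (M * (/ 2) ^ (S n) * exp (rate * (s + 1)))) (-1) x Hx).
      - intros s _. apply derive_minus; apply picard_step_derive; assumption.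
      - intros s _. apply growth_derive.
      - intros s Hs. unfold from_start. rewrite Rmax_left by lra.
        eapply Rle_trans; [apply lip|].
        destruct (IH s) as [I1 I2]; [lra|]. unfold growth in I1, I2.
        pose proof (exp_pos (rate * (s + 1))) as Ee.
        change ((/ 2) ^ S n) with (/ 2 * (/ 2) ^ n).
        assert (Hp : 0 < (/ 2) ^ n) by (apply pow_lt; lra).
        set (w := (/ 2) ^ n) in *. set (e := exp (rate * (s + 1))) in *.
        assert (0 <= M * w * e) by (pose proof M_pos; apply Rmult_le_pos; [nra|lra]).
        replace (rate * (M * (/ 2 * w) * e)) with (rate / 2 * (M * w * e)) by field.
        unfold rate. nra.
      - unfold picard_step. rewrite !antiderivative_start, Rminus_diag, Rabs_R0.
        apply Rmult_le_pos; [|apply Rlt_le, exp_pos].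
        apply Rmult_le_pos; [apply M_pos|]. apply pow_le; lra. }
    split; apply B; assumption.
Qed.

Lemma picard_existence : exists y z : R -> R,
  y (-1) = y0 /\ z (-1) = z0 /\
  forall x, -1 <= x -> is_derive y x (V1 x (y x) (z x)) /\ is_derive z x (V2 x (y x) (z x)).
Proof.
  set (y := fun x => real (Lim_seq (fun n => fst (picard_iter n) (from_start x)))).
  set (z := fun x => real (Lim_seq (fun n => snd (picard_iter n) (from_start x)))).
  set (lim := fun x => 2 * (M * exp (rate * (from_start x + 1)))).
  assert (Hfs : forall x, -1 <= from_start x) by (intros; apply Rmax_r).
  assert (Hy : forall n x, Rabs (fst (picard_iter n) (from_start x) - y x) <= lim x * (/ 2) ^ n).
  { intros n x. unfold lim, y.
    apply (geometric_convergence (fun n => fst (picard_iter n) (from_start x))).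
    intros k. eapply Rle_trans; [apply (picard_iter_diff k (from_start x) (Hfs x))|].
    right. unfold growth. ring. }
  assert (Hz : forall n x, Rabs (snd (picard_iter n) (from_start x) - z x) <= lim x * (/ 2) ^ n).
  { intros n x. unfold lim, z.
    apply (geometric_convergence (fun n => snd (picard_iter n) (from_start x))).
    intros k. eapply Rle_trans; [apply (picard_iter_diff k (from_start x) (Hfs x))|].
    right. unfold growth. ring. }
  assert (small : forall c r, (forall n, r <= c * (/ 2) ^ n) -> r <= 0).
  { intros c r H.
    assert (L0 : is_lim_seq (fun n => c * (/ 2) ^ n) 0).
    { replace (Finite 0) with (Rbar_mult c 0) by (simpl; f_equal; ring).
      apply is_lim_seq_scal_l. apply is_lim_seq_geom. rewrite Rabs_pos_eq; lra. }
    exact (is_lim_seq_le _ _ (Finite _) (Finite _) H (is_lim_seq_const r) L0). }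
  assert (lip_lim : forall (p : nat -> R -> R) u,
    (forall n a b, Rabs (p n a - p n b) <= M * Rabs (a - b)) ->
    (forall n x, Rabs (p n (from_start x) - u x) <= lim x * (/ 2) ^ n) ->
    forall a b, Rabs (u a - u b) <= M * Rabs (a - b)).
  { intros p u Lp Lu a b.
    assert (Rabs (u a - u b) - M * Rabs (a - b) <= 0); [|lra].
    apply (small (lim a + lim b)). intros n.
    pose proof (Lu n a) as Ha. pose proof (Lu n b) as Hb.
    pose proof (Lp n (from_start a) (from_start b)) as Hab.
    pose proof (Rmax_lipschitz (-1) a b) as Hm.
    fold (from_start a) (from_start b) in Hm.
    assert (M * Rabs (from_start a - from_start b) <= M * Rabs (a - b))
      by (apply Rmult_le_compat_l; [apply M_pos|easy]).
    rewrite Rabs_minus_sym in Ha.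
    pose proof (Rabs_triang (u a - p n (from_start a))
      ((p n (from_start a) - p n (from_start b)) + (p n (from_start b) - u b))) as T1.
    pose proof (Rabs_triang (p n (from_start a) - p n (from_start b))
       (p n (from_start b) - u b)) as T2.
    replace (u a - p n (from_start a) + (p n (from_start a) - p n (from_start b) +
      (p n (from_start b) - u b))) with (u a - u b) in T1 by ring. lra. }
  assert (Ly : forall a b, Rabs (y a - y b) <= M * Rabs (a - b)).
  { apply (lip_lim (fun n => fst (picard_iter n))); [|exact Hy].
    intros n; apply (picard_iter_lipschitz n). }
  assert (Lz : forall a b, Rabs (z a - z b) <= M * Rabs (a - b)).
  { apply (lip_lim (fun n => snd (picard_iter n))); [|exact Hz].
    intros n; apply (picard_iter_lipschitz n). }
  assert (fix_eq : forall V c (p : nat -> R -> R) u,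
    (forall x a b a' b',
      Rabs (V x a b - V x a' b') <= K * (Rabs (a - a') + Rabs (b - b'))) ->
    (forall x a b, continuous (fun s => V s a b) x) ->
    (forall n, p (S n) = picard_step V c (fst (picard_iter n)) (snd (picard_iter n))) ->
    (forall n x, Rabs (p n (from_start x) - u x) <= lim x * (/ 2) ^ n) ->
    forall x, -1 <= x -> picard_step V c y z x = u x).
  { intros V c p u lip cont Hp Hu x Hx.
    assert (Rabs (picard_step V c y z x - u x) <= 0).
    2:{ pose proof (Rabs_pos (picard_step V c y z x - u x)).
        apply Rminus_diag_uniq, Rabs_eq_0. lra. }
    apply (small (2 * (M * exp (rate * (x + 1))) + lim x)). intros n.
    assert (D : Rabs (picard_step V c y z x - p (S n) x)
       <= 2 * M * (/ 2) ^ n * exp (rate * (x + 1))).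
    { rewrite Hp.
      set (r := picard_iter n) in *.
      pose proof (picard_iter_lipschitz n) as [L3 L4]. fold r in L3, L4.
      apply (derive_dominated_le
        (fun s => picard_step V c y z s - picard_step V c (fst r) (snd r) s)
        (fun s => V s (y (from_start s)) (z (from_start s)) -
                  V s (fst r (from_start s)) (snd r (from_start s)))
        (fun s => 2 * M * (/ 2) ^ n * exp (rate * (s + 1)))
        (fun s => rate * (2 * M * (/ 2) ^ n * exp (rate * (s + 1)))) (-1) x Hx).
      - intros s _. apply derive_minus; apply picard_step_derive; assumption.
      - intros s _. apply growth_derive.
      - intros s Hs.
        eapply Rle_trans; [apply lip|].
        specialize (Hy n (from_start s)). specialize (Hz n (from_start s)).
        fold r in Hy, Hz. unfold lim in Hy, Hz.
        rewrite Rabs_minus_sym in Hy. rewrite Rabs_minus_sym in Hz.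
        assert (Es : from_start s = s) by (unfold from_start; rewrite Rmax_left; lra).
        rewrite !Es in *.
        pose proof (exp_pos (rate * (s + 1))) as Ee.
        assert (Hpw : 0 < (/ 2) ^ n) by (apply pow_lt; lra).
        set (w := (/ 2) ^ n) in *. set (e := exp (rate * (s + 1))) in *.
        assert (0 <= M * w * e) by (pose proof M_pos; apply Rmult_le_pos; [nra|lra]).
        replace (rate * (2 * M * w * e)) with (2 * rate * (M * w * e)) by ring.
        replace (2 * (M * e) * w) with (2 * (M * w * e)) in * by ring.
        unfold rate. nra.
      - unfold picard_step. rewrite !antiderivative_start, Rminus_diag, Rabs_R0.
        apply Rmult_le_pos; [|apply Rlt_le, exp_pos].
        apply Rmult_le_pos; [pose proof M_pos; lra|]. apply pow_le; lra. }
    pose proof (Hu (S n) x) as Hn.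
    replace (from_start x) with x in Hn by (unfold from_start; rewrite Rmax_left; lra).
    replace (picard_step V c y z x - u x) with
      ((picard_step V c y z x - p (S n) x) + (p (S n) x - u x)) by ring.
    eapply Rle_trans; [apply Rabs_triang|]. simpl in Hn |- *.
    assert (0 <= lim x * (/ 2) ^ n).
    { eapply Rle_trans; [apply Rabs_pos|apply (Hu n)]. }
    nra. }
  exists (picard_step V1 y0 y z), (picard_step V2 z0 y z).
  split; [apply antiderivative_start|]. split; [apply antiderivative_start|].
  intros x Hx.
  rewrite (fix_eq V1 y0 (fun n => fst (picard_iter n)) y lip1 cont1 (fun _ => eq_refl) Hy x Hx).
  rewrite (fix_eq V2 z0 (fun n => snd (picard_iter n)) z lip2 cont2 (fun _ => eq_refl) Hz x Hx).
  assert (Es : from_start x = x) by (unfold from_start; rewrite Rmax_left; lra).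
  pose proof (picard_step_derive V1 y0 y z lip1 cont1 Ly Lz x) as D1.
  pose proof (picard_step_derive V2 z0 y z lip2 cont2 Ly Lz x) as D2.
  rewrite Es in D1, D2. easy.
Qed.
End Picard.

(** Gronwall's argument for the squared distance [q] of the two solutions, which
    satisfies [q' <= (4 * K + 2) * q] once [eps ^ 2] is added to it. *)
Lemma planar_dependence (y z u v : R -> R) (V1 V2 W1 W2 : R -> R -> R -> R) (K eps : R) :
  0 <= K -> 0 <= eps ->
  (forall x, J x -> is_derive y x (V1 x (y x) (z x)) /\ is_derive z x (V2 x (y x) (z x))) ->
  (forall x, J x -> is_derive u x (W1 x (u x) (v x)) /\ is_derive v x (W2 x (u x) (v x))) ->
  (forall x a b a' b', J x ->
     Rabs (W1 x a b - W1 x a' b') <= K * (Rabs (a - a') + Rabs (b - b')) /\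
     Rabs (W2 x a b - W2 x a' b') <= K * (Rabs (a - a') + Rabs (b - b'))) ->
  (forall x, J x -> Rabs (V1 x (y x) (z x) - W1 x (y x) (z x)) <= eps /\
     Rabs (V2 x (y x) (z x) - W2 x (y x) (z x)) <= eps) ->
  forall x, J x ->
    (y x - u x) ^ 2 + (z x - v x) ^ 2 <=
    ((y (-1) - u (-1)) ^ 2 + (z (-1) - v (-1)) ^ 2 + eps ^ 2) * exp (2 * (4 * K + 2)).
Proof.
  intros HK He Hyz Huv Hlip Hclose x Hx.
  set (c := 4 * K + 2).
  set (q := fun s => (y s - u s) ^ 2 + (z s - v s) ^ 2 + eps ^ 2).
  set (dq := fun s => 2 * (y s - u s) * (V1 s (y s) (z s) - W1 s (u s) (v s)) +
                      2 * (z s - v s) * (V2 s (y s) (z s) - W2 s (u s) (v s))).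
  assert (Hdec : - (q (-1) * exp (- c * (-1 + 1))) <= - (q x * exp (- c * (x + 1)))).
  { apply (derive_nonneg_le (fun s => - (q s * exp (- c * (s + 1))))
      (fun s => - ((dq s - c * q s) * exp (- c * (s + 1)))) (-1) x).
    - apply Hx.
    - intros s Hs. assert (Js : J s) by (unfold J in *; lra).
      destruct (Hyz s Js) as [D1 D2]. destruct (Huv s Js) as [D3 D4].
      unfold q, dq. auto_derive.
      + repeat split; eexists; eassumption.
      + rewrite (is_derive_unique (fun x : R => y x) _ _ D1), (is_derive_unique (fun x : R => z x) _ _ D2),
          (is_derive_unique (fun x : R => u x) _ _ D3), (is_derive_unique (fun x : R => v x) _ _ D4). ring.
    - intros s Hs. assert (Js : J s) by (unfold J in *; lra).
      pose proof (exp_pos (- c * (s + 1))) as Ep.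
      assert (dq s <= c * q s); [|nra].
      destruct (Hlip s (y s) (z s) (u s) (v s) Js) as [L1 L2].
      destruct (Hclose s Js) as [C1 C2].
      assert (B1 : Rabs (V1 s (y s) (z s) - W1 s (u s) (v s)) <=
         eps + K * (Rabs (y s - u s) + Rabs (z s - v s))).
      { replace (V1 s (y s) (z s) - W1 s (u s) (v s)) with
          ((V1 s (y s) (z s) - W1 s (y s) (z s)) + (W1 s (y s) (z s) - W1 s (u s) (v s))) by ring.
        eapply Rle_trans; [apply Rabs_triang|]. lra. }
      assert (B2 : Rabs (V2 s (y s) (z s) - W2 s (u s) (v s)) <=
         eps + K * (Rabs (y s - u s) + Rabs (z s - v s))).
      { replace (V2 s (y s) (z s) - W2 s (u s) (v s)) with
          ((V2 s (y s) (z s) - W2 s (y s) (z s)) + (W2 s (y s) (z s) - W2 s (u s) (v s))) by ring.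
        eapply Rle_trans; [apply Rabs_triang|]. lra. }
      unfold dq, q.
      set (X1 := V1 s (y s) (z s) - W1 s (u s) (v s)) in *.
      set (X2 := V2 s (y s) (z s) - W2 s (u s) (v s)) in *.
      set (p := y s - u s) in *. set (r := z s - v s) in *.
      assert (P1 : p * X1 <= Rabs p * (eps + K * (Rabs p + Rabs r))).
      { eapply Rle_trans; [apply Rle_abs|]. rewrite Rabs_mult.
        apply Rmult_le_compat_l; [apply Rabs_pos|easy]. }
      assert (P2 : r * X2 <= Rabs r * (eps + K * (Rabs p + Rabs r))).
      { eapply Rle_trans; [apply Rle_abs|]. rewrite Rabs_mult.
        apply Rmult_le_compat_l; [apply Rabs_pos|easy]. }
      rewrite <- (pow2_abs p), <- (pow2_abs r).
      pose proof (Rabs_pos p). pose proof (Rabs_pos r).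
      set (a := Rabs p) in *. set (b := Rabs r) in *. unfold c.
      assert (Q1 : 2 * a * eps <= a ^ 2 + eps ^ 2) by (pose proof (pow2_ge_0 (a - eps)); nra).
      assert (Q2 : 2 * b * eps <= b ^ 2 + eps ^ 2) by (pose proof (pow2_ge_0 (b - eps)); nra).
      assert (Q3 : K * (a + b) ^ 2 <= K * (2 * (a ^ 2 + b ^ 2))).
      { apply Rmult_le_compat_l; [easy|]. pose proof (pow2_ge_0 (a - b)); nra. }
      assert (0 <= K * eps ^ 2) by (apply Rmult_le_pos; [easy|apply pow2_ge_0]).
      nra. }
  replace (- c * (-1 + 1)) with 0 in Hdec by ring. rewrite exp_0, Rmult_1_r in Hdec.
  fold (q (-1)).
  assert (Eq : q x = q x * exp (- c * (x + 1)) * exp (c * (x + 1))).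
  { rewrite Rmult_assoc, <- exp_plus. replace (- c * (x + 1) + c * (x + 1)) with 0 by ring.
    rewrite exp_0. ring. }
  assert (Q0 : 0 <= q (-1)).
  { unfold q. pose proof (pow2_ge_0 (y (-1) - u (-1))). pose proof (pow2_ge_0 (z (-1) - v (-1))).
    pose proof (pow2_ge_0 eps). lra. }
  assert (Hexp : exp (c * (x + 1)) <= exp (2 * c)).
  { destruct (Req_dec (c * (x + 1)) (2 * c)) as [->|N]; [lra|].
    apply Rlt_le, exp_increasing. unfold J in Hx. unfold c in *. nra. }
  assert (q x <= q (-1) * exp (c * (x + 1))).
  { rewrite Eq. apply Rmult_le_compat_r; [apply Rlt_le, exp_pos|]. lra. }
  assert (q (-1) * exp (c * (x + 1)) <= q (-1) * exp (2 * c)) by (apply Rmult_le_compat_l; easy).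
  pose proof (pow2_ge_0 eps). unfold q in *. lra.
Qed.

(** * The polar form of the equation *)

(** In polar coordinates [u = r * sin th], [u' = r * cos th] and with [l = ln r],
    the equation [- u'' = lam * f] becomes the system below for [(th, l)], where
    [S] is [f / r].  The bounds make this system globally Lipschitz, so that both
    [th] and [l] exist on all of [J]; [t] is a homotopy variable, in which
    continuity is only required for bounded [l]. *)
Record polar_field (S : R -> R -> R -> R -> R) (G L gm : R) : Prop := {
  pf_gm : 0 < gm;
  pf_L : 0 <= L;
  pf_bound : forall t x l th, 0 <= t <= 1 -> J x -> Rabs (S t x l th) <= G;
  pf_lip : forall t x l th l' th', 0 <= t <= 1 -> J x ->
    Rabs (S t x l th - S t x l' th') <= L * (Rabs (l - l') + Rabs (th - th'));
  pf_cont : forall t l th, 0 <= t <= 1 -> forall x0, J x0 -> forall eps, 0 < eps ->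
    exists d, 0 < d /\ forall x, J x -> Rabs (x - x0) < d ->
      Rabs (S t x l th - S t x0 l th) < eps;
  pf_t : forall t0 C eps, 0 <= t0 <= 1 -> 0 < eps -> exists d, 0 < d /\
    forall t x l th, 0 <= t <= 1 -> Rabs (t - t0) < d -> J x -> Rabs l <= C ->
      Rabs (S t x l th - S t0 x l th) <= eps;
  pf_coercive : forall t x l th, 0 <= t <= 1 -> J x ->
    gm * sin th ^ 2 <= S t x l th * sin th
}.

Definition angle_speed (S : R -> R -> R -> R -> R) (t lam x th l : R) : R :=
  cos th ^ 2 + lam * S t x l th * sin th.

Definition logr_speed (S : R -> R -> R -> R -> R) (t lam x th l : R) : R :=
  cos th * sin th - lam * S t x l th * cos th.

Definition is_flow (S : R -> R -> R -> R -> R) (t lam a : R) (yz : (R -> R) * (R -> R)) : Prop :=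
  fst yz (-1) = a /\ snd yz (-1) = 0 /\
  forall x, J x ->
    is_derive (fst yz) x (angle_speed S t lam x (fst yz x) (snd yz x)) /\
    is_derive (snd yz) x (logr_speed S t lam x (fst yz x) (snd yz x)).

(** The first component is the angle, the second the logarithm of the radius;
    the radius is 1 at the point -1. *)
Definition flow (S : R -> R -> R -> R -> R) (t lam a : R) : (R -> R) * (R -> R) :=
  epsilon (inhabits (fun _ => 0, fun _ => 0)) (is_flow S t lam a).

Lemma sin_lipschitz x y : Rabs (sin x - sin y) <= Rabs (x - y).
Proof.
  rewrite <- (Rmult_1_l (Rabs (x - y))).
  apply (derive_bounded_lipschitz sin cos).
  - intros s. auto_derive; [easy|ring].
  - intros s. apply Rabs_le, COS_bound.
Qed.

Lemma cos_lipschitz x y : Rabs (cos x - cos y) <= Rabs (x - y).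
Proof.
  rewrite <- (Rmult_1_l (Rabs (x - y))).
  apply (derive_bounded_lipschitz cos (fun s => - sin s)).
  - intros s. auto_derive; [easy|ring].
  - intros s. rewrite Rabs_Ropp. apply Rabs_le, SIN_bound.
Qed.

Lemma Rabs_sin_le x : Rabs (sin x) <= 1.
Proof. apply Rabs_le, SIN_bound. Qed.

Lemma Rabs_cos_le x : Rabs (cos x) <= 1.
Proof. apply Rabs_le, COS_bound. Qed.

Lemma Rabs_mult_diff a b a' b' A B :
  Rabs a <= A -> Rabs b' <= B ->
  Rabs (a * b - a' * b') <= A * Rabs (b - b') + B * Rabs (a - a').
Proof.
  intros HA HB. replace (a * b - a' * b') with (a * (b - b') + (a - a') * b') by ring.
  eapply Rle_trans; [apply Rabs_triang|]. rewrite !Rabs_mult.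
  pose proof (Rabs_pos (b - b')). pose proof (Rabs_pos (a - a')). nra.
Qed.

Definition clamp (x : R) : R := Rmax (-1) (Rmin x 1).

Lemma clamp_in x : J (clamp x).
Proof. unfold J, clamp, Rmax, Rmin. destruct (Rle_dec x 1); destruct Rle_dec; lra. Qed.

Lemma clamp_id x : J x -> clamp x = x.
Proof. unfold J, clamp, Rmax, Rmin. destruct (Rle_dec x 1); destruct Rle_dec; lra. Qed.

Lemma clamp_lipschitz x y : Rabs (clamp x - clamp y) <= Rabs (x - y).
Proof.
  unfold clamp, Rmax, Rmin. destruct (Rle_dec x 1), (Rle_dec y 1);
    repeat destruct (Rle_dec (-1) _); unfold Rabs; repeat destruct Rcase_abs; lra.
Qed.

Section Flow.
Variables (S : R -> R -> R -> R -> R) (G L gm : R).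
Hypothesis HS : polar_field S G L gm.

Let G_pos : 0 <= G.
Proof.
  eapply Rle_trans; [apply Rabs_pos|apply (pf_bound _ _ _ _ HS 0 0 0 0)]; unfold J; lra.
Qed.

Lemma angle_speed_lipschitz t lam Lam x th l th' l' :
  0 <= t <= 1 -> 0 <= lam <= Lam -> J x ->
  Rabs (angle_speed S t lam x th l - angle_speed S t lam x th' l') <=
    (2 + Lam * (L + G)) * (Rabs (th - th') + Rabs (l - l')).
Proof.
  intros Ht Hlam Hx. unfold angle_speed.
  replace (cos th ^ 2 + lam * S t x l th * sin th - (cos th' ^ 2 + lam * S t x l' th' * sin th'))
   with ((cos th * cos th - cos th' * cos th') +
     lam * (S t x l th * sin th - S t x l' th' * sin th')) by ring.
  eapply Rle_trans; [apply Rabs_triang|].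
  rewrite (Rabs_mult lam), (Rabs_pos_eq lam) by lra.
  pose proof (Rabs_mult_diff _ (cos th) (cos th') _ _ _ (Rabs_cos_le th) (Rabs_cos_le th')) as H1.
  pose proof (Rabs_mult_diff _ (sin th) (S t x l' th') _ _ _
     (pf_bound _ _ _ _ HS t x l th Ht Hx) (Rabs_sin_le th')) as H2.
  pose proof (pf_lip _ _ _ _ HS t x l th l' th' Ht Hx) as H3.
  pose proof (cos_lipschitz th th'). pose proof (sin_lipschitz th th').
  pose proof (pf_L _ _ _ _ HS).
  set (s := Rabs (S t x l th * sin th - S t x l' th' * sin th')) in *.
  pose proof (Rabs_pos (th - th')). pose proof (Rabs_pos (l - l')).
  set (p := Rabs (th - th')) in *. set (r := Rabs (l - l')) in *.
  assert (s <= (L + G) * (p + r)) by nra.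
  assert (0 <= s) by apply Rabs_pos.
  assert (lam * s <= Lam * ((L + G) * (p + r))) by (apply Rmult_le_compat; lra).
  lra.
Qed.

Lemma logr_speed_lipschitz t lam Lam x th l th' l' :
  0 <= t <= 1 -> 0 <= lam <= Lam -> J x ->
  Rabs (logr_speed S t lam x th l - logr_speed S t lam x th' l') <=
    (2 + Lam * (L + G)) * (Rabs (th - th') + Rabs (l - l')).
Proof.
  intros Ht Hlam Hx. unfold logr_speed.
  replace (cos th * sin th - lam * S t x l th * cos th -
      (cos th' * sin th' - lam * S t x l' th' * cos th'))
   with ((cos th * sin th - cos th' * sin th') +
     - (lam * (S t x l th * cos th - S t x l' th' * cos th'))) by ring.
  eapply Rle_trans; [apply Rabs_triang|].
  rewrite Rabs_Ropp, (Rabs_mult lam), (Rabs_pos_eq lam) by lra.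
  pose proof (Rabs_mult_diff _ (sin th) (cos th') _ _ _ (Rabs_cos_le th) (Rabs_sin_le th')) as H1.
  pose proof (Rabs_mult_diff _ (cos th) (S t x l' th') _ _ _
     (pf_bound _ _ _ _ HS t x l th Ht Hx) (Rabs_cos_le th')) as H2.
  pose proof (pf_lip _ _ _ _ HS t x l th l' th' Ht Hx) as H3.
  pose proof (cos_lipschitz th th'). pose proof (sin_lipschitz th th').
  pose proof (pf_L _ _ _ _ HS).
  set (s := Rabs (S t x l th * cos th - S t x l' th' * cos th')) in *.
  pose proof (Rabs_pos (th - th')). pose proof (Rabs_pos (l - l')).
  set (p := Rabs (th - th')) in *. set (r := Rabs (l - l')) in *.
  assert (s <= (L + G) * (p + r)) by nra.
  assert (0 <= s) by apply Rabs_pos.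
  assert (lam * s <= Lam * ((L + G) * (p + r))) by (apply Rmult_le_compat; lra).
  lra.
Qed.

Lemma polar_field_continuous t l th x : 0 <= t <= 1 ->
  continuous (fun s => S t (clamp s) l th) x.
Proof.
  intros Ht. apply continuous_eps. intros eps He.
  destruct (pf_cont _ _ _ _ HS t l th Ht (clamp x) (clamp_in x) eps He) as (d & Hd & H).
  exists d. split; [easy|]. intros y Hy. apply H; [apply clamp_in|].
  eapply Rle_lt_trans; [apply clamp_lipschitz|easy].
Qed.

Lemma speed_bounds t lam x th l : 0 <= t <= 1 -> 0 <= lam -> J x ->
  Rabs (angle_speed S t lam x th l) <= 1 + lam * G /\
  Rabs (logr_speed S t lam x th l) <= 1 + lam * G.
Proof.
  intros Ht Hlam Hx. pose proof (pf_bound _ _ _ _ HS t x l th Ht Hx) as B.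
  pose proof (Rabs_sin_le th) as Bs. pose proof (Rabs_cos_le th) as Bc.
  pose proof (Rabs_pos (sin th)). pose proof (Rabs_pos (cos th)).
  pose proof (Rabs_pos (S t x l th)).
  assert (E : forall a b c, Rabs a <= 1 -> Rabs b <= 1 -> Rabs c <= 1 ->
     Rabs (a * b) + Rabs (lam * S t x l th * c) <= 1 + lam * G).
  { intros a b c Ha Hb Hc. rewrite !Rabs_mult, (Rabs_pos_eq lam) by lra.
    pose proof (Rabs_pos a). pose proof (Rabs_pos b). pose proof (Rabs_pos c).
    assert (Rabs a * Rabs b <= 1) by nra.
    assert (Rabs (S t x l th) * Rabs c <= G) by nra. nra. }
  split.
  - unfold angle_speed. eapply Rle_trans; [apply Rabs_triang|].
    replace (cos th ^ 2) with (cos th * cos th) by ring. apply E; easy.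
  - unfold logr_speed, Rminus. eapply Rle_trans; [apply Rabs_triang|].
    rewrite Rabs_Ropp. apply E; easy.
Qed.

Lemma flow_spec t lam a : 0 <= t <= 1 -> 0 <= lam -> is_flow S t lam a (flow S t lam a).
Proof.
  intros Ht Hlam. unfold flow. apply epsilon_spec.
  destruct (picard_existence
    (fun x th l => angle_speed S t lam (clamp x) th l)
    (fun x th l => logr_speed S t lam (clamp x) th l)
    (2 + lam * (L + G)) (1 + lam * G) a 0) as (y & z & Hy & Hz & H).
  - pose proof (pf_L _ _ _ _ HS). pose proof G_pos. nra.
  - intros. apply speed_bounds; auto using clamp_in.
  - intros. apply speed_bounds; auto using clamp_in.
  - intros. apply angle_speed_lipschitz; auto using clamp_in. lra.
  - intros. apply logr_speed_lipschitz; auto using clamp_in. lra.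
  - intros x th l. unfold angle_speed.
    apply (continuous_plus (V := R_NormedModule) (fun _ => cos th ^ 2)
      (fun s => lam * S t (clamp s) l th * sin th)); [apply continuous_const|].
    apply (continuous_mult (K := R_AbsRing) (fun s => lam * S t (clamp s) l th) (fun _ => sin th));
      [|apply continuous_const].
    apply (continuous_mult (K := R_AbsRing) (fun _ => lam) (fun s => S t (clamp s) l th));
      [apply continuous_const|]. apply polar_field_continuous, Ht.
  - intros x th l. unfold logr_speed.
    apply (continuous_minus (V := R_NormedModule) (fun _ => cos th * sin th)
      (fun s => lam * S t (clamp s) l th * cos th)); [apply continuous_const|].
    apply (continuous_mult (K := R_AbsRing) (fun s => lam * S t (clamp s) l th) (fun _ => cos th));
      [|apply continuous_const].
    apply (continuous_mult (K := R_AbsRing) (fun _ => lam) (fun s => S t (clamp s) l th));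
      [apply continuous_const|]. apply polar_field_continuous, Ht.
  - exists (y, z). split; [exact Hy|]. split; [exact Hz|]. intros x Hx.
    destruct (H x) as [D1 D2]; [apply Hx|]. rewrite (clamp_id x Hx) in D1, D2. easy.
Qed.

Lemma flow_logr_bound t lam a x : 0 <= t <= 1 -> 0 <= lam -> J x ->
  Rabs (snd (flow S t lam a) x) <= 2 * (1 + lam * G).
Proof.
  intros Ht Hlam Hx. destruct (flow_spec t lam a Ht Hlam) as (_ & H0 & H).
  apply Rle_trans with ((1 + lam * G) * (x + 1)).
  - apply (derive_dominated_le (snd (flow S t lam a))
      (fun s => logr_speed S t lam s (fst (flow S t lam a) s) (snd (flow S t lam a) s))
      (fun s => (1 + lam * G) * (s + 1)) (fun _ => 1 + lam * G) (-1) x); [apply Hx| | | |].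
    + intros s Hs. apply H. unfold J in *; lra.
    + intros s _. auto_derive; [easy|ring].
    + intros s Hs. apply speed_bounds; auto. unfold J in *; lra.
    + rewrite H0, Rabs_R0. right. ring.
  - unfold J in Hx. pose proof G_pos. assert (0 <= lam * G) by nra. nra.
Qed.

Lemma flow_continuous Lam t0 lam0 a0 eps :
  0 <= t0 <= 1 -> 0 <= lam0 <= Lam -> 0 < eps ->
  exists d, 0 < d /\ forall t lam a, 0 <= t <= 1 -> 0 <= lam <= Lam ->
    Rabs (t - t0) < d -> Rabs (lam - lam0) < d -> Rabs (a - a0) < d ->
    forall x, J x ->
      Rabs (fst (flow S t lam a) x - fst (flow S t0 lam0 a0) x) < eps /\
      Rabs (snd (flow S t lam a) x - snd (flow S t0 lam0 a0) x) < eps.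
Proof.
  intros Ht0 Hlam0 He.
  set (K := 2 + Lam * (L + G)).
  assert (HK : 0 <= K).
  { pose proof (pf_L _ _ _ _ HS). pose proof G_pos. unfold K. nra. }
  set (E := exp (2 * (4 * K + 2))).
  assert (HE : 1 <= E).
  { unfold E. pose proof (exp_ineq1_le (2 * (4 * K + 2))). lra. }
  (* Starting data and fields within e of each other give a squared distance of
     at most 2 * e ^ 2 * E = eps ^ 2 / (2 * E). *)
  set (e := eps / (2 * E)).
  assert (Hep : 0 < e) by (apply Rdiv_lt_0_compat; lra).
  destruct (pf_t _ _ _ _ HS t0 (2 * (1 + lam0 * G)) (e / (2 * (Lam + 1))) Ht0)
    as (d1 & Hd1 & HSt); [apply Rdiv_lt_0_compat; lra|].
  pose proof G_pos.
  assert (Hd2 : 0 < e / (2 * (G + 1))) by (apply Rdiv_lt_0_compat; lra).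
  exists (Rmin e (Rmin d1 (e / (2 * (G + 1))))). split; [repeat apply Rmin_glb_lt; easy|].
  intros t lam a Ht Hlam Htt Hll Haa x Hx.
  set (dd := Rmin d1 (e / (2 * (G + 1)))) in *.
  assert (Rmin e dd <= e) by apply Rmin_l. assert (Rmin e dd <= dd) by apply Rmin_r.
  assert (dd <= d1) by apply Rmin_l. assert (dd <= e / (2 * (G + 1))) by apply Rmin_r.
  destruct (flow_spec t0 lam0 a0) as (I1 & I2 & I3); [easy|lra|].
  destruct (flow_spec t lam a) as (J1 & J2 & J3); [easy|lra|].
  assert (Hd : forall s, J s ->
     Rabs (lam0 * S t0 s (snd (flow S t0 lam0 a0) s) (fst (flow S t0 lam0 a0) s) -
       lam * S t s (snd (flow S t0 lam0 a0) s) (fst (flow S t0 lam0 a0) s)) <= e).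
  { intros s Hs.
    assert (Hb : Rabs (snd (flow S t0 lam0 a0) s) <= 2 * (1 + lam0 * G))
      by (apply flow_logr_bound; auto; lra).
    set (l := snd (flow S t0 lam0 a0) s) in *. set (th := fst (flow S t0 lam0 a0) s).
    pose proof (HSt t s l th Ht ltac:(lra) Hs Hb) as B1.
    rewrite Rabs_minus_sym in B1.
    pose proof (pf_bound _ _ _ _ HS t0 s l th Ht0 Hs) as B2.
    replace (lam0 * S t0 s l th - lam * S t s l th) with
      (lam * (S t0 s l th - S t s l th) + (lam0 - lam) * S t0 s l th) by ring.
    eapply Rle_trans; [apply Rabs_triang|]. rewrite !Rabs_mult, (Rabs_pos_eq lam) by lra.
    rewrite (Rabs_minus_sym lam0 lam).
    assert (T1 : lam * Rabs (S t0 s l th - S t s l th) <= e / 2).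
    { apply Rle_trans with ((Lam + 1) * (e / (2 * (Lam + 1)))); [|right; field; lra].
      apply Rmult_le_compat; try lra. apply Rabs_pos. }
    assert (T2 : Rabs (lam - lam0) * Rabs (S t0 s l th) <= e / 2).
    { apply Rle_trans with ((e / (2 * (G + 1))) * (G + 1)); [|right; field; lra].
      apply Rmult_le_compat; try lra; apply Rabs_pos. }
    lra. }
  pose proof (planar_dependence
    (fst (flow S t0 lam0 a0)) (snd (flow S t0 lam0 a0)) (fst (flow S t lam a)) (snd (flow S t lam a))
    (angle_speed S t0 lam0) (logr_speed S t0 lam0) (angle_speed S t lam) (logr_speed S t lam)
    K e HK (Rlt_le _ _ Hep) I3 J3) as P.
  specialize (P ltac:(intros; split;
    [apply angle_speed_lipschitz|apply logr_speed_lipschitz]; assumption)).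
  assert (Pq : forall c r, Rabs c <= 1 -> Rabs r <= e -> Rabs (r * c) <= e).
  { intros c r Hc Hr. rewrite Rabs_mult. pose proof (Rabs_pos c). pose proof (Rabs_pos r). nra. }
  specialize (P ltac:(intros s Hs; specialize (Hd s Hs); unfold angle_speed, logr_speed; split;
    [match goal with |- Rabs (?c ^ 2 + ?u * ?w - (_ + ?v * _)) <= _ =>
       replace (c ^ 2 + u * w - (c ^ 2 + v * w)) with ((u - v) * w) by ring end;
       apply Pq; [apply Rabs_sin_le|exact Hd]
    |match goal with |- Rabs (?c - ?u * ?w - (_ - ?v * _)) <= _ =>
       replace (c - u * w - (c - v * w)) with ((u - v) * (- w)) by ring end;
       apply Pq; [rewrite Rabs_Ropp; apply Rabs_cos_le|exact Hd]])).
  specialize (P x Hx). rewrite I1, I2, J1, J2 in P. fold E in P.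
  assert (Q : ((a0 - a) ^ 2 + (0 - 0) ^ 2 + e ^ 2) * E < eps ^ 2).
  { assert (Ha : (a0 - a) ^ 2 <= e ^ 2).
    { rewrite <- (pow2_abs (a0 - a)), Rabs_minus_sym. apply pow_incr.
      split; [apply Rabs_pos|lra]. }
    apply Rle_lt_trans with ((2 * e ^ 2) * E); [apply Rmult_le_compat_r; lra|].
    assert (E1 : eps = 2 * E * e) by (unfold e; field; lra).
    rewrite E1. assert (0 < e ^ 2) by nra. nra. }
  assert (Sq : forall p r, p ^ 2 + r ^ 2 < eps ^ 2 -> Rabs p < eps).
  { intros p r Hpr. apply Rnot_le_lt. intros Hle.
    assert (Hp : eps ^ 2 <= Rabs p ^ 2) by (apply pow_incr; lra).
    rewrite pow2_abs in Hp. pose proof (pow2_ge_0 r). lra. }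
  split; rewrite Rabs_minus_sym.
  - apply (Sq _ (snd (flow S t0 lam0 a0) x - snd (flow S t lam a) x)). lra.
  - apply (Sq _ (fst (flow S t0 lam0 a0) x - fst (flow S t lam a) x)). lra.
Qed.
End Flow.

(** * Derivatives relative to J and the boundary conditions *)

Lemma is_derive_D_in (f : R -> R) (x l : R) (D : R -> Prop) :
  is_derive f x l -> D_in f (fun _ => l) D x.
Proof.
  intros H. apply is_derive_Reals in H. intros eps He.
  destruct (H eps He) as [d Hd]. exists d. split; [apply cond_pos|].
  intros y [[_ Hne] Hy]. simpl in *. unfold Rdist in *.
  specialize (Hd (y - x)). replace (x + (y - x)) with y in Hd by ring.
  apply Hd; [lra|easy].
Qed.

Lemma J_limit_point (x d : R) : J x -> 0 < d -> exists y, J y /\ y <> x /\ Rabs (y - x) < d.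
Proof.
  intros Hx Hd. unfold J in *.
  set (e := Rmin (d / 2) (1 / 2)).
  assert (He : 0 < e) by (apply Rmin_glb_lt; lra).
  assert (e <= d / 2) by apply Rmin_l. assert (e <= 1 / 2) by apply Rmin_r.
  destruct (Rle_dec x 0).
  - exists (x + e). replace (x + e - x) with e by ring. rewrite Rabs_pos_eq; lra.
  - exists (x - e). replace (x - e - x) with (- e) by ring. rewrite Rabs_Ropp, Rabs_pos_eq; lra.
Qed.

Lemma D_in_unique (f : R -> R) (x l l' : R) : J x ->
  D_in f (fun _ => l) J x -> D_in f (fun _ => l') J x -> l = l'.
Proof.
  intros Hx H H'. apply Rminus_diag_uniq, Rabs_eq_0, Rle_antisym; [|apply Rabs_pos].
  apply le_epsilon. intros eps He. rewrite Rplus_0_l.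
  destruct (H (eps / 2)) as (d & Hd & K); [lra|].
  destruct (H' (eps / 2)) as (d' & Hd' & K'); [lra|].
  destruct (J_limit_point x (Rmin d d') Hx) as (y & Jy & Hne & Hy).
  { apply Rmin_glb_lt; easy. }
  pose proof (Rmin_l d d'). pose proof (Rmin_r d d').
  specialize (K y). specialize (K' y). simpl in K, K'. unfold Rdist, D_x in K, K'.
  specialize (K ltac:(split; [split; [exact Jy|congruence]|lra])).
  specialize (K' ltac:(split; [split; [exact Jy|congruence]|lra])).
  set (q := (f y - f x) / (y - x)) in *.
  replace (l - l') with ((q - l') - (q - l)) by ring.
  eapply Rle_trans; [apply Rabs_triang|]. rewrite Rabs_Ropp. lra.
Qed.

Lemma deriv_eq (f : R -> R) (x l : R) : J x -> D_in f (fun _ => l) J x -> deriv f x = l.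
Proof.
  intros Hx H. unfold deriv. apply (iota_unique (V := R_CompleteNormedModule)); [|exact H].
  intros y Hy. exact (D_in_unique f x y l Hx Hy H).
Qed.

Lemma derivable_at_D_in (f : R -> R) (x : R) : J x -> derivable_at f x ->
  D_in f (fun _ => deriv f x) J x.
Proof.
  intros Hx [l Hl]. rewrite (deriv_eq f x l Hx Hl). exact Hl.
Qed.

Lemma D_in_ext (f g : R -> R) (x l : R) : J x -> eq_on_J f g ->
  D_in f (fun _ => l) J x -> D_in g (fun _ => l) J x.
Proof.
  intros Hx E H eps He. destruct (H eps He) as (d & Hd & K).
  exists d. split; [easy|]. intros y Hy. rewrite <- !E; [apply K, Hy|exact Hx|apply Hy].
Qed.

Lemma derivable_continuous_J (f : R -> R) (x : R) : J x -> derivable_at f x ->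
  forall eps, 0 < eps -> exists d, 0 < d /\
    forall y, J y -> Rabs (y - x) < d -> Rabs (f y - f x) < eps.
Proof.
  intros Hx [l Hl] eps He.
  destruct (cont_deriv f (fun _ => l) J x Hl eps He) as (d & Hd & K).
  exists d. split; [easy|]. intros y Jy Hy.
  destruct (Req_dec x y) as [<-|Hne]; [rewrite Rminus_diag, Rabs_R0; easy|].
  apply (K y). split; [split; [exact Jy|exact Hne]|exact Hy].
Qed.
Lemma D_in_lin (f g : R -> R) (x l m a b : R) :
  D_in f (fun _ => l) J x -> D_in g (fun _ => m) J x ->
  D_in (fun s => a * f s + b * g s) (fun _ => a * l + b * m) J x.
Proof.
  intros Hf Hg.
  apply (Dadd J (fun _ => a * l) (fun _ => b * m) (fun s => a * f s) (fun s => b * g s) x).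
  - apply (Dmult_const J f (fun _ => l) x a Hf).
  - apply (Dmult_const J g (fun _ => m) x b Hg).
Qed.

Lemma continuous_on_J_of_continuous (f h : R -> R) :
  eq_on_J f h -> (forall x, J x -> continuous h x) -> C0_J f.
Proof.
  intros E H x Hx. rewrite (E x Hx).
  apply filterlim_within_ext with (f := h).
  - intros y Hy. symmetry. apply E, Hy.
  - apply filterlim_filter_le_1 with (2 := H x Hx). apply filter_le_within.
Qed.

Lemma C2_lin (u v : R -> R) (a b : R) : C2_J u -> C2_J v ->
  C2_J (fun s => a * u s + b * v s) /\
  (forall x, J x -> deriv (fun s => a * u s + b * v s) x = a * deriv u x + b * deriv v x) /\
  (forall x, J x -> Delta (fun s => a * u s + b * v s) x = a * Delta u x + b * Delta v x).
Proof.
  intros (Hu1 & Hu2 & Hu3) (Hv1 & Hv2 & Hv3).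
  assert (D1 : forall x, J x -> D_in (fun s => a * u s + b * v s)
     (fun _ => a * deriv u x + b * deriv v x) J x).
  { intros x Hx. apply D_in_lin; apply derivable_at_D_in; auto. }
  assert (E1 : forall x, J x -> deriv (fun s => a * u s + b * v s) x = a * deriv u x + b * deriv v x).
  { intros x Hx. apply deriv_eq; auto. }
  assert (D2 : forall x, J x -> D_in (deriv (fun s => a * u s + b * v s))
     (fun _ => a * Delta u x + b * Delta v x) J x).
  { intros x Hx. apply (D_in_ext (fun s => a * deriv u s + b * deriv v s)); [easy| |].
    - intros y Hy. symmetry. auto.
    - apply D_in_lin; apply derivable_at_D_in; auto. }
  assert (E2 : forall x, J x -> Delta (fun s => a * u s + b * v s) x = a * Delta u x + b * Delta v x).
  { intros x Hx. apply deriv_eq; auto. }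
  split; [|split; assumption]. split; [|split].
  - intros x Hx. eexists. apply D1, Hx.
  - intros x Hx. eexists. apply D2, Hx.
  - intros x Hx. unfold Delta in E2. rewrite (E2 x Hx).
    apply filterlim_within_ext with (f := fun s => a * Delta u s + b * Delta v s).
    + intros y Hy. symmetry. apply E2, Hy.
    + apply (filterlim_comp_2 (G := locally (a * Delta u x)) (H := locally (b * Delta v x))).
      * apply (filterlim_comp _ _ _ (Delta u) (fun s => a * s) _ (locally (Delta u x))); [apply Hu3, Hx|].
        apply (filterlim_scal_r (K := R_AbsRing) (V := R_NormedModule) a (Delta u x)).
      * apply (filterlim_comp _ _ _ (Delta v) (fun s => b * s) _ (locally (Delta v x))); [apply Hv3, Hx|].
        apply (filterlim_scal_r (K := R_AbsRing) (V := R_NormedModule) b (Delta v x)).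
      * apply (filterlim_plus (K := R_AbsRing) (V := R_NormedModule) (a * Delta u x) (b * Delta v x)).
Qed.

(** Composition with [clamp] gives a continuous function on the line, to which
    the mean value theorem applies. *)
Lemma deriv_zero_constant (u : R -> R) :
  (forall x, J x -> D_in u (fun _ => 0) J x) -> forall x, J x -> u x = u (-1).
Proof.
  intros H.
  assert (Hc : forall x, continuous (fun s => u (clamp s)) x).
  { intros x. apply continuous_eps. intros eps He.
    destruct (derivable_continuous_J u (clamp x) (clamp_in x)) with (eps := eps)
      as (d & Hd & K); [eexists; apply H, clamp_in|easy|].
    exists d. split; [easy|]. intros y Hy. apply K; [apply clamp_in|].
    eapply Rle_lt_trans; [apply clamp_lipschitz|exact Hy]. }
  intros x Hx.
  destruct (MVT_gen (fun s => u (clamp s)) (-1) x (fun _ => 0)) as (c & _ & E).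
  - unfold J in Hx. rewrite Rmin_left, Rmax_right by lra. intros s Hs.
    apply is_derive_Reals. intros eps He.
    destruct (H s ltac:(unfold J; lra) eps He) as (d & Hd & K).
    assert (Hd2 : 0 < Rmin d (Rmin (s + 1) (1 - s))) by (repeat apply Rmin_glb_lt; lra).
    exists (mkposreal _ Hd2). intros h Hh0 Hh. simpl in Hh.
    set (r := Rmin (s + 1) (1 - s)) in *.
    assert (Rmin d r <= d) by apply Rmin_l. assert (Rmin d r <= r) by apply Rmin_r.
    assert (r <= s + 1) by apply Rmin_l. assert (r <= 1 - s) by apply Rmin_r.
    apply Rabs_def2 in Hh as Hh'.
    rewrite !clamp_id by (unfold J; lra).
    specialize (K (s + h)). simpl in K. unfold Rdist, D_x, J in K.
    replace (s + h - s) with h in K by ring. apply K. repeat split; lra.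
  - intros s _. apply continuity_pt_filterlim, Hc.
  - rewrite !clamp_id in E by (unfold J in *; lra). lra.
Qed.

Lemma Delta_zero_affine (u : R -> R) : C2_J u -> (forall x, J x -> Delta u x = 0) ->
  exists A B, forall x, J x -> u x = A + B * x.
Proof.
  intros (H1 & H2 & _) H0.
  assert (E1 : forall x, J x -> deriv u x = deriv u (-1)).
  { apply deriv_zero_constant. intros x Hx. rewrite <- (H0 x Hx).
    apply derivable_at_D_in; auto. }
  exists (u (-1) + deriv u (-1)), (deriv u (-1)). intros x Hx.
  assert (E2 : 1 * u x + (- deriv u (-1)) * x = 1 * u (-1) + (- deriv u (-1)) * (-1)).
  { apply (deriv_zero_constant (fun s => 1 * u s + (- deriv u (-1)) * s)); [|exact Hx].
    intros s Hs. replace 0 with (1 * deriv u (-1) + (- deriv u (-1)) * 1) by ring.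
    apply (D_in_lin u (fun s => s)).
    - rewrite <- (E1 s Hs). apply derivable_at_D_in; auto.
    - apply is_derive_D_in. auto_derive; easy. }
  lra.
Qed.

Lemma sum_abs_bound (n : nat) (a v : nat -> R) (M : R) : 
  (forall i, (1 <= i <= n)%nat -> Rabs (v i) <= M) ->
  Rabs (sum_n_m (fun i => a i * v i) 1 n) <= norm1 n a * M.
Proof.
  intros H. unfold norm1. induction n as [|n IH].
  - rewrite !sum_n_m_zero by lia. change (@zero R_AbelianMonoid) with 0. rewrite Rabs_R0. lra.
  - rewrite !sum_n_Sm by lia. unfold plus; simpl.
    eapply Rle_trans; [apply Rabs_triang|]. rewrite Rabs_mult.
    pose proof (IH ltac:(intros; apply H; lia)). pose proof (H (S n) ltac:(lia)).
    pose proof (Rabs_pos (a (S n))). nra.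
Qed.

(** The maximum of the modulus of an affine function over [J] is attained at an
    end point, where the nonlocal condition makes it smaller than itself. *)
Lemma spaceX_Delta_zero m eta al u : valid_points m eta -> calA m 1 al ->
  spaceX m eta al u -> (forall x, J x -> Delta u x = 0) -> forall x, J x -> u x = 0.
Proof.
  intros Hv HA [HC HB] H0.
  destruct (Delta_zero_affine u HC H0) as (A & B & E).
  set (M := Rmax (Rabs (u (-1))) (Rabs (u 1))).
  assert (HM : forall x, J x -> Rabs (u x) <= M).
  { intros x Hx. assert (J1 : J 1) by (unfold J; lra). assert (J2 : J (-1)) by (unfold J; lra).
    pose proof (Rmax_l (Rabs (u (-1))) (Rabs (u 1))) as M1.
    pose proof (Rmax_r (Rabs (u (-1))) (Rabs (u 1))) as M2. fold M in M1, M2.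
    apply Rabs_le_between in M1, M2. apply Rabs_le_between.
    rewrite (E _ J1) in M2. rewrite (E _ J2) in M1. rewrite (E x Hx). unfold J in Hx.
    split; nra. }
  assert (HM0 : 0 <= M) by (eapply Rle_trans; [apply Rabs_pos|apply (HM 0); unfold J; lra]).
  assert (Hs : forall s, Rabs (u (sgn s)) <= norm1 (m s) (al s) * M).
  { intros s. rewrite (HB s).
    apply (sum_abs_bound (m s) (al s) (fun i => u (eta s i))).
    intros i Hi. apply HM. apply Hv, Hi. }
  assert (M = 0).
  { pose proof (Hs Plus) as P. pose proof (Hs Minus) as Q. simpl in P, Q.
    pose proof (HA Plus). pose proof (HA Minus).
    assert (Hmx : M = Rabs (u (-1)) \/ M = Rabs (u 1))
      by (unfold M, Rmax; destruct Rle_dec; auto).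
    replace (IZR (-1)) with (-1) in * by easy.
    destruct Hmx as [Hm|Hm]; rewrite <- Hm in *; nra. }
  intros x Hx. specialize (HM x Hx). pose proof (Rabs_pos (u x)). apply Rabs_eq_0. lra.
Qed.

Lemma spaceX_lin m eta al u v a b : spaceX m eta al u -> spaceX m eta al v ->
  spaceX m eta al (fun s => a * u s + b * v s).
Proof.
  intros [Hu Bu] [Hv Bv]. split; [apply C2_lin; assumption|].
  intros s. rewrite Bu, Bv.
  rewrite <- !(sum_n_m_mult_l (K := R_Ring)). rewrite <- (sum_n_m_plus (G := R_AbelianMonoid)).
  apply sum_n_m_ext. intros i. unfold mult, plus; simpl. ring.
Qed.

(** * Eigenfunctions of the linear problems *)

Lemma calA_le m c c' al : c <= c' -> calA m c al -> calA m c' al.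
Proof. intros H K nu. specialize (K nu). lra. Qed.

(** By uniqueness in [spaceX_Delta_zero], the inverse of [Delta] maps [r * u] to
    [- u / lam], so that already the first power of the operator kills [u]. *)
Lemma eigenfunction_generalized_null m eta al r lam u :
  valid_points m eta -> calA m 1 al -> lam <> 0 ->
  eigenfunction m eta al r lam u -> generalized_null_space m eta al r lam u.
Proof.
  intros Hv HA Hl (HX & _ & Hu). destruct HX as [HC HB].
  split.
  { intros x Hx. apply filterlim_locally. intros eps.
    destruct (derivable_continuous_J u x Hx (proj1 HC x Hx) eps (cond_pos eps))
      as (d & Hd & K).
    exists (mkposreal d Hd). intros y Hy Jy. exact (K y Jy Hy). }
  exists 1%nat. split; [lia|]. intros x Hx. simpl. unfold opK.
  set (h := fun y => r y * u y).
  assert (Hspec : spaceX m eta al (Delta_inv m eta al h) /\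
     eq_on_J (Delta (Delta_inv m eta al h)) h).
  { unfold Delta_inv. apply epsilon_spec.
    exists (fun s => - / lam * u s + 0 * u s). split.
    - apply spaceX_lin; split; assumption.
    - intros y Hy. destruct (C2_lin u u (- / lam) 0 HC HC) as (_ & _ & E).
      rewrite (E y Hy). specialize (Hu y Hy). unfold h.
      replace (Delta u y) with (- (lam * r y * u y)) by lra. field. easy. }
  destruct Hspec as [HX1 HX2].
  assert (Hz : 1 * Delta_inv m eta al h x + / lam * u x = 0).
  { apply (spaceX_Delta_zero m eta al (fun s => 1 * Delta_inv m eta al h s + / lam * u s)); try easy.
    - apply spaceX_lin; [easy|split; easy].
    - intros y Hy. destruct (C2_lin _ u 1 (/ lam) (proj1 HX1) HC) as (_ & _ & E).
      rewrite (E y Hy), (HX2 y Hy). specialize (Hu y Hy). unfold h.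
      replace (Delta u y) with (- (lam * r y * u y)) by lra. field. easy. }
  replace (Delta_inv m eta al h x) with (- (/ lam * u x)) by lra. field. easy.
Qed.

(** The [k]-th element of a set is determined by the set, so every
    enumeration of the eigenvalues is the one with known nodal properties. *)
Lemma increasing_enumeration_unique (a b : nat -> R) :
  (forall k, (1 <= k)%nat -> a k < a (S k)) -> (forall k, (1 <= k)%nat -> b k < b (S k)) ->
  (forall l, (exists k, (1 <= k)%nat /\ l = a k) <-> (exists k, (1 <= k)%nat /\ l = b k)) ->
  forall k, (1 <= k)%nat -> a k = b k.
Proof.
  intros Ha Hb E.
  assert (mono : forall c : nat -> R, (forall k, (1 <= k)%nat -> c k < c (S k)) ->
     forall i j, (1 <= i)%nat -> (i <= j)%nat -> c i <= c j).
  { intros c Hc i j Hi Hij. induction Hij as [|j Hij IH]; [lra|].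
    specialize (Hc j ltac:(lia)). lra. }
  assert (index : forall c : nat -> R, (forall k, (1 <= k)%nat -> c k < c (S k)) ->
     forall i j, (1 <= i)%nat -> (1 <= j)%nat -> c i < c j -> (i < j)%nat).
  { intros c Hc i j Hi Hj H. destruct (Nat.lt_ge_cases i j) as [|Hle]; [easy|].
    pose proof (mono c Hc j i Hj Hle). lra. }
  assert (le : forall c d : nat -> R, (forall k, (1 <= k)%nat -> c k < c (S k)) ->
    (forall k, (1 <= k)%nat -> d k < d (S k)) ->
    (forall k, (1 <= k)%nat -> exists j, (1 <= j)%nat /\ d k = c j) ->
    forall k, (1 <= k)%nat -> c k <= d k).
  { intros c d Hc Hd Hin k Hk.
    assert (H : exists j, (k <= j)%nat /\ d k = c j).
    { induction Hk as [|k Hk IH].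
      - destruct (Hin 1%nat (le_n _)) as (j & Hj & Ej). exists j. easy.
      - destruct IH as (j & Hj & Ej). destruct (Hin (S k) ltac:(lia)) as (i & Hi & Ei).
        exists i. split; [|easy].
        assert (j < i)%nat; [|lia]. apply (index c Hc); try lia.
        rewrite <- Ej, <- Ei. apply Hd; lia. }
    destruct H as (j & Hj & ->). apply mono; easy. }
  intros k Hk. apply Rle_antisym.
  - apply (le a b Ha Hb); [|easy]. intros j Hj. apply (E (b j)). exists j; easy.
  - apply (le b a Hb Ha); [|easy]. intros j Hj. apply (E (a j)). exists j; easy.
Qed.

Lemma nodalT_zero_count m eta al j k nu nu' u v :
  nodalT m eta al j nu u -> nodalT m eta al k nu' v ->
  (forall x, J x -> deriv u x = 0 <-> deriv v x = 0) -> j = k.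
Proof.
  intros (_ & _ & _ & _ & _ & (zs & N1 & L1 & Z1) & _) (_ & _ & _ & _ & _ & (ws & N2 & L2 & Z2) & _) E.
  assert (I : forall x, In x zs <-> In x ws).
  { intros x. rewrite Z1, Z2. split; intros [H1 H2]; (split; [easy|]);
      apply E; unfold J; try lra; easy. }
  rewrite <- L1, <- L2. apply Nat.le_antisymm; apply NoDup_incl_length; try easy;
    intros x Hx; apply I, Hx.
Qed.

(** Simplicity makes every eigenfunction a multiple of the one whose nodal
    properties are known. *)
Lemma eigenfunction_nodal m eta al r c lam u :
  valid_points m eta -> spectral_constant m eta r c -> calA m c al ->
  eigenfunction m eta al r lam u ->
  exists j, (1 <= j)%nat /\ deriv u (-1) <> 0 /\ deriv u 1 <> 0 /\
    (forall k nu, nodalT m eta al k nu u -> k = j) /\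
    (forall mu, eigenvalue_sequence m eta al r mu -> lam = mu j).
Proof.
  intros Hv [Hc HS] HA Hu.
  destruct (HS al HA) as (mu & (Hinc & Hev) & Hk & _).
  destruct (proj1 (Hev lam)) as (j & Hj & El); [exists u; exact Hu|].
  destruct (Hk j Hj) as ((_ & phi & _ & _ & Hspan) & Hpos & v & Hv1 & Hv2).
  rewrite <- El in *.
  assert (HA1 : calA m 1 al) by (apply (calA_le m c 1); [lra|easy]).
  destruct (Hspan u) as [cu Eu]; [apply eigenfunction_generalized_null; try easy; lra|].
  destruct (Hspan v) as [cv Ev]; [apply eigenfunction_generalized_null; try easy; lra|].
  destruct Hu as (HXu & (xu & Jxu & Hnu) & _). destruct Hv2 as (HXv & (xv & Jxv & Hnv) & _).
  assert (Hcu : cu <> 0) by (intros ->; apply Hnu; rewrite (Eu xu Jxu); ring).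
  assert (Hcv : cv <> 0) by (intros ->; apply Hnv; rewrite (Ev xv Jxv); ring).
  set (d := cu / cv).
  assert (Hd : d <> 0) by (apply Rmult_integral_contrapositive_currified; [easy|now apply Rinv_neq_0_compat]).
  assert (E : eq_on_J (fun s => d * v s + 0 * v s) u).
  { intros x Hx. rewrite (Eu x Hx), (Ev x Hx). unfold d. field. easy. }
  assert (Ed : forall x, J x -> deriv u x = d * deriv v x).
  { intros x Hx. apply deriv_eq; [easy|].
    replace (d * deriv v x) with (d * deriv v x + 0 * deriv v x) by ring.
    apply (D_in_ext _ _ _ _ Hx E), D_in_lin; (apply derivable_at_D_in; [easy|]);
      apply (proj1 (proj1 HXv)), Hx. }
  assert (Hz : forall x, J x -> deriv u x = 0 <-> deriv v x = 0).
  { intros x Hx. rewrite (Ed x Hx). split; [|intros ->; ring].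
    intros H. apply Rmult_integral in H. tauto. }
  exists j. split; [easy|].
  pose proof Hv1 as (_ & Hv3 & Hv4 & _).
  repeat split.
  - rewrite Hz; [easy|unfold J; lra].
  - rewrite Hz; [easy|unfold J; lra].
  - intros k nu Hk'. apply (nodalT_zero_count _ _ _ _ _ _ _ _ _ Hk' Hv1 Hz).
  - intros mu' [Hinc' Hev']. rewrite El.
    apply (increasing_enumeration_unique mu mu' Hinc Hinc'); [|easy].
    intros l. rewrite <- Hev, <- Hev'. reflexivity.
Qed.

(** * Nodal properties read off the angle *)

Definition flow_fun (S : R -> R -> R -> R -> R) (t lam a x : R) : R :=
  exp (snd (flow S t lam a) x) * sin (fst (flow S t lam a) x).

Definition flow_slope (S : R -> R -> R -> R -> R) (t lam a x : R) : R :=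
  exp (snd (flow S t lam a) x) * cos (fst (flow S t lam a) x).

Section FlowSolution.
Variables (S : R -> R -> R -> R -> R) (G L gm : R).
Hypothesis HS : polar_field S G L gm.
Variables (t lam a : R).
Hypothesis Ht : 0 <= t <= 1.
Hypothesis Hlam : 0 <= lam.

Let phi := fst (flow S t lam a).
Let ell := snd (flow S t lam a).
Let force (x : R) : R := S t x (ell x) (phi x).

Let Hflow : is_flow S t lam a (flow S t lam a).
Proof. exact (flow_spec S G L gm HS t lam a Ht Hlam). Qed.

Lemma angle_derive x : J x -> is_derive phi x (cos (phi x) ^ 2 + lam * force x * sin (phi x)).
Proof. intros Hx. apply Hflow, Hx. Qed.

Lemma flow_fun_derive x : J x -> is_derive (flow_fun S t lam a) x (flow_slope S t lam a x).
Proof.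
  intros Hx. destruct Hflow as (_ & _ & H). destruct (H x Hx) as [D1 D2].
  unfold flow_fun, flow_slope. fold phi ell in D1, D2 |- *.
  auto_derive.
  - split; [eexists; exact D2|]. split; [eexists; exact D1|easy].
  - rewrite (is_derive_unique (fun x : R => phi x) _ _ D1), (is_derive_unique (fun x : R => ell x) _ _ D2).
    unfold angle_speed, logr_speed. pose proof (sin2_cos2 (phi x)) as E. unfold Rsqr in E.
    set (s := sin (phi x)) in *. set (c := cos (phi x)) in *.
    replace (exp (ell x) * c) with (exp (ell x) * c * (s * s + c * c)) by (rewrite E; ring). ring.
Qed.

Lemma flow_slope_derive x : J x ->
  is_derive (flow_slope S t lam a) x (- (lam * (exp (ell x) * force x))).
Proof.
  intros Hx. destruct Hflow as (_ & _ & H). destruct (H x Hx) as [D1 D2].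
  unfold force. unfold flow_slope. fold phi ell in D1, D2 |- *.
  auto_derive.
  - split; [eexists; exact D2|]. split; [eexists; exact D1|easy].
  - rewrite (is_derive_unique (fun x : R => phi x) _ _ D1), (is_derive_unique (fun x : R => ell x) _ _ D2).
    unfold angle_speed, logr_speed. pose proof (sin2_cos2 (phi x)) as E. unfold Rsqr in E.
    set (s := sin (phi x)) in *. set (c := cos (phi x)) in *.
    replace (- (lam * (exp (ell x) * S t x (ell x) (phi x)))) with
      (- (lam * (exp (ell x) * S t x (ell x) (phi x))) * (s * s + c * c)) by (rewrite E; ring). ring.
Qed.

Lemma phi_continuous x : J x -> continuous phi x.
Proof. intros Hx. apply (ex_derive_continuous (V := R_NormedModule)). eexists. apply angle_derive, Hx. Qed.

Lemma ell_continuous x : J x -> continuous ell x.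
Proof.
  intros Hx. apply (ex_derive_continuous (V := R_NormedModule)). eexists.
  apply Hflow, Hx.
Qed.

Lemma comp_clamp_continuous (f : R -> R) :
  (forall x, J x -> continuous f x) -> forall x, continuous (fun s => f (clamp s)) x.
Proof.
  intros Hf x. apply (continuous_comp clamp f).
  - apply (lipschitz_continuous clamp 1). intros y z. rewrite Rmult_1_l. apply clamp_lipschitz.
  - apply Hf, clamp_in.
Qed.

Variable c : R.

Lemma scaled_flow_deriv x : J x ->
  deriv (fun s => c * flow_fun S t lam a s) x = c * flow_slope S t lam a x.
Proof.
  intros Hx. apply deriv_eq; [easy|]. apply is_derive_D_in.
  apply (is_derive_scal (flow_fun S t lam a) x c), flow_fun_derive, Hx.
Qed.

Lemma scaled_flow_second x : J x ->
  D_in (deriv (fun s => c * flow_fun S t lam a s))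
    (fun _ => c * - (lam * (exp (ell x) * force x))) J x.
Proof.
  intros Hx. apply (D_in_ext (fun s => c * flow_slope S t lam a s)); [easy| |].
  - intros y Hy. symmetry. apply scaled_flow_deriv, Hy.
  - apply is_derive_D_in.
    apply (is_derive_scal (flow_slope S t lam a) x c), flow_slope_derive, Hx.
Qed.

Lemma scaled_flow_Delta x : J x ->
  Delta (fun s => c * flow_fun S t lam a s) x = - (lam * (c * (exp (ell x) * force x))).
Proof.
  intros Hx. unfold Delta. rewrite (deriv_eq _ x _ Hx (scaled_flow_second x Hx)). ring.
Qed.

Lemma scaled_flow_C2 : C2_J (fun s => c * flow_fun S t lam a s).
Proof.
  split; [|split].
  - intros x Hx. eexists. apply is_derive_D_in.
    apply (is_derive_scal (flow_fun S t lam a) x c), flow_fun_derive, Hx.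
  - intros x Hx. eexists. apply scaled_flow_second, Hx.
  - apply (continuous_on_J_of_continuous _
      (fun s => - (lam * (c * (exp (ell (clamp s)) * S t (clamp s) (ell (clamp s)) (phi (clamp s))))))).
    + intros x Hx. rewrite (clamp_id x Hx). apply (scaled_flow_Delta x Hx).
    + intros x _.
      assert (Ce : continuous (fun s => exp (ell (clamp s))) x).
      { apply (continuous_comp (fun s => ell (clamp s)) exp).
        - apply (comp_clamp_continuous ell), ell_continuous.
        - apply (ex_derive_continuous (V := R_NormedModule)). auto_derive. easy. }
      assert (Cs : continuous (fun s => S t (clamp s) (ell (clamp s)) (phi (clamp s))) x).
      { apply (field_continuous_along L (pf_L _ _ _ _ HS) (fun s l th => S t (clamp s) l th)
          (fun s => ell (clamp s)) (fun s => phi (clamp s))).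
        - intros. apply (pf_lip _ _ _ _ HS); [easy|apply clamp_in].
        - intros. apply (polar_field_continuous S G L gm HS t a0 b x0 Ht).
        - apply (comp_clamp_continuous ell), ell_continuous.
        - apply (comp_clamp_continuous phi), phi_continuous. }
      apply (continuous_opp (V := R_NormedModule)
        (fun s => lam * (c * (exp (ell (clamp s)) * S t (clamp s) (ell (clamp s)) (phi (clamp s)))))).
      apply (continuous_mult (K := R_AbsRing) (fun _ => lam)); [apply continuous_const|].
      apply (continuous_mult (K := R_AbsRing) (fun _ => c)); [apply continuous_const|].
      apply (continuous_mult (K := R_AbsRing) (fun s => exp (ell (clamp s)))); assumption.
Qed.

Lemma angle_monotone x y : J x -> J y -> x <= y -> phi x <= phi y.
Proof.
  intros Hx Hy Hxy.
  apply (derive_nonneg_le phi (fun s => cos (phi s) ^ 2 + lam * force s * sin (phi s)) x y Hxy).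
  - intros s Hs. apply angle_derive. unfold J in *; lra.
  - intros s Hs. assert (Js : J s) by (unfold J in *; lra).
    pose proof (pf_coercive _ _ _ _ HS t s (ell s) (phi s) Ht Js) as C.
    pose proof (pf_gm _ _ _ _ HS). pose proof (pow2_ge_0 (cos (phi s))).
    pose proof (pow2_ge_0 (sin (phi s))). fold (force s) in C. 
    assert (0 <= force s * sin (phi s)) by nra. nra.
Qed.

Lemma angle_strict x y : 0 < lam -> J x -> J y -> x < y -> phi x < phi y.
Proof.
  intros Hl Hx Hy Hxy.
  destruct (angle_monotone x y Hx Hy (Rlt_le _ _ Hxy)) as [H|H]; [easy|exfalso].
  (* A constant angle on an interval contradicts its positive speed. *)
  set (mid := (x + y) / 2).
  assert (Jm : J mid) by (unfold mid, J in *; lra).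
  assert (D0 : is_derive phi mid 0).
  { apply (is_derive_ext_loc (fun _ => phi x)); [|exact (is_derive_const (phi x) mid)].
    assert (He : 0 < (y - x) / 2) by lra.
    exists (mkposreal _ He). intros s Hs. change (Rabs (s - mid) < (y - x) / 2) in Hs.
    apply Rabs_def2 in Hs. unfold mid in Hs.
    apply Rle_antisym; [|rewrite H]; apply angle_monotone; try lra; try easy;
      unfold J in *; lra. }
  pose proof (is_derive_unique _ _ _ D0) as E.
  rewrite (is_derive_unique _ _ _ (angle_derive mid Jm)) in E.
  pose proof (pf_coercive _ _ _ _ HS t mid (ell mid) (phi mid) Ht Jm) as C.
  fold (force mid) in C. pose proof (pf_gm _ _ _ _ HS).
  pose proof (sin2_cos2 (phi mid)) as E2. unfold Rsqr in E2.
  set (s := sin (phi mid)) in *. set (k := cos (phi mid)) in *.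
  assert (0 < lam * gm) by nra.
  assert (lam * (gm * s ^ 2) <= lam * (force mid * s)) by (apply Rmult_le_compat_l; lra).
  assert (0 <= k ^ 2) by apply pow2_ge_0. assert (0 <= s ^ 2) by apply pow2_ge_0.
  assert (0 <= lam * gm * s ^ 2) by nra.
  assert (k ^ 2 = 0) by nra. assert (lam * gm * s ^ 2 = 0) by nra.
  assert (s ^ 2 = 1) by nra. nra.
Qed.

Lemma angle_takes_value v x y : J x -> J y -> x < y -> phi x < v < phi y ->
  exists s, x < s < y /\ phi s = v.
Proof.
  intros Hx Hy Hxy Hv.
  destruct (IVT_gen (fun s => phi (clamp s)) x y v) as (s & Hs & E).
  - intros s. apply continuity_pt_filterlim.
    apply (comp_clamp_continuous phi), phi_continuous.
  - rewrite !clamp_id by easy. rewrite Rmin_left, Rmax_right by lra. lra.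
  - rewrite Rmin_left, Rmax_right in Hs by lra.
    rewrite clamp_id in E by (unfold J in *; lra).
    exists s. split; [|easy].
    assert (s <> x) by (intros ->; lra). assert (s <> y) by (intros ->; lra). lra.
Qed.

Lemma angle_start : phi (-1) = a.
Proof. apply Hflow. Qed.

(** The angle increases strictly, [u'] vanishes where it is an odd multiple of
    [PI / 2] and [u] where it is a multiple of [PI]: both zero sets, and their
    interlacing, are determined by the values of the angle at the end points. *)
Lemma nodalT_of_angle m eta al k nu : 0 < lam -> 0 < sgn nu * c ->
  - (PI / 2) < a < PI / 2 -> Rabs (phi 1 - INR k * PI) < PI / 2 ->
  spaceX m eta al (fun s => c * flow_fun S t lam a s) ->
  nodalT m eta al k nu (fun s => c * flow_fun S t lam a s).
Proof.
  intros Hl Hc Ha Hk HX. apply Rabs_def2 in Hk.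
  pose proof PI_RGT_0 as HPI.
  assert (Jm : J (-1)) by (unfold J; lra). assert (J1 : J 1) by (unfold J; lra).
  pose proof angle_start as E0.
  assert (Hc0 : c <> 0) by (intros ->; rewrite Rmult_0_r in Hc; lra).
  assert (Hex : forall x, exp (ell x) <> 0) by (intros; apply Rgt_not_eq, exp_pos).
  assert (Hzero : forall x, J x ->
     deriv (fun s => c * flow_fun S t lam a s) x = 0 <-> cos (phi x) = 0).
  { intros x Hx. rewrite (scaled_flow_deriv x Hx). unfold flow_slope. fold phi ell.
    split; [|intros ->; ring]. intros H.
    apply Rmult_integral in H. destruct H as [H|H]; [easy|].
    apply Rmult_integral in H. destruct H as [H|H]; [|easy]. now apply Hex in H. }
  assert (Hrange : forall x, -1 < x < 1 -> - (PI / 2) < phi x < INR k * PI + PI / 2).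
  { intros x Hx. assert (Jx : J x) by (unfold J; lra).
    pose proof (angle_strict (-1) x Hl Jm Jx ltac:(lra)).
    pose proof (angle_strict x 1 Hl Jx J1 ltac:(lra)). lra. }
  assert (Hcos : forall x, -1 < x < 1 ->
     (cos (phi x) = 0 <-> exists i, (i < k)%nat /\ phi x = INR i * PI + PI / 2)).
  { intros x Hx. specialize (Hrange x Hx). split.
    - intros H. destruct (cos_eq_0_0 _ H) as [z Hz].
      assert (z0 : (0 <= z)%Z).
      { apply le_IZR. apply Rnot_lt_le. intros Hn.
        assert (IZR z <= -1) by (apply IZR_le; apply lt_IZR in Hn; lia). nra. }
      assert (z1 : (z < Z.of_nat k)%Z).
      { apply lt_IZR. rewrite <- INR_IZR_INZ. nra. }
      exists (Z.to_nat z). split; [lia|].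
      rewrite Hz. rewrite INR_IZR_INZ, Z2Nat.id by easy. easy.
    - intros (i & _ & ->). rewrite Rplus_comm. apply cos_eq_0_1.
      exists (Z.of_nat i). rewrite <- INR_IZR_INZ. ring. }
  assert (Hpick : forall i, exists x, (i < k)%nat -> -1 < x < 1 /\ phi x = INR i * PI + PI / 2).
  { intros i. destruct (Nat.lt_ge_cases i k) as [Hi|Hi]; [|exists 0; lia].
    destruct (angle_takes_value (INR i * PI + PI / 2) (-1) 1 Jm J1 ltac:(lra)) as (x & Hx & E).
    - pose proof (pos_INR i). assert (INR i + 1 <= INR k) by (rewrite <- S_INR; apply le_INR; lia).
      rewrite E0. split; nra.
    - exists x. easy. }
  set (zero := fun i => proj1_sig (constructive_indefinite_description _ (Hpick i))).
  assert (Hzs : forall i, (i < k)%nat -> -1 < zero i < 1 /\ phi (zero i) = INR i * PI + PI / 2)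
    by (intros i; exact (proj2_sig (constructive_indefinite_description _ (Hpick i)))).
  clearbody zero.
  assert (Hinj : forall x y, -1 < x < 1 -> -1 < y < 1 -> phi x = phi y -> x = y).
  { intros x y Hx Hy E. destruct (Rtotal_order x y) as [H|[H|H]]; [|easy|].
    - pose proof (angle_strict x y Hl ltac:(unfold J; lra) ltac:(unfold J; lra) H). lra.
    - pose proof (angle_strict y x Hl ltac:(unfold J; lra) ltac:(unfold J; lra) H). lra. }
  split; [exact HX|]. split; [|split; [|split; [|split; [|split]]]].
  - rewrite Hzero by easy. rewrite E0. apply Rgt_not_eq, cos_gt_0; lra.
  - rewrite Hzero by easy. intros H. destruct (cos_eq_0_0 _ H) as [z Hz].
    rewrite Hz, INR_IZR_INZ in Hk.
    assert (-1 < IZR z - IZR (Z.of_nat k) < 0) by (split; nra).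
    rewrite <- minus_IZR in H0. destruct H0 as [H0 H1]. apply lt_IZR in H0, H1. lia.
  - rewrite scaled_flow_deriv by easy. unfold flow_slope. fold phi ell. rewrite E0.
    rewrite <- Rmult_assoc. apply Rmult_lt_0_compat; [easy|].
    apply Rmult_lt_0_compat; [apply exp_pos|]. apply cos_gt_0; lra.
  - intros x Hx Hd. assert (Jx : J x) by (unfold J; lra).
    apply (Hzero x Jx) in Hd. rewrite (scaled_flow_Delta x Jx).
    apply Ropp_neq_0_compat. apply Rmult_integral_contrapositive_currified; [lra|].
    apply Rmult_integral_contrapositive_currified; [easy|].
    apply Rmult_integral_contrapositive_currified; [apply Hex|].
    intros Hf. pose proof (pf_coercive _ _ _ _ HS t x (ell x) (phi x) Ht Jx) as C.
    fold (force x) in C. rewrite Hf, Rmult_0_l in C. pose proof (pf_gm _ _ _ _ HS).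
    pose proof (sin2_cos2 (phi x)) as E. rewrite Hd in E. unfold Rsqr in E. nra.
  - exists (map zero (seq 0 k)). split; [|split].
    + apply NoDup_nth with (d := 0). rewrite length_map, length_seq.
      intros i j Hi Hj E. rewrite (nth_indep _ 0 (zero 0%nat)) in E by (rewrite length_map, length_seq; easy).
      rewrite (nth_indep (map zero (seq 0 k)) 0 (zero 0%nat) (n := j)) in E by (rewrite length_map, length_seq; easy).
      rewrite !map_nth, !seq_nth in E by easy. simpl in E.
      destruct (Hzs i Hi) as [_ Ei]. destruct (Hzs j Hj) as [_ Ej]. rewrite E, Ej in Ei.
      apply INR_eq. nra.
    + rewrite length_map, length_seq. easy.
    + intros x. rewrite in_map_iff. split.
      * intros (i & <- & Hi). apply in_seq in Hi. destruct (Hzs i) as [Hx E]; [lia|].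
        split; [easy|]. apply Hzero; [unfold J; lra|]. apply Hcos; [easy|]. exists i. split; [lia|easy].
      * intros [Hx Hd]. apply Hzero in Hd; [|unfold J; lra]. apply Hcos in Hd; [|easy].
        destruct Hd as (i & Hi & E). exists i. destruct (Hzs i Hi) as [Hxi Ei].
        split; [|apply in_seq; lia]. apply Hinj; [easy|easy|]. rewrite E, Ei. easy.
  - intros x y Hx Hxy Hy Hdx Hdy _.
    assert (Jx : J x) by (unfold J; lra). assert (Jy : J y) by (unfold J; lra).
    apply Hzero in Hdx, Hdy; try easy.
    apply Hcos in Hdx; [|lra]. apply Hcos in Hdy; [|lra].
    destruct Hdx as (i & Hi & Ei). destruct Hdy as (j & Hj & Ej).
    pose proof (angle_strict x y Hl Jx Jy Hxy) as Hs. rewrite Ei, Ej in Hs.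
    assert (Hij : (i < j)%nat) by (apply INR_lt; nra).
    assert (Hij' : INR i + 1 <= INR j) by (rewrite <- S_INR; apply le_INR; lia).
    destruct (angle_takes_value (INR i * PI + PI) x y Jx Jy Hxy) as (z & Hz & Ez).
    { rewrite Ei, Ej. nra. }
    exists z. split; [easy|]. unfold flow_fun. fold phi ell. rewrite Ez.
    replace (sin (INR i * PI + PI)) with 0; [ring|]. symmetry. apply sin_eq_0_1.
    exists (Z.of_nat i + 1)%Z. rewrite plus_IZR, <- INR_IZR_INZ. ring.
Qed.
End FlowSolution.

(** * The family joining the linearisations at zero and at infinity *)

Lemma derivable_bounded_J (f : R -> R) : (forall x, J x -> derivable_at f x) ->
  exists M, forall x, J x -> Rabs (f x) <= M.
Proof.
  intros H.
  assert (Hc : forall x, continuous (fun s => Rabs (f (clamp s))) x).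
  { intros x. apply (continuous_comp (fun s => f (clamp s)) Rabs); [|apply continuous_Rabs].
    apply continuous_eps. intros eps He.
    destruct (derivable_continuous_J f (clamp x) (clamp_in x) (H _ (clamp_in x)) eps He)
      as (d & Hd & K).
    exists d. split; [easy|]. intros y Hy. apply K; [apply clamp_in|].
    eapply Rle_lt_trans; [apply clamp_lipschitz|exact Hy]. }
  destruct (continuity_ab_maj (fun s => Rabs (f (clamp s))) (-1) 1) as (xm & HM & _); [lra| |].
  - intros c _. apply continuity_pt_filterlim, Hc.
  - exists (Rabs (f (clamp xm))). intros x Hx. specialize (HM x Hx). simpl in HM.
    rewrite (clamp_id x Hx) in HM. exact HM.
Qed.

(** Logarithm of the amplitude [t / (1 - t)], which maps [(0, 1)] onto
    [(0, +oo)]. *)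
Definition log_amplitude (t : R) : R := ln t - ln (1 - t).

(** A solution [u] with [u^2 + u'^2 = rho^2] at -1, [rho = t / (1 - t)], is written
    [u = sgn nu * rho * w].  The equation for [w], of radius 1 at -1, is
    [- w'' = lam * g x (sgn nu * rho * w) * w]; it tends to the linear equation
    with weight [r0] as [rho -> 0] and with weight [rinf] as [rho -> +oo]. *)
Definition blowup_field (g : R -> R -> R) (r0 rinf : R -> R) (nu : side)
    (t x l th : R) : R :=
  (if Rle_dec t 0 then r0 x else if Rle_dec 1 t then rinf x
   else g x (sgn nu * (exp (log_amplitude t + l) * sin th))) * sin th.

Lemma exp_log_amplitude t : 0 < t < 1 -> exp (log_amplitude t) = t / (1 - t).
Proof.
  intros Ht. unfold log_amplitude, Rminus. rewrite exp_plus, exp_Ropp, !exp_ln by lra. easy.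
Qed.

Lemma blowup_field_0 g r0 rinf nu x l th : blowup_field g r0 rinf nu 0 x l th = r0 x * sin th.
Proof. unfold blowup_field. destruct Rle_dec; [easy|lra]. Qed.

Lemma blowup_field_1 g r0 rinf nu x l th : blowup_field g r0 rinf nu 1 x l th = rinf x * sin th.
Proof. unfold blowup_field. destruct Rle_dec; [lra|]. destruct Rle_dec; [easy|lra]. Qed.

Lemma blowup_field_interior g r0 rinf nu t x l th : 0 < t < 1 ->
  blowup_field g r0 rinf nu t x l th =
  g x (sgn nu * (exp (log_amplitude t + l) * sin th)) * sin th.
Proof. intros Ht. unfold blowup_field. do 2 (destruct Rle_dec; [lra|]). easy. Qed.

Lemma Rabs_sgn nu : Rabs (sgn nu) = 1.
Proof. destruct nu; simpl; [apply Rabs_R1|]. rewrite Rabs_left; lra. Qed.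

Section Nonlinearity.
Variables (g : R -> R -> R) (r0 rinf : R -> R) (nu : side).
Hypothesis Hg : admissible_g g r0 rinf.
Hypothesis Hgmin : 0 < g_min g.

Lemma g_min_le x xi : J x -> g_min g <= g x xi.
Proof.
  intros Hx. unfold g_min in *.
  destruct (Glb_Rbar_correct (fun y => exists x xi, J x /\ y = g x xi)) as [Hlb _].
  specialize (Hlb (g x xi) ltac:(exists x, xi; easy)).
  destruct (Glb_Rbar (fun y => exists x xi, J x /\ y = g x xi)); simpl in *; lra.
Qed.

Lemma g_min_le_r0 x : J x -> g_min g <= r0 x.
Proof.
  intros Hx. destruct Hg as (_ & _ & _ & H0 & _). apply le_epsilon. intros eps He.
  destruct (H0 eps He) as (d & Hd & K).
  specialize (K x (d / 2) Hx). rewrite Rabs_pos_eq in K by lra. specialize (K ltac:(lra)).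
  apply Rabs_def2 in K. pose proof (g_min_le x (d / 2) Hx). lra.
Qed.

Lemma g_min_le_rinf x : J x -> g_min g <= rinf x.
Proof.
  intros Hx. destruct Hg as (_ & _ & _ & _ & _ & _ & H0 & _). apply le_epsilon. intros eps He.
  destruct (H0 eps He) as (M & K).
  specialize (K x (Rabs M + 1) Hx). pose proof (Rle_abs M). pose proof (Rabs_pos M).
  rewrite (Rabs_pos_eq (Rabs M + 1)) in K by lra. specialize (K ltac:(lra)).
  apply Rabs_def2 in K. pose proof (g_min_le x (Rabs M + 1) Hx). lra.
Qed.

Lemma g_derive x xi : J x -> is_derive (g x) xi (g_xi g x xi).
Proof.
  intros Hx. destruct Hg as ((H & _) & _). apply Derive_correct. apply H, Hx.
Qed.

(** The two limits control [g] for small and for large [xi]; in between, the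
    bound on [xi * g_xi] is a bound on [g_xi]. *)
Lemma g_bounded : exists G, forall x, J x ->
  Rabs (r0 x) <= G /\ Rabs (rinf x) <= G /\ forall xi, Rabs (g x xi) <= G.
Proof.
  destruct Hg as ((HC & _) & (Hr0 & _) & _ & L0 & (Hr1 & _) & _ & L1 & _ & [B HB]).
  destruct (derivable_bounded_J r0 Hr0) as [M0 HM0].
  destruct (derivable_bounded_J rinf Hr1) as [M1 HM1].
  destruct (L0 1 Rlt_0_1) as (d & Hd & K0). destruct (L1 1 Rlt_0_1) as (M & K1).
  assert (HB0 : 0 <= B).
  { eapply Rle_trans; [apply Rabs_pos|apply (HB 0 0)]. unfold J; lra. }
  set (N := Rabs M + d + 1).
  assert (HN : M < N) by (unfold N; pose proof (Rle_abs M); lra).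
  assert (HN0 : d < N) by (unfold N; pose proof (Rabs_pos M); lra).
  set (G := M0 + M1 + 1 + (2 * B / d) * N).
  assert (Hpos : 0 <= M0 /\ 0 <= M1).
  { assert (J0 : J 0) by (unfold J; lra).
    pose proof (HM0 0 J0). pose proof (HM1 0 J0). pose proof (Rabs_pos (r0 0)).
    pose proof (Rabs_pos (rinf 0)). lra. }
  assert (HBd : 0 <= 2 * B / d) by (apply Rdiv_le_0_compat; lra).
  assert (HBN : 0 <= (2 * B / d) * N) by (apply Rmult_le_pos; lra).
  exists G. intros x Hx. specialize (HM0 x Hx). specialize (HM1 x Hx).
  split; [unfold G; lra|]. split; [unfold G; lra|].
  assert (Small : forall xi, 0 < Rabs xi < d -> Rabs (g x xi) <= M0 + 1).
  { intros xi Hxi. specialize (K0 x xi Hx Hxi).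
    replace (g x xi) with ((g x xi - r0 x) + r0 x) by ring.
    eapply Rle_trans; [apply Rabs_triang|]. lra. }
  assert (Large : forall xi, M < Rabs xi -> Rabs (g x xi) <= M1 + 1).
  { intros xi Hxi. specialize (K1 x xi Hx Hxi).
    replace (g x xi) with ((g x xi - rinf x) + rinf x) by ring.
    eapply Rle_trans; [apply Rabs_triang|]. lra. }
  assert (Mid : forall e xi, Rabs e = 1 -> d / 2 <= xi <= N ->
     Rabs (g x (e * xi) - g x (e * N)) <= (2 * B / d) * N).
  { intros e xi He Hxi.
    assert (Dg : forall s, is_derive (fun s => g x (e * s)) s (e * g_xi g x (e * s))).
    { intros s. auto_derive.
      - exists (g_xi g x (e * s)). apply g_derive, Hx.
      - unfold g_xi. replace (Derive (fun x0 : R => g x x0)) with (Derive (g x)) by easy. ring. }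
    destruct (MVT_gen (fun s => g x (e * s)) N xi (fun s => e * g_xi g x (e * s)))
      as (c & Hc & E).
    - intros s _. exact (Dg s).
    - intros s _. apply continuity_pt_filterlim.
      apply (ex_derive_continuous (V := R_NormedModule) (fun s => g x (e * s))).
      eexists. exact (Dg s).
    - rewrite Rmin_right, Rmax_left in Hc by lra. rewrite E.
      rewrite !Rabs_mult, He, Rmult_1_l.
      specialize (HB x (e * c) Hx). rewrite !Rabs_mult, He, Rmult_1_l in HB.
      rewrite (Rabs_pos_eq c) in HB by lra.
      apply Rmult_le_compat; try apply Rabs_pos.
      + apply (Rmult_le_reg_l d); [easy|]. replace (d * (2 * B / d)) with (2 * B) by (field; lra).
        pose proof (Rabs_pos (g_xi g x (e * c))). nra.
      + rewrite Rabs_left1 by lra. lra. }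
  assert (Nonzero : forall xi, xi <> 0 -> Rabs (g x xi) <= G).
  { intros xi Hne. destruct (Rlt_or_le (Rabs xi) d) as [H|H].
    - eapply Rle_trans; [apply Small; split; [apply Rabs_pos_lt, Hne|easy]|]. unfold G; lra.
    - destruct (Rlt_or_le M (Rabs xi)) as [H'|H'].
      + eapply Rle_trans; [apply Large, H'|]. unfold G; lra.
      + assert (He : exists e, Rabs e = 1 /\ xi = e * Rabs xi).
        { destruct (Rle_or_lt 0 xi).
          - exists 1. rewrite Rabs_R1, Rabs_pos_eq by lra. split; ring.
          - exists (-1). rewrite (Rabs_left (-1)), (Rabs_left xi) by lra. split; ring. }
        destruct He as (e & He & E).
        assert (Rabs xi <= N) by lra.
        pose proof (Mid e (Rabs xi) He ltac:(lra)) as P. rewrite <- E in P.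
        assert (Q : Rabs (g x (e * N)) <= M1 + 1).
        { apply Large. rewrite Rabs_mult, He, Rmult_1_l, Rabs_pos_eq; lra. }
        replace (g x xi) with ((g x xi - g x (e * N)) + g x (e * N)) by ring.
        eapply Rle_trans; [apply Rabs_triang|]. unfold G; lra. }
  intros xi. destruct (Req_dec xi 0) as [->|Hne]; [|apply Nonzero, Hne].
  apply le_epsilon. intros eps He.
  assert (Hc : continuous (g x) 0).
  { apply (ex_derive_continuous (V := R_NormedModule)). eexists. apply g_derive, Hx. }
  destruct (continuous_eps_inv _ _ Hc eps He) as (e & Hee & K).
  specialize (K (e / 2)). rewrite Rminus_0_r, Rabs_pos_eq in K by lra. specialize (K ltac:(lra)).
  pose proof (Nonzero (e / 2) ltac:(lra)) as P.
  replace (g x 0) with (- (g x (e / 2) - g x 0) + g x (e / 2)) by ring.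
  eapply Rle_trans; [apply Rabs_triang|]. rewrite Rabs_Ropp. lra.
Qed.

(** [xi * g_xi] is the derivative of [g] with respect to the logarithm of [xi],
    which is why its boundedness gives Lipschitz constants that do not depend on
    the size of the solution. *)
Lemma g_polar_lipschitz G B : 
  (forall x xi, J x -> Rabs (g x xi) <= G) ->
  (forall x xi, J x -> Rabs (xi * g_xi g x xi) <= B) ->
  forall x l th l' th', J x ->
  Rabs (g x (sgn nu * (exp l * sin th)) * sin th - g x (sgn nu * (exp l' * sin th')) * sin th')
  <= B * Rabs (l - l') + (B + G) * Rabs (th - th').
Proof.
  intros HG HB x l th l' th' Hx.
  set (h := fun l th => g x (sgn nu * (exp l * sin th)) * sin th).
  assert (D1 : forall th l, is_derive (fun l => h l th) l
     ((sgn nu * (exp l * sin th) * g_xi g x (sgn nu * (exp l * sin th))) * sin th)).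
  { intros b a. unfold h. auto_derive.
    - exists (g_xi g x (sgn nu * (exp a * sin b))). apply g_derive, Hx.
    - unfold g_xi. replace (Derive (fun x0 : R => g x x0)) with (Derive (g x)) by easy. ring. }
  assert (D2 : forall l th, is_derive (fun th => h l th) th
     ((sgn nu * (exp l * sin th) * g_xi g x (sgn nu * (exp l * sin th)) +
       g x (sgn nu * (exp l * sin th))) * cos th)).
  { intros a b. unfold h. auto_derive.
    - exists (g_xi g x (sgn nu * (exp a * sin b))). apply g_derive, Hx.
    - unfold g_xi. replace (Derive (fun x0 : R => g x x0)) with (Derive (g x)) by easy. ring. }
  change (Rabs (h l th - h l' th') <= B * Rabs (l - l') + (B + G) * Rabs (th - th')).
  replace (h l th - h l' th') with ((h l th - h l' th) + (h l' th - h l' th')) by ring.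
  eapply Rle_trans; [apply Rabs_triang|]. apply Rplus_le_compat.
  - apply (derive_bounded_lipschitz (fun l => h l th) _ B (D1 th)). intros s.
    rewrite Rabs_mult. pose proof (HB x (sgn nu * (exp s * sin th)) Hx).
    pose proof (Rabs_sin_le th). pose proof (Rabs_pos (sin th)).
    pose proof (Rabs_pos (sgn nu * (exp s * sin th) * g_xi g x (sgn nu * (exp s * sin th)))). nra.
  - apply (derive_bounded_lipschitz (fun th => h l' th) _ (B + G) (D2 l')). intros s.
    rewrite Rabs_mult. pose proof (HB x (sgn nu * (exp l' * sin s)) Hx).
    pose proof (HG x (sgn nu * (exp l' * sin s)) Hx).
    pose proof (Rabs_cos_le s). pose proof (Rabs_pos (cos s)).
    pose proof (Rabs_triang (sgn nu * (exp l' * sin s) * g_xi g x (sgn nu * (exp l' * sin s)))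
      (g x (sgn nu * (exp l' * sin s)))).
    set (u := Rabs (sgn nu * (exp l' * sin s) * g_xi g x (sgn nu * (exp l' * sin s)) +
      g x (sgn nu * (exp l' * sin s)))) in *.
    assert (0 <= u) by apply Rabs_pos. nra.
Qed.

(** The delicate point is continuity in [t] at 1: where [xi] stays bounded, [g]
    is not close to [rinf], but there [sin th] is small. *)
Lemma blowup_polar_field : exists G L, polar_field (blowup_field g r0 rinf nu) G L (g_min g).
Proof.
  destruct g_bounded as [G HG].
  pose proof Hg as ((HC & _) & (Hr0 & _) & _ & L0 & (Hr1 & _) & _ & L1 & _ & [B HB]).
  assert (J0 : J 0) by (unfold J; lra).
  assert (HG0 : 0 <= G) by (eapply Rle_trans; [apply Rabs_pos|apply (proj1 (HG 0 J0))]).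
  assert (HB0 : 0 <= B) by (eapply Rle_trans; [apply Rabs_pos|apply (HB 0 0 J0)]).
  pose proof (g_polar_lipschitz G B (fun x xi Hx => proj2 (proj2 (HG x Hx)) xi) HB) as HL.
  exists G, (B + G). constructor.
  - exact Hgmin.
  - lra.
  - intros t x l th Ht Hx. unfold blowup_field. rewrite Rabs_mult.
    pose proof (Rabs_sin_le th). pose proof (Rabs_pos (sin th)). destruct (HG x Hx) as (H1 & H2 & H3).
    match goal with |- Rabs ?q * _ <= _ => assert (Rabs q <= G);
      [destruct Rle_dec; [easy|destruct Rle_dec; [easy|apply H3]]|
       pose proof (Rabs_pos q)] end. nra.
  - intros t x l th l' th' Ht Hx.
    assert (Lin : forall r, Rabs r <= G -> Rabs (r * sin th - r * sin th') <=
       (B + G) * (Rabs (l - l') + Rabs (th - th'))).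
    { intros r Hr. replace (r * sin th - r * sin th') with (r * (sin th - sin th')) by ring.
      rewrite Rabs_mult. pose proof (sin_lipschitz th th'). pose proof (Rabs_pos (l - l')).
      pose proof (Rabs_pos r). pose proof (Rabs_pos (sin th - sin th')). nra. }
    destruct (Rle_lt_dec t 0); [replace t with 0 by lra; rewrite !blowup_field_0; apply Lin, HG, Hx|].
    destruct (Rle_lt_dec 1 t); [replace t with 1 by lra; rewrite !blowup_field_1; apply Lin, HG, Hx|].
    rewrite !blowup_field_interior by lra.
    eapply Rle_trans; [apply HL, Hx|].
    replace (log_amplitude t + l - (log_amplitude t + l')) with (l - l') by ring.
    pose proof (Rabs_pos (l - l')). nra.
  - intros t l th Ht x0 Hx0 eps He.
    assert (Cont : forall f, derivable_at f x0 -> exists d, 0 < d /\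
      forall x, J x -> Rabs (x - x0) < d -> Rabs (f x * sin th - f x0 * sin th) < eps).
    { intros f Hf. destruct (derivable_continuous_J f x0 Hx0 Hf eps He) as (d & Hd & K).
      exists d. split; [easy|]. intros x Jx Hx. specialize (K x Jx Hx).
      replace (f x * sin th - f x0 * sin th) with ((f x - f x0) * sin th) by ring.
      rewrite Rabs_mult. pose proof (Rabs_sin_le th). pose proof (Rabs_pos (f x - f x0)). nra. }
    destruct (Rle_lt_dec t 0).
    { replace t with 0 by lra. destruct (Cont r0 (Hr0 x0 Hx0)) as (d & Hd & K).
      exists d. split; [easy|]. intros. rewrite !blowup_field_0. auto. }
    destruct (Rle_lt_dec 1 t).
    { replace t with 1 by lra. destruct (Cont rinf (Hr1 x0 Hx0)) as (d & Hd & K).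
      exists d. split; [easy|]. intros. rewrite !blowup_field_1. auto. }
    destruct (Cont (fun x => g x (sgn nu * (exp (log_amplitude t + l) * sin th))))
      as (d & Hd & K); [apply (HC x0 _ Hx0)|].
    exists d. split; [easy|]. intros. rewrite !blowup_field_interior by lra. auto.
  - intros t0 C eps Ht0 He.
    destruct (Rle_lt_dec t0 0) as [Hz|Hz].
    { replace t0 with 0 in * by lra. clear Hz.
      destruct (L0 eps He) as (d & Hd & K).
      assert (Hd1 : 0 < d / (2 * exp C)) by (apply Rdiv_lt_0_compat; [easy|pose proof (exp_pos C); lra]).
      exists (Rmin (1 / 2) (d / (2 * exp C))). split; [apply Rmin_glb_lt; lra|].
      intros t x l th Ht Htd Hx Hl. rewrite Rminus_0_r, Rabs_pos_eq in Htd by lra.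
      pose proof (Rmin_l (1 / 2) (d / (2 * exp C))). pose proof (Rmin_r (1 / 2) (d / (2 * exp C))).
      rewrite blowup_field_0.
      destruct (Rle_lt_dec t 0).
      { replace t with 0 by lra. rewrite blowup_field_0, Rminus_diag, Rabs_R0. lra. }
      rewrite blowup_field_interior by lra. 
      destruct (Req_dec (sin th) 0) as [Es|Es].
      { rewrite Es, !Rmult_0_r, Rminus_0_r, Rabs_R0. lra. }
      rewrite <- Rmult_minus_distr_r, Rabs_mult.
      assert (Hxi : 0 < Rabs (sgn nu * (exp (log_amplitude t + l) * sin th)) < d).
      { rewrite !Rabs_mult, Rabs_sgn, Rmult_1_l, (Rabs_pos_eq (exp _)) by apply Rlt_le, exp_pos.
        split; [apply Rmult_lt_0_compat; [apply exp_pos|apply Rabs_pos_lt, Es]|].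
        rewrite exp_plus, exp_log_amplitude by lra.
        assert (A1 : t / (1 - t) <= 2 * t).
        { apply (Rmult_le_reg_r (1 - t)); [lra|]. field_simplify; [nra|lra]. }
        assert (A2 : exp l <= exp C).
        { destruct (Req_dec l C) as [->|N]; [lra|]. apply Rlt_le, exp_increasing.
          apply Rabs_le_between in Hl. lra. }
        assert (A3 : 0 <= t / (1 - t)) by (apply Rdiv_le_0_compat; lra).
        pose proof (exp_pos l). pose proof (exp_pos C).
        pose proof (Rabs_sin_le th). pose proof (Rabs_pos (sin th)).
        assert (A4 : t / (1 - t) * exp l <= 2 * t * exp C) by (apply Rmult_le_compat; lra).
        assert (A5 : 2 * t * exp C < d).
        { replace d with (2 * (d / (2 * exp C)) * exp C) by (field; lra).
          apply Rmult_lt_compat_r; lra. }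
        assert (0 <= t / (1 - t) * exp l) by (apply Rmult_le_pos; lra). nra. }
      specialize (K x _ Hx Hxi). pose proof (Rabs_sin_le th).
      eapply Rle_trans; [apply Rmult_le_compat; [apply Rabs_pos|apply Rabs_pos|apply Rlt_le, K|eassumption]|lra]. }
    destruct (Rle_lt_dec 1 t0) as [Ho|Ho].
    { replace t0 with 1 in * by lra. clear Hz Ho.
      destruct (L1 eps He) as (M & K).
      set (D := 4 * (G + 1) * (Rabs M + 1) * exp C).
      assert (HD : 0 < D).
      { unfold D. pose proof (exp_pos C). pose proof (Rabs_pos M).
        repeat apply Rmult_lt_0_compat; lra. }
      assert (Hd1 : 0 < eps / D) by (apply Rdiv_lt_0_compat; lra).
      exists (Rmin (1 / 2) (eps / D)). split; [apply Rmin_glb_lt; lra|].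
      intros t x l th Ht Htd Hx Hl. rewrite Rabs_left1 in Htd by lra.
      pose proof (Rmin_l (1 / 2) (eps / D)). pose proof (Rmin_r (1 / 2) (eps / D)).
      rewrite blowup_field_1.
      destruct (Rle_lt_dec 1 t).
      { replace t with 1 by lra. rewrite blowup_field_1, Rminus_diag, Rabs_R0. lra. }
      rewrite blowup_field_interior by lra.
      rewrite <- Rmult_minus_distr_r, Rabs_mult.
      set (xi := sgn nu * (exp (log_amplitude t + l) * sin th)).
      pose proof (Rabs_sin_le th) as Hs.
      destruct (Rlt_or_le M (Rabs xi)) as [HM|HM].
      { specialize (K x xi Hx HM).
        eapply Rle_trans; [apply Rmult_le_compat; [apply Rabs_pos|apply Rabs_pos|apply Rlt_le, K|eassumption]|lra]. }
      (* the bounded range of xi, where sin th is of the order 1 - t *)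
      assert (A0 : Rabs xi = t / (1 - t) * exp l * Rabs (sin th)).
      { unfold xi. rewrite !Rabs_mult, Rabs_sgn, Rmult_1_l, (Rabs_pos_eq (exp _)) by apply Rlt_le, exp_pos.
        rewrite exp_plus, exp_log_amplitude by lra. easy. }
      assert (A2 : exp (- C) <= exp l).
      { destruct (Req_dec l (- C)) as [->|N]; [lra|]. apply Rlt_le, exp_increasing.
        apply Rabs_le_between in Hl. lra. }
      rewrite exp_Ropp in A2. pose proof (exp_pos C) as EC. pose proof (exp_pos l) as El.
      pose proof (Rabs_pos (sin th)) as Hs0.
      assert (A3 : Rabs (sin th) <= 2 * (1 - t) * exp C * (Rabs M + 1)).
      { assert (B1 : / (2 * (1 - t)) <= t / (1 - t)).
        { apply (Rmult_le_reg_r (2 * (1 - t))); [lra|]. rewrite Rinv_l by lra.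
          replace (t / (1 - t) * (2 * (1 - t))) with (2 * t) by (field; lra). lra. }
        assert (B2 : / (2 * (1 - t)) * / exp C * Rabs (sin th) <= Rabs M + 1).
        { apply Rle_trans with (Rabs xi); [|pose proof (Rle_abs M); lra].
          rewrite A0. apply Rmult_le_compat_r; [easy|].
          apply Rmult_le_compat; try easy; apply Rlt_le, Rinv_0_lt_compat; lra. }
        replace (Rabs (sin th)) with
          ((2 * (1 - t) * exp C) * (/ (2 * (1 - t)) * / exp C * Rabs (sin th))) by (field; lra).
        apply Rmult_le_compat_l; [|exact B2]. apply Rmult_le_pos; lra. }
      destruct (HG x Hx) as (_ & H2 & H3). specialize (H3 xi).
      assert (A4 : Rabs (g x xi - rinf x) <= 2 * (G + 1)).
      { eapply Rle_trans; [apply Rabs_triang|]. rewrite Rabs_Ropp. lra. }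
      apply Rle_trans with ((2 * (G + 1)) * (2 * (1 - t) * exp C * (Rabs M + 1))).
      { apply Rmult_le_compat; try easy. apply Rabs_pos. }
      replace (2 * (G + 1) * (2 * (1 - t) * exp C * (Rabs M + 1))) with ((1 - t) * D)
        by (unfold D; ring).
      apply Rle_trans with ((eps / D) * D); [|right; field; lra].
      apply Rmult_le_compat_r; lra. }
    assert (Hc : continuous log_amplitude t0).
    { apply (ex_derive_continuous (V := R_NormedModule)). unfold log_amplitude. auto_derive. lra. }
    destruct (continuous_eps_inv _ _ Hc (eps / (B + 1))) as (d & Hd & K).
    { apply Rdiv_lt_0_compat; lra. }
    exists (Rmin d (Rmin t0 (1 - t0))). split; [repeat apply Rmin_glb_lt; lra|].
    intros t x l th Ht Htd Hx _.
    pose proof (Rmin_l d (Rmin t0 (1 - t0))). pose proof (Rmin_r d (Rmin t0 (1 - t0))).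
    pose proof (Rmin_l t0 (1 - t0)). pose proof (Rmin_r t0 (1 - t0)).
    specialize (K t ltac:(lra)). apply Rabs_def2 in Htd.
    rewrite !blowup_field_interior by lra.
    eapply Rle_trans; [apply HL, Hx|].
    rewrite (Rminus_diag th), Rabs_R0.
    replace (log_amplitude t + l - (log_amplitude t0 + l)) with (log_amplitude t - log_amplitude t0) by ring.
    set (k := Rabs (log_amplitude t - log_amplitude t0)) in *.
    assert (0 <= k) by apply Rabs_pos.
    apply Rlt_le in K. apply (Rmult_le_compat_l (B + 1)) in K; [|lra].
    replace ((B + 1) * (eps / (B + 1))) with eps in K by (field; lra). lra.
  - intros t x l th Ht Hx. unfold blowup_field.
    assert (Sq : forall r, g_min g <= r -> g_min g * sin th ^ 2 <= r * sin th * sin th).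
    { intros r Hr. replace (r * sin th * sin th) with (r * sin th ^ 2) by ring.
      apply Rmult_le_compat_r; [apply pow2_ge_0|easy]. }
    apply Sq. destruct Rle_dec; [apply g_min_le_r0, Hx|].
    destruct Rle_dec; [apply g_min_le_rinf, Hx|apply g_min_le, Hx].
Qed.
End Nonlinearity.

(** * Continuity on the box *)

Lemma box_continuous_const A c : box_continuous A (fun _ _ _ => c).
Proof.
  intros t l a _ eps He. exists 1. split; [lra|]. intros. rewrite Rminus_diag, Rabs_R0. easy.
Qed.

Lemma box_continuous_plus A F H : box_continuous A F -> box_continuous A H ->
  box_continuous A (fun t l a => F t l a + H t l a).
Proof.
  intros HF HH t l a Hin eps He.
  destruct (HF t l a Hin (eps / 2)) as (d1 & Hd1 & K1); [lra|].
  destruct (HH t l a Hin (eps / 2)) as (d2 & Hd2 & K2); [lra|].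
  exists (Rmin d1 d2). split; [apply Rmin_glb_lt; easy|]. intros t' l' a' Hb.
  specialize (K1 t' l' a' (box_ball_le _ _ _ _ _ _ _ _ _ (Rmin_l _ _) Hb)).
  specialize (K2 t' l' a' (box_ball_le _ _ _ _ _ _ _ _ _ (Rmin_r _ _) Hb)).
  replace (F t' l' a' + H t' l' a' - (F t l a + H t l a)) with
    ((F t' l' a' - F t l a) + (H t' l' a' - H t l a)) by ring.
  eapply Rle_lt_trans; [apply Rabs_triang|]. lra.
Qed.

Lemma box_continuous_mult A F H : box_continuous A F -> box_continuous A H ->
  box_continuous A (fun t l a => F t l a * H t l a).
Proof.
  intros HF HH t l a Hin eps He.
  set (f := Rabs (F t l a)). set (h := Rabs (H t l a)).
  assert (Hf : 0 <= f) by apply Rabs_pos. assert (Hh : 0 <= h) by apply Rabs_pos.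
  assert (E1 : 0 < eps / (2 * (h + 1))) by (apply Rdiv_lt_0_compat; lra).
  assert (E2 : 0 < eps / (2 * (f + 1))) by (apply Rdiv_lt_0_compat; lra).
  destruct (HF t l a Hin (Rmin 1 (eps / (2 * (h + 1))))) as (d1 & Hd1 & K1); [apply Rmin_glb_lt; lra|].
  destruct (HH t l a Hin (eps / (2 * (f + 1)))) as (d2 & Hd2 & K2); [easy|].
  exists (Rmin d1 d2). split; [apply Rmin_glb_lt; easy|]. intros t' l' a' Hb.
  specialize (K1 t' l' a' (box_ball_le _ _ _ _ _ _ _ _ _ (Rmin_l _ _) Hb)).
  specialize (K2 t' l' a' (box_ball_le _ _ _ _ _ _ _ _ _ (Rmin_r _ _) Hb)).
  pose proof (Rmin_l 1 (eps / (2 * (h + 1)))). pose proof (Rmin_r 1 (eps / (2 * (h + 1)))).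
  assert (Hf' : Rabs (F t' l' a') <= f + 1).
  { replace (F t' l' a') with ((F t' l' a' - F t l a) + F t l a) by ring.
    eapply Rle_trans; [apply Rabs_triang|]. fold f. lra. }
  eapply Rle_lt_trans; [apply (Rabs_mult_diff _ _ _ (H t l a) (f + 1) h Hf'); right; easy|].
  set (p := Rabs (H t' l' a' - H t l a)) in *. set (q := Rabs (F t' l' a' - F t l a)) in *.
  assert (P : (f + 1) * p < (f + 1) * (eps / (2 * (f + 1)))) by (apply Rmult_lt_compat_l; lra).
  assert (Q : h * q <= (h + 1) * (eps / (2 * (h + 1)))).
  { apply Rmult_le_compat; try lra. apply Rabs_pos. }
  replace ((f + 1) * (eps / (2 * (f + 1)))) with (eps / 2) in P by (field; lra).
  replace ((h + 1) * (eps / (2 * (h + 1)))) with (eps / 2) in Q by (field; lra). lra.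
Qed.

Lemma box_continuous_comp A F (h : R -> R) : (forall x, continuous h x) ->
  box_continuous A F -> box_continuous A (fun t l a => h (F t l a)).
Proof.
  intros Hh HF t l a Hin eps He.
  destruct (continuous_eps_inv _ _ (Hh (F t l a)) eps He) as (e & Hee & K).
  destruct (HF t l a Hin e Hee) as (d & Hd & K1). exists d. split; [easy|].
  intros t' l' a' Hb. apply K, K1, Hb.
Qed.

Lemma box_continuous_time A (p : R -> R) : (forall x, continuous p x) ->
  box_continuous A (fun t _ _ => p t).
Proof.
  intros Hp t l a _ eps He. destruct (continuous_eps_inv _ _ (Hp t) eps He) as (d & Hd & K).
  exists d. split; [easy|]. intros t' l' a' (_ & Ht & _). apply K, Ht.
Qed.

Lemma box_continuous_sum A (n : nat) (F : nat -> R -> R -> R -> R) :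
  (forall i, (1 <= i <= n)%nat -> box_continuous A (F i)) ->
  box_continuous A (fun t l a => sum_n_m (fun i => F i t l a) 1 n).
Proof.
  induction n as [|n IH]; intros H.
  - intros t l a _ eps He. exists 1. split; [lra|]. intros.
    rewrite !sum_n_m_zero by lia. rewrite Rminus_diag, Rabs_R0. easy.
  - assert (HP : box_continuous A (fun t l a => sum_n_m (fun i => F i t l a) 1 n + F (S n) t l a)).
    { apply box_continuous_plus; [apply IH; intros; apply H; lia|apply H; lia]. }
    intros t l a Hin eps He. destruct (HP t l a Hin eps He) as (d & Hd & K).
    exists d. split; [easy|]. intros t' l' a' Hb. rewrite !sum_n_Sm by lia. apply K, Hb.
Qed.

(** * Rotation of the angle *)

Lemma sin_shift_PI x k : sin (x - INR k * PI) = (-1) ^ k * sin x.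
Proof.
  induction k as [|k IH].
  - simpl. rewrite Rmult_0_l, Rminus_0_r. ring.
  - rewrite S_INR. replace (x - (INR k + 1) * PI) with ((x - INR k * PI) - PI) by ring.
    rewrite sin_minus, cos_PI, sin_PI, IH. simpl. ring.
Qed.

Lemma cos_half_odd k : cos (INR k * PI + PI / 2) = 0 /\ cos (INR k * PI - PI / 2) = 0.
Proof.
  split; apply cos_eq_0_1.
  - exists (Z.of_nat k). rewrite <- INR_IZR_INZ. ring.
  - exists (Z.of_nat k - 1)%Z. rewrite minus_IZR, <- INR_IZR_INZ. field.
Qed.

(** The lift to the line of [th |-> atan (om * tan th)]: the angle of the pair
    [(om * u, u')], which an equation [- u'' = q * u] with [q >= om ^ 2] rotates at
    speed at least [om].  It agrees with [th] at the multiples of [PI / 2]. *)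
Definition rescaled_angle (om th : R) : R :=
  th + atan ((om - 1) * (sin th * cos th) / (cos th ^ 2 + om * sin th ^ 2)).

Lemma rescaled_angle_denominator om th : 0 < om -> 0 < cos th ^ 2 + om * sin th ^ 2.
Proof.
  intros Ho. pose proof (sin2_cos2 th) as E. unfold Rsqr in E.
  pose proof (pow2_ge_0 (cos th)). pose proof (pow2_ge_0 (sin th)).
  assert (0 <= om * sin th ^ 2) by nra.
  destruct (Rle_lt_or_eq_dec 0 (cos th ^ 2)) as [|E2]; [easy|lra|].
  assert (sin th ^ 2 = 1) by nra. nra.
Qed.

Lemma rescaled_angle_derive om th : 0 < om ->
  is_derive (rescaled_angle om) th (om / (cos th ^ 2 + om ^ 2 * sin th ^ 2)).
Proof.
  intros Ho. pose proof (rescaled_angle_denominator om th Ho) as HD.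
  assert (HD2 : 0 < cos th ^ 2 + om ^ 2 * sin th ^ 2).
  { apply (rescaled_angle_denominator (om ^ 2)). nra. }
  pose proof (sin2_cos2 th) as E. unfold Rsqr in E.
  unfold rescaled_angle.
  auto_derive; [lra|].
  set (s := sin th) in *. set (c := cos th) in *.
  set (d := c * (c * 1) + om * (s * (s * 1))). set (A := (om - 1) * (s * c)).
  assert (Hd : 0 < d) by (unfold d; lra).
  assert (Ec : c ^ 2 = 1 - s ^ 2) by lra.
  assert (HdA : d ^ 2 + A ^ 2 = c ^ 2 + om ^ 2 * s ^ 2).
  { unfold d, A. replace (((om - 1) * (s * c)) ^ 2) with ((om - 1) ^ 2 * s ^ 2 * c ^ 2) by ring.
    replace (c * (c * 1)) with (c ^ 2) by ring. rewrite Ec. ring. }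
  match goal with |- 1 + (?a1 * / d + A * (- ?d1 * / (d * d))) * / _ = _ =>
    transitivity (1 + (a1 * d - A * d1) / (d ^ 2 + A ^ 2));
    [field; nra|replace (a1 * d - A * d1) with ((om - 1) * (c ^ 2 - om * s ^ 2))] end.
  - rewrite HdA.
    apply (Rmult_eq_reg_r (c ^ 2 + om ^ 2 * s ^ 2)); [|lra].
    replace (om / (c ^ 2 + om ^ 2 * s ^ 2) * (c ^ 2 + om ^ 2 * s ^ 2)) with om by (field; lra).
    replace ((1 + (om - 1) * (c ^ 2 - om * s ^ 2) / (c ^ 2 + om ^ 2 * s ^ 2)) *
      (c ^ 2 + om ^ 2 * s ^ 2)) with (c ^ 2 + om ^ 2 * s ^ 2 + (om - 1) * (c ^ 2 - om * s ^ 2))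
      by (field; lra).
    rewrite Ec. ring.
  - unfold d, A.
    transitivity ((om - 1) * (c ^ 2 - om * s ^ 2) * (s * s + c * c)); [rewrite E|]; ring.
Qed.

(** Sturm comparison: on [J], of length 2, the rescaled angle increases by at least
    [(k + 2) * PI] once [lam * gm >= ((k + 2) * PI / 2) ^ 2]. *)
Lemma angle_lower_bound S G L gm t lam a k : polar_field S G L gm -> 0 <= t <= 1 ->
  ((INR k + 2) * PI / 2) ^ 2 <= lam * gm -> - (PI / 2) <= a ->
  INR k * PI + PI / 2 < fst (flow S t lam a) 1.
Proof.
  intros HS Ht Hlg Ha. pose proof PI_RGT_0 as HPI. pose proof (pos_INR k) as Hk.
  set (om := (INR k + 2) * PI / 2) in *.
  assert (Ho : 0 < om) by (unfold om; nra).
  pose proof (pf_gm _ _ _ _ HS) as Hgm.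
  assert (Hlam : 0 < lam).
  { apply (Rmult_lt_reg_r gm); [easy|]. rewrite Rmult_0_l. nra. }
  set (phi := fst (flow S t lam a)).
  assert (Jm : J (-1)) by (unfold J; lra). assert (J1 : J 1) by (unfold J; lra).
  assert (Hrot : rescaled_angle om (phi (-1)) - om * (-1) <= rescaled_angle om (phi 1) - om * 1).
  { apply (derive_nonneg_le (fun s => rescaled_angle om (phi s) - om * s)
      (fun s => om / (cos (phi s) ^ 2 + om ^ 2 * sin (phi s) ^ 2) *
        (cos (phi s) ^ 2 + lam * S t s (snd (flow S t lam a) s) (phi s) * sin (phi s)) - om)); [lra| |].
    - intros s Hs. apply derive_minus.
      + rewrite Rmult_comm.
        apply (is_derive_comp (rescaled_angle om) phi); [apply rescaled_angle_derive, Ho|].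
        apply (angle_derive S G L gm HS t lam a Ht (Rlt_le _ _ Hlam)). exact Hs.
      + auto_derive; [easy|ring].
    - intros s Hs.
      pose proof (pf_coercive _ _ _ _ HS t s (snd (flow S t lam a) s) (phi s) Ht Hs) as C.
      set (F := S t s (snd (flow S t lam a) s) (phi s)) in *.
      assert (HD2 : 0 < cos (phi s) ^ 2 + om ^ 2 * sin (phi s) ^ 2)
        by (apply (rescaled_angle_denominator (om ^ 2)); nra).
      set (D := cos (phi s) ^ 2 + om ^ 2 * sin (phi s) ^ 2) in *.
      assert (D <= cos (phi s) ^ 2 + lam * F * sin (phi s)).
      { unfold D. apply Rplus_le_compat_l. rewrite Rmult_assoc.
        apply Rle_trans with (lam * (gm * sin (phi s) ^ 2)).
        - rewrite <- Rmult_assoc. apply Rmult_le_compat_r; [apply pow2_ge_0|easy].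
        - apply Rmult_le_compat_l; lra. }
      apply Rle_trans with (om / D * D - om); [right; field; lra|].
      apply Rplus_le_compat_r, Rmult_le_compat_l; [|easy].
      apply Rlt_le, Rdiv_lt_0_compat; easy. }
  assert (mono : forall x y, x <= y -> rescaled_angle om x <= rescaled_angle om y).
  { intros x y Hxy. apply (derive_nonneg_le _ _ x y Hxy (fun s _ => rescaled_angle_derive om s Ho)).
    intros s _. apply Rlt_le, Rdiv_lt_0_compat; [easy|].
    apply (rescaled_angle_denominator (om ^ 2)). nra. }
  assert (fixed : forall x, cos x = 0 -> rescaled_angle om x = x).
  { intros x E. unfold rescaled_angle. rewrite E.
    replace ((om - 1) * (sin x * 0) / (0 ^ 2 + om * sin x ^ 2)) with 0.
    - rewrite atan_0. ring.
    - unfold Rdiv. ring. }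
  assert (E0 : phi (-1) = a) by apply (angle_start S G L gm HS t lam a Ht (Rlt_le _ _ Hlam)).
  apply Rnot_le_lt. intros Hle. apply mono in Hle. apply mono in Ha.
  rewrite (fixed (INR k * PI + PI / 2)) in Hle by apply cos_half_odd.
  rewrite (fixed (- (PI / 2))) in Ha by (rewrite cos_neg; apply cos_PI2).
  fold phi in Hle. rewrite E0 in Hrot. unfold om in *. nra.
Qed.

(** * Shooting *)

Definition boundary_defect (S : R -> R -> R -> R -> R) (m : side -> nat)
    (eta al : side -> nat -> R) (nu : side) (s t lam a : R) : R :=
  flow_fun S t lam a (sgn nu) -
  s * sum_n_m (fun i => al nu i * flow_fun S t lam a (eta nu i)) 1 (m nu).

Definition clip (x : R) : R := Rmax 0 (Rmin x 1).

Lemma clip_continuous x : continuous clip x.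
Proof.
  apply (lipschitz_continuous clip 1). intros u v. rewrite Rmult_1_l.
  unfold clip, Rmax, Rmin. destruct (Rle_dec u 1), (Rle_dec v 1);
    repeat destruct (Rle_dec 0 _); unfold Rabs; repeat destruct Rcase_abs; lra.
Qed.

Lemma clip_range x : 0 <= clip x <= 1.
Proof. unfold clip, Rmax, Rmin. destruct (Rle_dec x 1); destruct Rle_dec; lra. Qed.

Lemma clip_low x : x <= 0 -> clip x = 0.
Proof. unfold clip, Rmax, Rmin. destruct (Rle_dec x 1); destruct Rle_dec; lra. Qed.

Lemma clip_high x : 1 <= x -> clip x = 1.
Proof. unfold clip, Rmax, Rmin. destruct (Rle_dec x 1); destruct Rle_dec; lra. Qed.

Lemma clip_affine_continuous a b c d x : continuous (fun y => a + b * clip (c * y + d)) x.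
Proof.
  apply (continuous_plus (V := R_NormedModule) (fun _ => a)); [apply continuous_const|].
  apply (continuous_mult (K := R_AbsRing) (fun _ => b)); [apply continuous_const|].
  apply (continuous_comp (fun y => c * y + d) clip); [|apply clip_continuous].
  apply (ex_derive_continuous (V := R_NormedModule)). auto_derive. easy.
Qed.

Lemma norm1_pos n a : 0 <= norm1 n a.
Proof.
  pose proof (sum_abs_bound n a (fun _ => 1) 1) as H.
  rewrite Rmult_1_r in H. eapply Rle_trans; [apply Rabs_pos|apply H].
  intros. rewrite Rabs_R1. lra.
Qed.

Lemma calA_scale m c al s : 0 <= s <= 1 -> calA m c al -> calA m c (fun nu i => s * al nu i).
Proof.
  intros Hs H nu. specialize (H nu). pose proof (norm1_pos (m nu) (al nu)).
  assert (E : norm1 (m nu) (fun i => s * al nu i) = s * norm1 (m nu) (al nu)).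
  { unfold norm1. rewrite <- (sum_n_m_mult_l (K := R_Ring)). apply sum_n_m_ext.
    intros i. rewrite Rabs_mult, Rabs_pos_eq by lra. easy. }
  rewrite E. nra.
Qed.

Section Continuation.
Variables (S : R -> R -> R -> R -> R) (G L gm : R).
Hypothesis HS : polar_field S G L gm.
Variables (m : side -> nat) (eta al : side -> nat -> R) (k : nat).
Hypothesis Hpoints : valid_points m eta.
Hypothesis Hk : (1 <= k)%nat.
Hypothesis HA : calA m 1 al.

Definition shooting_zero (s t lam a : R) : Prop :=
  boundary_defect S m eta al Minus s t lam a = 0 /\
  boundary_defect S m eta al Plus s t lam a = 0.

Lemma spaceX_of_zero s t lam a c : 0 <= t <= 1 -> 0 <= lam -> shooting_zero s t lam a ->
  spaceX m eta (fun nu i => s * al nu i) (fun x => c * flow_fun S t lam a x).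
Proof.
  intros Ht Hl [Z1 Z2]. split; [apply (scaled_flow_C2 S G L gm HS); easy|].
  intros nu.
  assert (Z : boundary_defect S m eta al nu s t lam a = 0) by (destruct nu; easy).
  unfold boundary_defect in Z. apply Rminus_diag_uniq in Z. rewrite Z.
  rewrite <- Rmult_assoc.
  rewrite <- (sum_n_m_mult_l (K := R_Ring) (c * s)). apply sum_n_m_ext.
  intros i. unfold mult; simpl. ring.
Qed.

Lemma flow_fun_nonzero t lam a c : 0 <= t <= 1 -> 0 <= lam -> c <> 0 ->
  nonzero (fun x => c * flow_fun S t lam a x).
Proof.
  intros Ht Hl Hc. apply NNPP. intros Hn.
  assert (Z : eq_on_J (fun _ => 0) (fun x => c * flow_fun S t lam a x)).
  { intros x Hx. symmetry. apply NNPP. intros Hne. apply Hn. exists x. easy. }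
  assert (J0 : J 0) by (unfold J; lra).
  assert (D : deriv (fun x => c * flow_fun S t lam a x) 0 = 0).
  { apply deriv_eq; [easy|]. apply (D_in_ext (fun _ => 0)); [easy|easy|].
    apply is_derive_D_in. exact (is_derive_const 0 0). }
  rewrite (scaled_flow_deriv S G L gm HS) in D by easy.
  specialize (Z 0 J0). simpl in Z. unfold flow_fun in Z. unfold flow_slope in D.
  pose proof (exp_pos (snd (flow S t lam a) 0)) as He.
  symmetry in Z. apply Rmult_integral in Z. destruct Z as [Z|Z]; [easy|].
  apply Rmult_integral in Z. destruct Z as [Z|Z]; [lra|].
  apply Rmult_integral in D. destruct D as [D|D]; [easy|].
  apply Rmult_integral in D. destruct D as [D|D]; [lra|].
  pose proof (sin2_cos2 (fst (flow S t lam a) 0)) as E. rewrite Z, D in E. unfold Rsqr in E. lra.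
Qed.

(** For [lam = 0] solutions are affine, and the boundary conditions exclude all
    of these but 0. *)
Lemma no_zero_at_0 s t a : 0 <= s <= 1 -> 0 <= t <= 1 -> ~ shooting_zero s t 0 a.
Proof.
  intros Hs Ht HZ.
  destruct (flow_fun_nonzero t 0 a 1 Ht (Rle_refl 0) R1_neq_R0) as (x & Hx & Hne).
  apply Hne.
  apply (spaceX_Delta_zero m eta (fun nu i => s * al nu i)
    (fun x => 1 * flow_fun S t 0 a x) Hpoints (calA_scale m 1 al s Hs HA)).
  - apply spaceX_of_zero; easy || apply Rle_refl.
  - intros y Hy. rewrite (scaled_flow_Delta S G L gm HS) by (easy || apply Rle_refl). ring.
  - easy.
Qed.

Lemma flow_fun_box_continuous (pt pm : R -> R) (Lam : R) x : J x ->
  (forall y, continuous pt y) -> (forall y, continuous pm y) ->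
  (forall y, 0 <= pt y <= 1) -> (forall y, 0 < pm y <= Lam) ->
  box_continuous (PI / 2) (fun y l a => fst (flow S (pt y) (pm y * l) a) x) /\
  box_continuous (PI / 2) (fun y l a => snd (flow S (pt y) (pm y * l) a) x).
Proof.
  intros Hx Ct Cm Rt Rm.
  assert (Joint : forall y l a, in_box (PI / 2) y l a -> forall eps, 0 < eps ->
    exists d, 0 < d /\ forall y' l' a', box_ball (PI / 2) d y l a y' l' a' ->
     Rabs (fst (flow S (pt y') (pm y' * l') a') x - fst (flow S (pt y) (pm y * l) a) x) < eps /\
     Rabs (snd (flow S (pt y') (pm y' * l') a') x - snd (flow S (pt y) (pm y * l) a) x) < eps).
  { intros y l a Hin eps He.
    assert (range : forall y l a, in_box (PI / 2) y l a -> 0 <= pm y * l <= Lam).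
    { intros y' l' a' (_ & Hl & _). specialize (Rm y'). split; nra. }
    destruct (flow_continuous S G L gm HS Lam (pt y) (pm y * l) a eps (Rt y) (range _ _ _ Hin) He)
      as (d & Hd & K).
    destruct (box_continuous_time (PI / 2) pt Ct y l a Hin d Hd) as (d1 & Hd1 & K1).
    assert (Cl : box_continuous (PI / 2) (fun y l _ => l)).
    { intros y0 l0 a0 _ e Hee. exists e. split; [easy|]. intros y' l' a' (_ & _ & Hl & _). exact Hl. }
    destruct (box_continuous_mult _ _ _ (box_continuous_time (PI / 2) pm Cm) Cl y l a Hin d Hd)
      as (d2 & Hd2 & K2).
    exists (Rmin d (Rmin d1 d2)). split; [repeat apply Rmin_glb_lt; easy|].
    intros y' l' a' Hb.
    assert (B1 : box_ball (PI / 2) d1 y l a y' l' a').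
    { revert Hb. apply box_ball_le. eapply Rle_trans; [apply Rmin_r|apply Rmin_l]. }
    assert (B2 : box_ball (PI / 2) d2 y l a y' l' a').
    { revert Hb. apply box_ball_le. eapply Rle_trans; [apply Rmin_r|apply Rmin_r]. }
    assert (B0 : box_ball (PI / 2) d y l a y' l' a') by (revert Hb; apply box_ball_le, Rmin_l).
    apply K; [apply Rt|apply (range y' l' a'), Hb|apply (K1 y' l' a'), B1|apply (K2 y' l' a'), B2|apply B0|exact Hx]. }
  split; intros y l a Hin eps He; destruct (Joint y l a Hin eps He) as (d & Hd & K);
    exists d; (split; [easy|]); intros y' l' a' Hb; apply K, Hb.
Qed.

(** Instance of [zero_continuation] with the two boundary defects as [F1], [F2]
    and with [angle at 1 - k * PI] as [N].  For [s = 0] the boundary conditions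
    are those of Dirichlet: the first defect is a positive multiple of [sin a],
    and, up to the sign [(-1) ^ k], the second is one of [sin N].  For [a = 0] the
    angle at 1 is less than [PI] when [lam = 0], and is past the strip
    [|N| <= PI / 2] for the largest [lam], by [angle_lower_bound]. *)
Lemma shooting_continuation (ps pt pm : R -> R) (Lam : R)
  (Cs : forall y, continuous ps y) (Ct : forall y, continuous pt y)
  (Cm : forall y, continuous pm y)
  (Rs : forall y, 0 <= ps y <= 1) (Rt : forall y, 0 <= pt y <= 1)
  (Rm : forall y, 0 < pm y <= Lam)
  (start_s : ps 0 = 0) (start_m : ((INR k + 2) * PI / 2) ^ 2 <= pm 0 * gm)
  (sides : forall y l a, 0 <= y <= 1 -> 0 < l <= 1 -> - (PI / 2) <= a <= PI / 2 ->
     shooting_zero (ps y) (pt y) (pm y * l) a ->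
     Rabs (fst (flow S (pt y) (pm y * l) a) 1 - INR k * PI) <= PI / 2 ->
     l <> 1 /\ cos a <> 0 /\ cos (fst (flow S (pt y) (pm y * l) a) 1) <> 0) :
  exists l a, 0 < l <= 1 /\ - (PI / 2) < a < PI / 2 /\
    shooting_zero (ps 1) (pt 1) (pm 1 * l) a /\
    Rabs (fst (flow S (pt 1) (pm 1 * l) a) 1 - INR k * PI) < PI / 2.
Proof.
  pose proof PI_RGT_0 as HPI.
  assert (J1 : J 1) by (unfold J; lra). assert (Jm : J (-1)) by (unfold J; lra).
  assert (Cw : forall x, J x -> box_continuous (PI / 2) (fun y l a => flow_fun S (pt y) (pm y * l) a x)).
  { intros x Hx. destruct (flow_fun_box_continuous pt pm Lam x Hx Ct Cm Rt Rm) as [K1 K2].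
    unfold flow_fun. apply box_continuous_mult.
    - apply (box_continuous_comp _ _ exp); [|exact K2].
      intros z. apply (ex_derive_continuous (V := R_NormedModule)). auto_derive. easy.
    - apply (box_continuous_comp _ _ sin); [|exact K1].
      intros z. apply (ex_derive_continuous (V := R_NormedModule)). auto_derive. easy. }
  assert (Cd : forall nu, box_continuous (PI / 2)
     (fun y l a => boundary_defect S m eta al nu (ps y) (pt y) (pm y * l) a)).
  { intros nu. unfold boundary_defect.
    assert (K : box_continuous (PI / 2) (fun y l a => flow_fun S (pt y) (pm y * l) a (sgn nu) +
      (-1 * ps y) * sum_n_m (fun i => al nu i * flow_fun S (pt y) (pm y * l) a (eta nu i)) 1 (m nu))).
    { apply box_continuous_plus; [apply Cw; destruct nu; simpl; assumption|].
      apply box_continuous_mult.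
      - apply box_continuous_mult; [apply box_continuous_const|].
        apply (box_continuous_time _ ps Cs).
      - apply (box_continuous_sum _ (m nu) (fun i y l a => al nu i * flow_fun S (pt y) (pm y * l) a (eta nu i))).
        intros i Hi. apply box_continuous_mult; [apply box_continuous_const|].
        apply Cw, Hpoints, Hi. }
    intros y l a Hin eps He. destruct (K y l a Hin eps He) as (d & Hd & Hb).
    exists d. split; [easy|]. intros y' l' a' H'. specialize (Hb y' l' a' H').
    match goal with |- Rabs ?p < _ => match type of Hb with Rabs ?q < _ =>
      replace p with q by ring end end. exact Hb. }
  assert (Hsign : (-1) ^ k * (-1) ^ k = 1).
  { rewrite <- Rpow_mult_distr. replace (-1 * -1) with 1 by ring. apply pow1. }
  assert (Hsn0 : (-1) ^ k <> 0) by (intros E; rewrite E in Hsign; lra).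
  assert (Side : forall y l a, in_box (PI / 2) y l a ->
     boundary_defect S m eta al Minus (ps y) (pt y) (pm y * l) a = 0 ->
     (-1) ^ k * boundary_defect S m eta al Plus (ps y) (pt y) (pm y * l) a = 0 ->
     Rabs (fst (flow S (pt y) (pm y * l) a) 1 - INR k * PI) <= PI / 2 ->
     0 < l < 1 /\ - (PI / 2) < a < PI / 2 /\
     Rabs (fst (flow S (pt y) (pm y * l) a) 1 - INR k * PI) < PI / 2).
  { intros y l a (Hy & Hl & Ha) Z1 Z2 HN.
    apply Rmult_integral in Z2. destruct Z2 as [Z2|Z2]; [easy|].
    assert (HZ : shooting_zero (ps y) (pt y) (pm y * l) a) by (split; easy).
    assert (Hl0 : 0 < l).
    { destruct (Rle_lt_or_eq_dec 0 l) as [H|H]; [lra|easy|]. exfalso.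
      rewrite <- H, Rmult_0_r in HZ. exact (no_zero_at_0 _ _ _ (Rs y) (Rt y) HZ). }
    destruct (sides y l a Hy ltac:(lra) Ha HZ HN) as (N1 & N2 & N3).
    split; [lra|]. split.
    - assert (a <> PI / 2) by (intros ->; apply N2, cos_PI2).
      assert (a <> - (PI / 2)) by (intros ->; apply N2; rewrite cos_neg; apply cos_PI2). lra.
    - set (p := fst (flow S (pt y) (pm y * l) a) 1) in *.
      assert (p <> INR k * PI + PI / 2) by (intros E; apply N3; rewrite E; apply cos_half_odd).
      assert (p <> INR k * PI - PI / 2) by (intros E; apply N3; rewrite E; apply cos_half_odd).
      apply Rabs_le_between in HN. apply Rabs_def1; lra. }
  destruct (zero_continuation (PI / 2) (PI / 2)
    (fun y l a => boundary_defect S m eta al Minus (ps y) (pt y) (pm y * l) a)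
    (fun y l a => (-1) ^ k * boundary_defect S m eta al Plus (ps y) (pt y) (pm y * l) a)
    (fun y l a => fst (flow S (pt y) (pm y * l) a) 1 - INR k * PI)) as (l & a & Hin & Z1 & Z2 & HN).
  - lra.
  - lra.
  - apply Cd.
  - apply box_continuous_mult; [apply box_continuous_const|apply Cd].
  - apply (box_continuous_plus _ _ (fun _ _ _ => - (INR k * PI)));
      [|apply box_continuous_const].
    apply (flow_fun_box_continuous pt pm Lam 1 J1 Ct Cm Rt Rm).
  - exact Side.
  - intros l a (_ & Hl & Ha) Ha0. unfold boundary_defect. rewrite start_s, Rmult_0_l, Rminus_0_r.
    unfold flow_fun. simpl sgn.
    assert (Hml : 0 <= pm 0 * l) by (specialize (Rm 0); nra).
    rewrite (angle_start S G L gm HS) by (easy || apply Rt).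
    apply Rmult_le_pos; [apply Rlt_le, exp_pos|]. apply sin_ge_0; lra.
  - intros l a (_ & Hl & Ha) Ha0. unfold boundary_defect. rewrite start_s, Rmult_0_l, Rminus_0_r.
    unfold flow_fun. simpl sgn.
    assert (Hml : 0 <= pm 0 * l) by (specialize (Rm 0); nra).
    rewrite (angle_start S G L gm HS) by (easy || apply Rt).
    pose proof (sin_lt_0_var a ltac:(lra) Ha0). pose proof (exp_pos (snd (flow S (pt 0) (pm 0 * l) a) (-1))).
    nra.
  - intros l Hl HN. unfold boundary_defect. rewrite start_s, Rmult_0_l, Rminus_0_r.
    unfold flow_fun. simpl sgn.
    set (p := fst (flow S (pt 0) (pm 0 * l) 0) 1) in *.
    set (e := exp (snd (flow S (pt 0) (pm 0 * l) 0) 1)).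
    assert (He : 0 < e) by apply exp_pos.
    replace ((-1) ^ k * (e * sin p)) with (e * ((-1) ^ k * sin p)) by ring.
    rewrite <- sin_shift_PI. apply Rabs_def2 in HN. set (q := p - INR k * PI) in *.
    split; intros H.
    + apply Rnot_lt_le. intros Hq. pose proof (sin_lt_0_var q ltac:(lra) Hq). nra.
    + apply Rmult_le_pos; [lra|]. apply sin_ge_0; lra.
  - (* At l = 0 the angle has speed at most 1, and 2 < PI. *)
    rewrite Rmult_0_r. set (phi := fst (flow S (pt 0) 0 0)).
    assert (H : 1 - phi 1 >= -1 - phi (-1)).
    { apply Rle_ge, (derive_nonneg_le (fun s => s - phi s)
        (fun s => 1 - (cos (phi s) ^ 2 + 0 * S (pt 0) s (snd (flow S (pt 0) 0 0) s) (phi s) * sin (phi s)))); [lra| |].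
      - intros s Hs. apply derive_minus; [exact (is_derive_id s)|].
        apply (angle_derive S G L gm HS (pt 0) 0 0 (Rt 0) (Rle_refl 0)). exact Hs.
      - intros s _. pose proof (sin2_cos2 (phi s)) as E. unfold Rsqr in E.
        pose proof (pow2_ge_0 (sin (phi s))). lra. }
    assert (E0 : phi (-1) = 0) by apply (angle_start S G L gm HS (pt 0) 0 0 (Rt 0) (Rle_refl 0)).
    rewrite E0 in H. pose proof PI2_1. assert (1 <= INR k) by (change 1 with (INR 1); apply le_INR, Hk).
    nra.
  - rewrite Rmult_1_r.
    pose proof (angle_lower_bound S G L gm (pt 0) (pm 0) 0 k HS (Rt 0) start_m ltac:(lra)). lra.
  - destruct (Side 1 l a Hin Z1 Z2 (Rlt_le _ _ HN)) as (Hl & Ha & _).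
    exists l, a. split; [lra|]. split; [easy|]. split; [|easy]. split; [easy|].
    apply Rmult_integral in Z2. destruct Z2; easy.
Qed.
End Continuation.

Lemma flow_ends_of_deriv S G L gm t lam a c : polar_field S G L gm -> 0 <= t <= 1 -> 0 <= lam ->
  deriv (fun x => c * flow_fun S t lam a x) (-1) <> 0 ->
  deriv (fun x => c * flow_fun S t lam a x) 1 <> 0 ->
  cos a <> 0 /\ cos (fst (flow S t lam a) 1) <> 0.
Proof.
  intros HS Ht Hl H1 H2.
  rewrite (scaled_flow_deriv S G L gm HS) in H1, H2 by (easy || unfold J; lra).
  unfold flow_slope in H1, H2. rewrite (angle_start S G L gm HS) in H1 by easy.
  split; intros E; [apply H1|apply H2]; rewrite E; ring.
Qed.

(** At the ends of the family a zero of the shooting map is an eigenfunction for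
    the coefficients [s * al], which again satisfy the smallness condition. *)
Lemma linear_zero S G L gm m eta al k r c mu t : polar_field S G L gm -> valid_points m eta ->
  0 <= t <= 1 -> (forall x l th, S t x l th = r x * sin th) ->
  spectral_constant m eta r c -> calA m c al -> eigenvalue_sequence m eta al r mu ->
  forall s lam a, 0 <= s <= 1 -> 0 < lam -> shooting_zero S m eta al s t lam a ->
  cos a <> 0 /\ cos (fst (flow S t lam a) 1) <> 0 /\
  (s = 1 -> - (PI / 2) < a < PI / 2 ->
     Rabs (fst (flow S t lam a) 1 - INR k * PI) < PI / 2 -> lam = mu k).
Proof.
  intros HS Hv Ht Hlin Hr HA Hmu s lam a Hs Hlam HZ.
  pose proof (Rlt_le _ _ Hlam) as Hl.
  set (u := fun x => 1 * flow_fun S t lam a x).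
  set (als := fun nu i => s * al nu i).
  assert (HX : spaceX m eta als u) by (apply (spaceX_of_zero S G L gm HS); easy).
  assert (Hu : eigenfunction m eta als r lam u).
  { split; [exact HX|]. split.
    - apply (flow_fun_nonzero S G L gm HS); easy || apply R1_neq_R0.
    - intros x Hx. unfold u. rewrite (scaled_flow_Delta S G L gm HS) by easy.
      rewrite Hlin. unfold flow_fun. ring. }
  destruct (eigenfunction_nodal m eta als r c lam u Hv Hr (calA_scale m c al s Hs HA) Hu)
    as (j & Hj & D1 & D2 & Hn & Hmuj).
  destruct (flow_ends_of_deriv S G L gm t lam a 1 HS Ht Hl D1 D2) as [E1 E2].
  split; [easy|]. split; [easy|]. intros Es Ha HN.
  rewrite (Hn k Plus); [apply Hmuj|].
  - replace als with al; [exact Hmu|]. unfold als. rewrite Es.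
    extensionality nu. extensionality i. ring.
  - apply (nodalT_of_angle S G L gm HS); try easy. simpl. lra.
Qed.

Lemma interior_zero_solves g r0 rinf nu m eta al t lam a :
  admissible_g g r0 rinf -> 0 < g_min g -> 0 < t < 1 -> 0 < lam ->
  shooting_zero (blowup_field g r0 rinf nu) m eta al 1 t lam a ->
  exists c, 0 < sgn nu * c /\
    calS m eta al g lam (fun x => c * flow_fun (blowup_field g r0 rinf nu) t lam a x).
Proof.
  intros Hg Hgm Ht Hlam HZ.
  destruct (blowup_polar_field g r0 rinf nu Hg Hgm) as (G & L & HS).
  set (S := blowup_field g r0 rinf nu) in *.
  set (c := sgn nu * exp (log_amplitude t)).
  assert (Hc : 0 < sgn nu * c).
  { unfold c. pose proof (exp_pos (log_amplitude t)). destruct nu; simpl; lra. }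
  exists c. split; [easy|].
  assert (Ht' : 0 <= t <= 1) by lra. pose proof (Rlt_le _ _ Hlam) as Hl.
  split; [easy|]. split; [|split].
  - apply (flow_fun_nonzero S G L (g_min g) HS); try easy.
    intros E. rewrite E, Rmult_0_r in Hc. lra.
  - replace al with (fun nu i => 1 * al nu i) by (extensionality n; extensionality i; ring).
    apply (spaceX_of_zero S G L (g_min g) HS); easy.
  - intros x Hx. rewrite (scaled_flow_Delta S G L (g_min g) HS) by (easy || unfold J; lra).
    unfold S at 2. rewrite blowup_field_interior by easy.
    rewrite exp_plus. unfold flow_fun. fold S. unfold c.
    set (e := exp (log_amplitude t)). set (ex := exp (snd (flow S t lam a) x)).
    set (s := sin (fst (flow S t lam a) x)).
    replace (sgn nu * (e * ex * s)) with (sgn nu * e * (ex * s)) by ring. ring.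
Qed.

Lemma LambdaK_gmin g k : 0 < g_min g ->
  0 < LambdaK g k /\ LambdaK g k * g_min g = ((INR k + 2) * PI / 2) ^ 2.
Proof.
  intros Hg. unfold LambdaK. split.
  - apply Rmult_lt_0_compat; [now apply Rinv_0_lt_compat|].
    pose proof PI_RGT_0. pose proof (pos_INR k).
    apply pow_lt. nra.
  - field. lra.
Qed.

(** Suppose that there is no solution of the required type.  The zeros found by
    shooting are followed along a path of problems on [lam < mu]: at the end [ta]
    of the family, [s] goes from 0 to 1 with [mu = L] and then [mu] goes from [L]
    down to 1; after that [t] goes from [ta] to [tb].  Nothing leaves through the
    top [lam = mu]: for [mu = L] by [angle_lower_bound], at [ta] because the only
    eigenvalue with the right nodal type is below 1, and for intermediate [t]
    because a zero would be a solution at [lam = 1].  Hence [mub k < 1], a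
    contradiction.  The first part of such a path, at [tb], gives [mub k < L], hence
    [1 < L], without which the nodal hypothesis would not reach up to [lam = 1]. *)
Lemma nodal_solution_between nu m eta al k g r0 rinf ta tb ra rb ca cb mua mub L :
  valid_points m eta -> (1 <= k)%nat -> calA m 1 al ->
  admissible_g g r0 rinf -> 0 < g_min g ->
  L = LambdaK g k ->
  (ta = 0 /\ tb = 1 /\ ra = r0 /\ rb = rinf \/ ta = 1 /\ tb = 0 /\ ra = rinf /\ rb = r0) ->
  spectral_constant m eta ra ca -> calA m ca al -> eigenvalue_sequence m eta al ra mua ->
  spectral_constant m eta rb cb -> calA m cb al -> eigenvalue_sequence m eta al rb mub ->
  (forall lam u, calS m eta al g lam u -> lam <= L -> exists j,
     nodalT m eta al j Plus u \/ nodalT m eta al j Minus u) ->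
  mua k < 1 < mub k ->
  exists u, nodalT m eta al k nu u /\ solves m eta al g 1 u.
Proof.
  intros Hv Hk HA1 Hg Hgm EL Hab Hra HAa Hmua Hrb HAb Hmub Hnod Hmu.
  destruct (blowup_polar_field g r0 rinf nu Hg Hgm) as (G & Lc & HS).
  set (S := blowup_field g r0 rinf nu) in *.
  destruct (LambdaK_gmin g k Hgm) as [HL0 HL]. rewrite <- EL in HL0, HL.
  assert (Hta : 0 <= ta <= 1) by lra. assert (Htb : 0 <= tb <= 1) by lra.
  assert (Hlina : forall x l th, S ta x l th = ra x * sin th).
  { intros. destruct Hab as [(-> & _ & -> & _)|(-> & _ & -> & _)];
      [apply blowup_field_0|apply blowup_field_1]. }
  assert (Hlinb : forall x l th, S tb x l th = rb x * sin th).
  { intros. destruct Hab as [(_ & -> & _ & ->)|(_ & -> & _ & ->)];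
      [apply blowup_field_1|apply blowup_field_0]. }
  pose proof (linear_zero S G Lc _ m eta al k ra ca mua ta HS Hv Hta Hlina Hra HAa Hmua) as Za.
  pose proof (linear_zero S G Lc _ m eta al k rb cb mub tb HS Hv Htb Hlinb Hrb HAb Hmub) as Zb.
  assert (top : forall t a, 0 <= t <= 1 -> - (PI / 2) <= a ->
     ~ Rabs (fst (flow S t L a) 1 - INR k * PI) <= PI / 2).
  { intros t a Ht Ha HN. apply Rabs_le_between in HN.
    pose proof (angle_lower_bound S G Lc _ t L a k HS Ht (Req_le _ _ (eq_sym HL)) Ha). lra. }
  assert (HL1 : 1 < L).
  { destruct (shooting_continuation S G Lc _ HS m eta al k Hv Hk HA1
      (fun y => 0 + 1 * clip (1 * y + 0)) (fun _ => tb) (fun _ => L) L)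
      as (l & a & Hl & Ha & HZ & HN).
    - intros y. apply clip_affine_continuous.
    - intros y. apply continuous_const.
    - intros y. apply continuous_const.
    - intros y. pose proof (clip_range (1 * y + 0)). lra.
    - easy.
    - intros y. lra.
    - rewrite clip_low by lra. ring.
    - rewrite HL. apply Rle_refl.
    - intros y l a Hy Hl Ha HZ HN. pose proof (clip_range (1 * y + 0)).
      destruct (Zb (0 + 1 * clip (1 * y + 0)) (L * l) a) as (E1 & E2 & _); [lra|nra|easy|].
      split; [|easy]. intros ->. rewrite Rmult_1_r in HN. exact (top tb a Htb (proj1 Ha) HN).
    - assert (Ec : 0 + 1 * clip (1 * 1 + 0) = 1) by (rewrite clip_high by lra; ring).
      rewrite Ec in HZ.
      destruct (Zb 1 (L * l) a) as (_ & _ & E); [lra|nra|easy|].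
      specialize (E eq_refl Ha HN). nra. }
  apply NNPP. intros Hno.
  destruct (shooting_continuation S G Lc _ HS m eta al k Hv Hk HA1
      (fun y => 0 + 1 * clip (3 * y + 0))
      (fun y => ta + (tb - ta) * clip (3 * y + -2))
      (fun y => L + (1 - L) * clip (3 * y + -1)) L)
      as (l & a & Hl & Ha & HZ & HN).
  - intros y. apply clip_affine_continuous.
  - intros y. apply clip_affine_continuous.
  - intros y. apply clip_affine_continuous.
  - intros y. pose proof (clip_range (3 * y + 0)). lra.
  - intros y. pose proof (clip_range (3 * y + -2)). nra.
  - intros y. pose proof (clip_range (3 * y + -1)). nra.
  - rewrite clip_low by lra. ring.
  - rewrite clip_low by lra. rewrite Rmult_0_r, Rplus_0_r, HL. apply Rle_refl.
  - intros y l a Hy Hl Ha HZ HN.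
    pose proof (clip_range (3 * y + 0)) as Cs. pose proof (clip_range (3 * y + -1)) as Cm.
    pose proof (clip_range (3 * y + -2)) as Ct.
    assert (inner : cos a <> 0 -> - (PI / 2) < a < PI / 2).
    { intros E. assert (a <> PI / 2) by (intros ->; apply E, cos_PI2).
      assert (a <> - (PI / 2)) by (intros ->; apply E; rewrite cos_neg; apply cos_PI2). lra. }
    assert (strict : forall p, cos p <> 0 -> Rabs (p - INR k * PI) <= PI / 2 ->
       Rabs (p - INR k * PI) < PI / 2).
    { intros p E Hp.
      assert (p <> INR k * PI + PI / 2) by (intros ->; apply E, cos_half_odd).
      assert (p <> INR k * PI - PI / 2) by (intros ->; apply E, cos_half_odd).
      apply Rabs_le_between in Hp. apply Rabs_def1; lra. }
    destruct (Rle_lt_dec (3 * y + -2) 0) as [H2|H2].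
    + (* first two thirds of the path: the linear problem at ta *)
      rewrite (clip_low (3 * y + -2)) in * by lra.
      replace (ta + (tb - ta) * 0) with ta in * by ring.
      set (lam := (L + (1 - L) * clip (3 * y + -1)) * l) in *.
      assert (Hlam : 0 < lam) by (unfold lam; apply Rmult_lt_0_compat; nra).
      destruct (Za (0 + 1 * clip (3 * y + 0)) lam a ltac:(lra) Hlam HZ) as (E1 & E2 & E3).
      split; [|easy]. intros El.
      destruct (Rle_lt_dec (3 * y + -1) 0) as [H1|H1].
      * unfold lam in HN. rewrite (clip_low (3 * y + -1)), El in HN by lra.
        replace ((L + (1 - L) * 0) * 1) with L in HN by ring. exact (top ta a Hta (proj1 Ha) HN).
      * specialize (E3 ltac:(rewrite clip_high by lra; ring) (inner E1) (strict _ E2 HN)).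
        unfold lam in E3. rewrite El in E3. nra.
    + (* last third of the path: mu = 1 and s = 1 *)
      rewrite (clip_high (3 * y + -1)), (clip_high (3 * y + 0)) in * by lra.
      replace (0 + 1 * 1) with 1 in * by ring. replace ((L + (1 - L) * 1) * l) with l in * by ring.
      set (t := ta + (tb - ta) * clip (3 * y + -2)) in *.
      destruct (Req_dec t tb) as [Et|Et].
      { rewrite Et in *. destruct (Zb 1 l a ltac:(lra) ltac:(lra) HZ) as (E1 & E2 & E3).
        split; [|easy]. intros El.
        specialize (E3 eq_refl (inner E1) (strict _ E2 HN)). lra. }
      destruct (Req_dec t ta) as [Et'|Et'].
      { rewrite Et' in *. destruct (Za 1 l a ltac:(lra) ltac:(lra) HZ) as (E1 & E2 & E3).
        split; [|easy]. intros El.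
        specialize (E3 eq_refl (inner E1) (strict _ E2 HN)). lra. }
      assert (Ht : 0 < t < 1) by (unfold t in *; destruct Hab as [(-> & -> & _)|(-> & -> & _)]; lra).
      destruct (interior_zero_solves g r0 rinf nu m eta al t l a Hg Hgm Ht ltac:(lra) HZ)
        as (c & Hc & HSol). fold S in HSol.
      assert (E : cos a <> 0 /\ cos (fst (flow S t l a) 1) <> 0).
      { destruct (Hnod l _ HSol ltac:(lra)) as (j & [Hj|Hj]);
          refine (flow_ends_of_deriv S G Lc _ t l a c HS ltac:(lra) ltac:(lra) _ _); apply Hj. }
      destruct E as [E1 E2]. split; [|easy]. intros El. rewrite El in *.
      apply Hno. exists (fun x => c * flow_fun S t 1 a x).
      destruct HSol as (_ & _ & HSol). split; [|exact HSol].
      apply (nodalT_of_angle S G Lc _ HS);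
        first [exact (inner E1) | exact (strict _ E2 HN) | apply HSol | exact Hc | lra].
  - rewrite (clip_high (3 * 1 + 0)), (clip_high (3 * 1 + -1)), (clip_high (3 * 1 + -2)) in * by lra.
    replace (0 + 1 * 1) with 1 in * by ring. replace (ta + (tb - ta) * 1) with tb in * by ring.
    replace ((L + (1 - L) * 1) * l) with l in * by ring.
    destruct (Zb 1 l a ltac:(lra) ltac:(lra) HZ) as (_ & _ & E).
    specialize (E eq_refl Ha HN). lra.
Qed.

Theorem theorem6p5
  (m : side -> nat) (eta : side -> nat -> R)
  (Hpoints : valid_points m eta)
  (gamma : (R -> R) -> R)
  (Hgamma : forall r, C1_J r -> positive_on_J r ->
     spectral_constant m eta r (gamma r))
  (g : R -> R -> R) (r0 rinf : R -> R)
  (Hg : admissible_g g r0 rinf)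
  (Hgmin : 0 < g_min g)
  (gammag : R -> R)
  (Hgammag : forall L, 0 < L -> nodal_constant m eta g L (gammag L))
  (alpha : side -> nat -> R)
  (Halpha : forall s, norm1 (m s) (alpha s) < Rmin (gamma r0) (gamma rinf))
  (lam0 laminf : nat -> R)
  (Hlam0 : eigenvalue_sequence m eta alpha r0 lam0)
  (Hlaminf : eigenvalue_sequence m eta alpha rinf laminf)
  (k : nat) (Hk : (1 <= k)%nat)
  (Hcross : (lam0 k - 1) * (laminf k - 1) < 0)
  (Halphak : calA m (gammag (LambdaK g k)) alpha) :
  exists up um : R -> R,
    nodalT m eta alpha k Plus up /\ solves m eta alpha g 1 up /\
    nodalT m eta alpha k Minus um /\ solves m eta alpha g 1 um.
Proof.
  pose proof Hg as (_ & Hr0 & Hp0 & _ & Hr1 & Hp1 & _).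
  pose proof (Hgamma r0 Hr0 Hp0) as S0. pose proof (Hgamma rinf Hr1 Hp1) as S1.
  pose proof (Rmin_l (gamma r0) (gamma rinf)) as M0.
  pose proof (Rmin_r (gamma r0) (gamma rinf)) as M1.
  assert (A0 : calA m (gamma r0) alpha) by (intros s; specialize (Halpha s); lra).
  assert (A1 : calA m (gamma rinf) alpha) by (intros s; specialize (Halpha s); lra).
  assert (A : calA m 1 alpha).
  { intros s. specialize (A0 s). destruct S0 as [S0 _]. lra. }
  destruct (Hgammag (LambdaK g k) (proj1 (LambdaK_gmin g k Hgmin))) as [_ Hnod].
  specialize (Hnod alpha Halphak).
  assert (Hnod' : forall lam u, calS m eta alpha g lam u -> lam <= LambdaK g k ->
     exists j, nodalT m eta alpha j Plus u \/ nodalT m eta alpha j Minus u).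
  { intros lam u HS HL. destruct (Hnod lam u HS HL) as (j & _ & Hj). exists j. exact Hj. }
  assert (H : forall nu, exists u, nodalT m eta alpha k nu u /\ solves m eta alpha g 1 u).
  { intros nu. destruct (Rlt_or_le (lam0 k) 1) as [H|H].
    - apply (nodal_solution_between nu m eta alpha k g r0 rinf 0 1 r0 rinf
        (gamma r0) (gamma rinf) lam0 laminf (LambdaK g k)); try easy; [now left|split; nra].
    - assert (lam0 k <> 1) by (intros E; rewrite E in Hcross; lra).
      apply (nodal_solution_between nu m eta alpha k g r0 rinf 1 0 rinf r0
        (gamma rinf) (gamma r0) laminf lam0 (LambdaK g k)); try easy; [now right|split; nra]. }
  destruct (H Plus) as (up & P1 & P2). destruct (H Minus) as (um & Q1 & Q2).
  exists up, um. easy.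
Qed.
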